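(* Let $1<p<\infty$ and let $\omega$ be a regular weight. Then the following conditions are equivalent: (a) for $g\in\mathcal{H}(\mathbb{D})$, $T_g:A^p_\omega\to H^\infty$ is bounded if and only if $g$ is constant; (b) for $g\in\mathcal{H}(\mathbb{D})$, $T_g:A^p_\omega\to A$ is bounded if and only if $g$ is constant; (c) $\displaystyle\int_0^1\frac{dt}{[(1-t)\omega(t)]^{\frac1{p-1}}}=\infty$. In particular, if $\alpha\ge p-2$ and $T_g:A^p_\alpha\to H^\infty$ is bounded, then $g$ is constant.
   Context: $\mathbb{D}$ is the open unit disc, $\mathcal{H}(\mathbb{D})$ the space of analytic functions in $\mathbb{D}$, $H^\infty$ the bounded analytic functions with sup norm, $A$ the disc algebra (functions analytic in $\mathbb{D}$ and continuous on $\overline{\mathbb{D}}$, sup norm). $T_g(f)(z)=\int_0^z f(\zeta)g'(\zeta)\,d\zeta$. A weight is a nonnegative integrable function $\omega$ on $\mathbb{D}$; it is radial if $\omega(z)=\omega(|z|)$. For a weight $\omega$, $A^p_\omega=\{f\in\mathcal{H}(\mathbb{D}):\|f\|_{A^p_\omega}^p=\int_{\mathbb{D}}|f|^p\omega\,dA<\infty\}$, where $dA=\frac{dx\,dy}{\pi}$. $A^p_\alpha$ is the space induced by the weight $(1-|z|^2)^\alpha$. For a radial weight put $\widehat\omega(r)=\int_r^1\omega(s)\,ds$. A radial weight $\omega$ is regular if there is $C\ge1$ with $\widehat\omega(r)\le C\widehat\omega(\frac{1+r}{2})$ for all $0\le r<1$, and $\omega(r)(1-r)\asymp\widehat\omega(r)$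 for all $0\le r<1$ (two-sided comparability with positive constants independent of $r$). *)

(* Defs.v *)
From mathcomp Require Import all_boot all_order all_algebra.
From mathcomp Require Import complex.
From mathcomp Require Import all_classical all_reals all_analysis.

Set Implicit Arguments.
Unset Strict Implicit.
Unset Printing Implicit Defensive.

Import Order.TTheory GRing.Theory Num.Theory.
Import numFieldNormedType.Exports.

Local Open Scope classical_set_scope.
Local Open Scope ring_scope.
Local Open Scope complex_scope.

(* Declaring R[i] at type numFieldType gives it the norm topology and the
   derivative that MathComp-Analysis attaches to any numFieldType; its norm
   takes values in R[i], and [cabs] is the same norm with values in R. *)
Definition Cplx (R : realType) : numFieldType := R[i].

Definition cabs (R : realType) (z : Cplx R) : R := Normc.normc z.

Section UnitDisc.
Context {R : realType}.
Local Notation C := (Cplx R).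
Local Notation planar_lebesgue :=
  (@lebesgue_measure R \x @lebesgue_measure R)%E.
Implicit Types (f g : C -> C) (w : C -> R) (p r : R).

Definition unit_disc : set C := [set z | `|z| < 1].
Definition closed_unit_disc : set C := [set z | `|z| <= 1].

(* Functions on the disc are represented by total functions on the plane; every
   notion below depends only on their values in the disc. *)
Definition analytic f : Prop :=
  forall z, unit_disc z -> derivable (f : C -> C^o) z 1.

Definition constant_on_disc g : Prop :=
  exists c : C, forall z, unit_disc z -> g z = c.

Definition planar_disc : set (R * R) := [set u | unit_disc (u.1 +i* u.2)].

Definition area_integral (F : C -> \bar R) : \bar R :=
  ((pi^-1)%:E * \int[planar_lebesgue]_(u in planar_disc) F (u.1 +i* u.2))%E.

(* The sigma-algebra on R * R is the Borel one, so Lebesgue integrability of w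
   is spelled out as: w agrees almost everywhere on the disc with a
   Borel-measurable integrable function. The library integral of a nonnegative
   function is the supremum over simple functions below it and requires no
   measurability, so on Lebesgue-measurable functions it is their Lebesgue
   integral. *)
Definition weight w : Prop :=
  (forall z, unit_disc z -> 0 <= w z) /\
  exists h : R * R -> R,
    planar_lebesgue.-integrable planar_disc (EFin \o h) /\
    {ae planar_lebesgue, forall u, planar_disc u -> w (u.1 +i* u.2) = h u}.

Definition radial w : Prop :=
  forall z, unit_disc z -> w z = w (cabs z)%:C.

Definition omega_hat w r : \bar R :=
  (\int[lebesgue_measure]_(s in `[r, 1%R[) (w s%:C)%:E)%E.

Definition regular_weight w : Prop :=
  [/\ weight w,
      radial w,
      exists2 K : R, 1 <= K &
        forall r, 0 <= r < 1 -> (omega_hat w r <= K%:E * omega_hat w ((1 + r) / 2)%R)%E &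
      exists c1 c2 : R, [/\ 0 < c1, 0 < c2 &
        forall r, 0 <= r < 1 ->
          (c1%:E * omega_hat w r <= (w r%:C * (1 - r))%R%:E <= c2%:E * omega_hat w r)%E]].

Definition bergman_integral p w f : \bar R :=
  area_integral (fun z => (cabs (f z) `^ p * w z)%:E).

Definition bergman_space p w : set (C -> C) :=
  [set f | analytic f /\ (bergman_integral p w f < +oo)%E].

Definition bergman_norm p w f : R := fine (bergman_integral p w f) `^ p^-1.

Definition standard_weight (alpha : R) : C -> R :=
  fun z => (1 - cabs z ^+ 2) `^ alpha.

Definition sup_norm f : R := sup [set cabs (f z) | z in unit_disc].

Definition Hinfty : set (C -> C) :=
  [set f | analytic f /\ exists M : R, forall z, unit_disc z -> cabs (f z) <= M].

Definition disc_algebra : set (C -> C) :=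
  [set f | analytic f /\
    exists2 F : C -> C, {within closed_unit_disc, continuous F} &
      forall z, unit_disc z -> F z = f z].

Definition cintegral01 (h : R -> C) : C :=
  (\int[lebesgue_measure]_(t in `[0, 1]) complex.Re (h t)) +i*
  (\int[lebesgue_measure]_(t in `[0, 1]) complex.Im (h t)).

(* The line integral of f g' along the segment t |-> t z from 0 to z. *)
Definition volterra g f : C -> C :=
  fun z => cintegral01 (fun t : R =>
    f (t%:C * z) * derive1 (g : C -> C^o) (t%:C * z) * z).

Definition bounded_operator (X : set (C -> C)) (normX : (C -> C) -> R)
    (Y : set (C -> C)) (normY : (C -> C) -> R)
    (S : (C -> C) -> (C -> C)) : Prop :=
  (forall f, X f -> Y (S f)) /\
  exists M : R, forall f, X f -> normY (S f) <= M * normX f.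

Definition T_bounded_to_Hinfty p w g : Prop :=
  bounded_operator (bergman_space p w) (bergman_norm p w)
    Hinfty sup_norm (volterra g).

(* On the disc algebra the supremum over the open disc equals, by continuity,
   the one over the closed disc. *)
Definition T_bounded_to_disc_algebra p w g : Prop :=
  bounded_operator (bergman_space p w) (bergman_norm p w)
    disc_algebra sup_norm (volterra g).

End UnitDisc.

(* Main.v *)
Require Import Defs.
From mathcomp Require Import all_boot all_order all_algebra.
From mathcomp Require Import complex.
From mathcomp Require Import all_classical all_reals all_analysis.
From mathcomp Require Import measurable_realfun zify ring lra.
Set Implicit Arguments.
Unset Strict Implicit.
Unset Printing Implicit Defensive.
Import Order.TTheory GRing.Theory Num.Theory.
Import numFieldNormedType.Exports.
Local Open Scope classical_set_scope.
Local Open Scope ring_scope.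
Local Open Scope complex_scope.

(** Put r_m = 1 - 2^-m ([rad]), W_m = omega_hat(r_m) and b_m = W_m^(-1/(p-1)) ([bseq]). Regularity
    says that W_m / W_{m+1} lies between two constants, the lower one above 1, and that w is
    comparable to 2^m W_m on the annulus r_m <= |z| < r_{m+1} ([regular_dyadic], [dyadic_annulus]).
    When the W_m are positive, the integral of the third condition is therefore infinite exactly
    when the sums S_n of b_k 2^-k over k < n ([Sseq]) are unbounded. The exponent is the one for
    which b_m^p W_m = b_m.

    Unbounded S_n. The test function f_n(z) = sum over k < n of b_k (2^k - (2^k - 1) z
    e^(-it))^(-N), with N large, is at most a multiple of b_j where |1 - z e^(-it)| is about 2^-j,
    so its norm to the power p is at most a multiple of S_n, uniformly in t ([ftest_norm]). If T_g
    is bounded, |T_g f_n| at r_n e^(it) is at most a multiple of S_n^(1/p). Integrating over t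
    against e^(-i(m+1)t) isolates the m-th Taylor coefficient of g', multiplied by a radial integral
    of f_n that is at least a multiple of S_n - b_0 ([average_le], [ftest_integral_ge]). Since p >
    1, letting S_n grow forces every coefficient to vanish, so g is constant ([bounded_constant]).

    Bounded S_n. The symbol id sends f to its primitive. A mean value inequality bounds |f|^p on the
    k-th annulus by 2^k / W_k times the weighted mass of f on neighbouring annuli ([shell_bound]),
    whence |f| <= 2^k y_k there, with the sum of the y_k at most a multiple of the norm of f
    ([annulus_growth]). The increments of the primitive between the radii r_n and r_{n+1} are then
    uniformly summable, so it extends continuously to the closed disc, with a norm bound
    ([primitive_disc_algebra], [identity_bounded]). As id is not constant, the first two conditions
    both fail.

    A constant symbol gives the operator 0, and boundedness into the disc algebra implies
    boundedness into the bounded functions, so each of the first two conditions is equivalent to the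
    third. If some W_m is 0 then w vanishes on the disc: the integral is infinite because 1/0 = +oo,
    and w lies below a standard weight. The standard weights with alpha >= p - 2 enter the first
    half directly, with W_m = 2^(-(alpha+1)m) and S_n >= n.

    The function theory rests on one instance of Goursat's argument, [cone_goursat], for the image
    of a rectangle under (s, t) -> a + s * gam t. Segments give primitives, circles give Cauchy's
    formula, and the sides of a rectangle give the mean value inequality. *)

Local Notation Re := complex.Re.
Local Notation Im := complex.Im.
#[local] Arguments cabs {R} z : simpl never.

(** * Modulus, real and imaginary parts, complex derivative *)

Section ComplexBasics.
Context {R : realType}.
Local Notation C := (Cplx R).
Implicit Types (z w : C) (x y : R).

Lemma normE z : `|z| = (cabs z)%:C.
Proof. by case: z. Qed.

Lemma unit_discE z : unit_disc z <-> cabs z < 1.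
Proof.
by rewrite /unit_disc /= normE -[1]/(1%:C) ltcR.
Qed.

Lemma closed_unit_discE z : closed_unit_disc z <-> cabs z <= 1.
Proof. by rewrite /closed_unit_disc /= normE -[1]/(1%:C) lecR. Qed.

Lemma cabs_ge0 z : 0 <= cabs z.
Proof. by case: z => a b; exact: sqrtr_ge0. Qed.

Lemma cabsM z w : cabs (z * w) = cabs z * cabs w.
Proof. exact: Normc.normcM. Qed.

Lemma cabsV z : cabs z^-1 = (cabs z)^-1.
Proof. exact: Normc.normcV. Qed.

Lemma cabs0 : cabs (0 : C) = 0. Proof. exact: Normc.normc0. Qed.
Lemma cabs1 : cabs (1 : C) = 1. Proof. exact: Normc.normc1. Qed.

Lemma cabsN z : cabs (- z) = cabs z.
Proof. by case: z => a b; rewrite /cabs /= !sqrrN. Qed.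

Lemma cabsD z w : cabs (z + w) <= cabs z + cabs w.
Proof.
rewrite -lecR rmorphD /=.
by move: (ler_normD z w); rewrite !normE.
Qed.

Lemma cabsB z w : cabs (z - w) <= cabs z + cabs w.
Proof. by rewrite -(cabsN w) cabsD. Qed.

Lemma cabs_eq0 z : (cabs z == 0) = (z == 0).
Proof.
apply/eqP/eqP => [|->]; [exact: Normc.eq0_normc | exact: cabs0].
Qed.

Lemma cabs_gt0 z : (0 < cabs z) = (z != 0).
Proof. by rewrite lt_def cabs_ge0 cabs_eq0 andbT. Qed.

Lemma cabsR x : cabs (x%:C : C) = `|x|.
Proof. by rewrite /cabs /= expr0n addr0 sqrtr_sqr. Qed.

Lemma cabsX z n : cabs (z ^+ n) = cabs z ^+ n.
Proof. by elim: n => [|n IH]; rewrite ?expr0 ?cabs1 // !exprS cabsM IH. Qed.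

Lemma cabs_distC z w : cabs (z - w) = cabs (w - z).
Proof. by rewrite -cabsN opprB. Qed.

Lemma cabs_subl z w : cabs z - cabs w <= cabs (z - w).
Proof. by rewrite lerBlDr -{1}(subrK w z) cabsD. Qed.

Lemma Re_le z : `|Re z| <= cabs z.
Proof.
case: z => a b; rewrite /cabs /= -sqrtr_sqr ler_sqrt ?addr_ge0 ?sqr_ge0 //.
by rewrite lerDl sqr_ge0.
Qed.

Lemma Im_le z : `|Im z| <= cabs z.
Proof.
case: z => a b; rewrite /cabs /= -sqrtr_sqr ler_sqrt ?addr_ge0 ?sqr_ge0 //.
by rewrite lerDr sqr_ge0.
Qed.

Lemma cabs_le_ReIm z : cabs z <= `|Re z| + `|Im z|.
Proof.
case: z => a b /=; rewrite -[leRHS]ger0_norm ?addr_ge0 // -[leRHS]sqrtr_sqr.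
rewrite /cabs /= ler_sqrt ?sqr_ge0 // sqrrD !real_normK ?num_real //.
rewrite -addrA lerD2l lerDr; apply: mulrn_wge0; apply: mulr_ge0 => //.
Qed.

Lemma cabs_sqr z : cabs z ^+ 2 = Re z ^+ 2 + Im z ^+ 2.
Proof. by case: z => a b; rewrite /cabs /= sqr_sqrtr // addr_ge0 ?sqr_ge0. Qed.

Lemma cReD z w : Re (z + w) = Re z + Re w. Proof. by case: z w => a b []. Qed.
Lemma cImD z w : Im (z + w) = Im z + Im w. Proof. by case: z w => a b []. Qed.
Lemma cReN z : Re (- z) = - Re z. Proof. by case: z. Qed.
Lemma cImN z : Im (- z) = - Im z. Proof. by case: z. Qed.
Lemma cReM z w : Re (z * w) = Re z * Re w - Im z * Im w.
Proof. by case: z w => a b []. Qed.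
Lemma cImM z w : Im (z * w) = Re z * Im w + Im z * Re w.
Proof. by case: z w => a b []. Qed.

Lemma complex_ext z w : Re z = Re w -> Im z = Im w -> z = w.
Proof. by case: z w => a b [c d] /= -> ->. Qed.

(** A first-order expansion with real tolerances. It is free of division, so the increment 0 needs
    no exclusion and estimates can be added directly. *)
Definition cderiv (h : C -> C) (w l : C) := forall e : R, 0 < e ->
  exists2 d : R, 0 < d & forall k, cabs k < d ->
    cabs (h (w + k) - h w - l * k) <= e * cabs k.

Lemma cball z (e : R) w : ball z e%:C w = (cabs (z - w) < e).
Proof. by rewrite -ball_normE /= normE ltcR. Qed.

Lemma gt0_complexE (e : C) : 0 < e -> exists2 r : R, 0 < r & e = r%:C.
Proof.
case: e => a b; rewrite ltcE /= => /andP[/eqP -> a0].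
by exists a.
Qed.

Lemma ltc0R (x : R) : ((0 : C) < x%:C) = (0 < x).
Proof. by rewrite -[0]/(0%:C) ltcR. Qed.

Lemma cvg_cderiv (f : C -> C^o) z l :
  (fun h => h^-1 *: ((f \o shift z) (h *: 1) - f z)) @ (0 : C)^' --> (l : C^o) <->
  cderiv f z l.
Proof.
split.
- move=> /cvgrPdist_lt H e e0.
  have e0' : (0 : C) < e%:C by rewrite ltc0R.
  have [d d0 Hd] := H _ e0'.
  have [r r0 dr] := gt0_complexE d0; exists r => // k kr.
  have [->|k0] := eqVneq k 0.
    by rewrite addr0 subrr mulr0 subrr cabs0 mulr0.
  have /Hd : ball_ (fun x : C => `|x|) 0 d k.
    by rewrite /ball_ /= sub0r normrN normE dr ltcR.
  move=> /(_ k0) /=; rewrite normE ltcR => /ltW Hk.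
  have -> : f (z + k) - f z - l * k = - (l - k^-1 * (f (k * 1 + z) - f z)) * k.
    by rewrite mulr1 (addrC k) opprB mulrBl mulrAC mulVf // mul1r.
  by rewrite cabsM cabsN; apply: ler_wpM2r => //; exact: cabs_ge0.
- move=> H; apply/cvgrPdist_le => e /gt0_complexE[r r0 ->].
  have [d d0 Hd] := H _ r0.
  exists d%:C; first by rewrite /= ltc0R.
  move=> k; rewrite /ball_ /= sub0r normrN => + k0.
  rewrite normE ltcR => kd; rewrite normE lecR.
  have kn0 : 0 < cabs k by rewrite cabs_gt0.
  rewrite -(ler_pM2r kn0) -cabsM.
  have -> : (l - k^-1 *: (f (k *: (1 : C) + z) - f z)) * k =
     - (f (z + k) - f z - l * k).
    rewrite -[k *: _]/(k * 1) -[k^-1 *: _]/(k^-1 * _) mulr1 (addrC k).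
    by rewrite mulrBl mulrAC mulVf // mul1r [in RHS]opprB.
  by rewrite cabsN; exact: Hd.
Qed.

Lemma derive1_cderiv (f : C -> C) z : derivable (f : C -> C^o) z 1 ->
  cderiv f z (derive1 (f : C -> C^o) z).
Proof.
move=> df; apply/cvg_cderiv; rewrite derive1E; exact: df.
Qed.

Lemma cderiv_derivable (f : C -> C) z l : cderiv f z l ->
  derivable (f : C -> C^o) z 1 /\ derive1 (f : C -> C^o) z = l.
Proof.
move=> /cvg_cderiv H; split; first by apply/cvg_ex; exists l.
by rewrite derive1E; apply: cvg_lim => //.
Qed.

End ComplexBasics.

(** * Goursat's bisection as a principle on real rectangles *)

Section Bisection.
Context {R : realType}.
Variables (e : R -> R -> R -> R -> R) (x0 y0 u0 v0 : R).
Hypotheses (u0_ge0 : 0 <= u0) (v0_ge0 : 0 <= v0).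

Let inside x y u v :=
  [/\ x0 <= x, x + u <= x0 + u0, y0 <= y & y + v <= y0 + v0].

Hypothesis e_quarters : forall x y u v, 0 <= u -> 0 <= v ->
  inside x y (u + u) (v + v) ->
  e x y (u + u) (v + v) <=
    e x y u v + e (x + u) y u v + (e x (y + v) u v + e (x + u) (y + v) u v).

Hypothesis e_local : forall x1 y1, x0 <= x1 <= x0 + u0 -> y0 <= y1 <= y0 + v0 ->
  forall eps, 0 < eps -> exists2 d, 0 < d &
    forall x y u v, inside x y u v -> x <= x1 <= x + u -> y <= y1 <= y + v ->
      u < d -> v < d -> e x y u v <= eps * (u + v) ^+ 2.

Let u_ n := u0 / 2 ^+ n.
Let v_ n := v0 / 2 ^+ n.

Let u_S n : u_ n = u_ n.+1 + u_ n.+1.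
Proof. by rewrite /u_ exprS; field; rewrite expf_neq0. Qed.
Let v_S n : v_ n = v_ n.+1 + v_ n.+1.
Proof. by rewrite /v_ exprS; field; rewrite expf_neq0. Qed.
Let u_ge0 n : 0 <= u_ n. Proof. by rewrite divr_ge0 ?exprn_ge0. Qed.
Let v_ge0 n : 0 <= v_ n. Proof. by rewrite divr_ge0 ?exprn_ge0. Qed.

Let step t n (P : R * R) : R * R :=
  let u := u_ n.+1 in let v := v_ n.+1 in
  if t <= e P.1 P.2 u v then P else
  if t <= e (P.1 + u) P.2 u v then (P.1 + u, P.2) else
  if t <= e P.1 (P.2 + v) u v then (P.1, P.2 + v) else (P.1 + u, P.2 + v).

(** If the value were eta > 0, some quarter would carry at least eta / 4, and so on; the nested
    rectangles shrink to a point, where the local estimate makes their values too small. Applied to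
    contour integrals, to functions with zero derivative and to boundedness on the closed disc. *)
Lemma bisection_le0 : e x0 y0 u0 v0 <= 0.
Proof.
rewrite leNgt; apply/negP => eta_gt0; set eta := e _ _ _ _ in eta_gt0.
(* Lower left corners of the selected quarters, each of which still carries eta / 4 ^+ n. In the
   last branch of [step] the fourth quarter must qualify, since the other three do not. *)
pose Q := fix Q n := if n is m.+1 then step (eta / 4 ^+ m.+1) m (Q m) else (x0, y0).
have Qin n : inside (Q n).1 (Q n).2 (u_ n) (v_ n) /\
    eta / 4 ^+ n <= e (Q n).1 (Q n).2 (u_ n) (v_ n).
  elim: n => [|n [[h1 h2 h3 h4] IH]].
    by rewrite /u_ /v_ !expr0 !divr1; split.
  have := @e_quarters (Q n).1 (Q n).2 (u_ n.+1) (v_ n.+1) (u_ge0 _) (v_ge0 _).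
  rewrite -u_S -v_S => /(_ (And4 h1 h2 h3 h4)) hq.
  have := u_ge0 n.+1; have := v_ge0 n.+1; move: (u_S n) (v_S n) => us vs u1 v1.
  have e4 : eta / 4 ^+ n = 4 * (eta / 4 ^+ n.+1).
    by rewrite exprS; field; rewrite expf_neq0.
  rewrite /= /step; set t := eta / 4 ^+ n.+1.
  case: ifPn => [c1|/negP/negP]; first by split => //; split => //=; lra.
  rewrite -ltNge => c1.
  case: ifPn => [c2|/negP/negP]; first by split => //; split => //=; lra.
  rewrite -ltNge => c2.
  case: ifPn => [c3|/negP/negP]; first by split => //; split => //=; lra.
  rewrite -ltNge => c3.
  split; first by split => //=; lra.
  by move: IH; rewrite e4 -/t /= => IH; lra.
have Qstep n : (Q n).1 <= (Q n.+1).1 /\ (Q n.+1).1 + u_ n.+1 <= (Q n).1 + u_ n /\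
   (Q n).2 <= (Q n.+1).2 /\ (Q n.+1).2 + v_ n.+1 <= (Q n).2 + v_ n.
  have := u_ge0 n.+1; have := v_ge0 n.+1; move: (u_S n) (v_S n) => us vs u1 v1.
  by rewrite /= /step; do 3![case: ifPn => _ /=; first by do ?split => //; lra];
    do ?split => //; lra.
have Qmono m n : (m <= n)%N -> (Q m).1 <= (Q n).1 /\ (Q n).1 + u_ n <= (Q m).1 + u_ m /\
   (Q m).2 <= (Q n).2 /\ (Q n).2 + v_ n <= (Q m).2 + v_ m.
  move=> /subnK <-; elim: (n - m)%N => [|k [a [b [c d]]]]; first by rewrite add0n.
  rewrite addSn; have [a' [b' [c' d']]] := Qstep (k + m)%N.
  split; first exact: le_trans a a'.
  split; first exact: le_trans b' b.
  split; first exact: le_trans c c'.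
  exact: le_trans d' d.
have Qcross m n : (Q m).1 <= (Q n).1 + u_ n /\ (Q m).2 <= (Q n).2 + v_ n.
  have [a [b [c d]]] := Qmono _ _ (leq_maxl m n).
  have [a' [b' [c' d']]] := Qmono _ _ (leq_maxr m n).
  have := u_ge0 (maxn m n); have := v_ge0 (maxn m n).
  by split; lra.
(* The corners increase in each coordinate and stay below every upper right corner, so the two
   suprema give a point common to all the rectangles. *)
pose X := [set (Q n).1 | n in setT]; pose Y := [set (Q n).2 | n in setT].
have lim1 n : (Q n).1 <= sup X <= (Q n).1 + u_ n.
  apply/andP; split.
    apply: ub_le_sup; last by exists n.
    by exists ((Q n).1 + u_ n) => _ [m _ <-]; case: (Qcross m n).
  apply: ge_sup; first by exists (Q 0%N).1; exists 0%N.
  by move=> _ [m _ <-]; case: (Qcross m n).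
have lim2 n : (Q n).2 <= sup Y <= (Q n).2 + v_ n.
  apply/andP; split.
    apply: ub_le_sup; last by exists n.
    by exists ((Q n).2 + v_ n) => _ [m _ <-]; case: (Qcross m n).
  apply: ge_sup; first by exists (Q 0%N).2; exists 0%N.
  by move=> _ [m _ <-]; case: (Qcross m n).
have uv_gt0 : 0 < (u0 + v0) ^+ 2 + 1 by rewrite ltr_wpDl // sqr_ge0.
have h1 := lim1 0%N; have h2 := lim2 0%N.
rewrite /u_ /v_ !expr0 !divr1 /= in h1 h2.
(* Since (u_n + v_n)^2 = (u0 + v0)^2 / 4^n, this tolerance makes the local bound smaller than eta /
   4^n; the + 1 covers a degenerate rectangle. *)
have eps_gt0 : 0 < eta / (2 * ((u0 + v0) ^+ 2 + 1)).
  by rewrite divr_gt0 // mulr_gt0.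
have [d d_gt0 Hd] := e_local h1 h2 eps_gt0.
have [n Hn] : exists n, (u0 + v0) / 2 ^+ n < d.
  exists (Num.bound ((u0 + v0) / d)).
  rewrite ltr_pdivrMr ?exprn_gt0 // mulrC -ltr_pdivrMr //.
  apply: (lt_trans (archi_boundP _)); first by rewrite divr_ge0 ?addr_ge0 // ltW.
  by rewrite -natrX ltr_nat ltn_expl.
have [Hin He] := Qin n.
have un : u_ n < d.
  by apply: le_lt_trans Hn; rewrite ler_wpM2r ?invr_ge0 ?exprn_ge0 // lerDl.
have vn : v_ n < d.
  by apply: le_lt_trans Hn; rewrite ler_wpM2r ?invr_ge0 ?exprn_ge0 // lerDr.
have := le_trans He (Hd _ _ _ _ Hin (lim1 n) (lim2 n) un vn).
have -> : (u_ n + v_ n) ^+ 2 = (u0 + v0) ^+ 2 / 4 ^+ n.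
  have -> : (4 : R) = 2 ^+ 2 by rewrite -natrX.
  by rewrite /u_ /v_ -mulrDl expr_div_n -!exprM mulnC.
rewrite mulrA ler_pM2r ?invr_gt0 ?exprn_gt0 //.
rewrite mulrAC ler_pdivlMr ?mulr_gt0 // ler_pM2l //.
have := sqr_ge0 (u0 + v0); set q := (_ ^+ 2); lra.
Qed.

End Bisection.

(** * Integrals of complex functions of a real variable *)

Section ComplexIntegral.
Context {R : realType}.
Local Notation C := (Cplx R).
Local Notation mu := (@lebesgue_measure R).
Implicit Types (a b c : R) (f : R -> R) (phi psi : R -> C).

Definition ccont a b phi := forall x, a <= x <= b -> forall e : R, 0 < e ->
  exists2 d : R, 0 < d & forall y, a <= y <= b -> `|y - x| < d ->
    cabs (phi y - phi x) <= e.

Definition cint a b phi : C :=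
  (\int[mu]_(t in `[a, b]) Re (phi t)) +i* (\int[mu]_(t in `[a, b]) Im (phi t)).

Lemma ccont_within a b phi : ccont a b phi ->
  {within `[a, b], continuous (fun t => Re (phi t))} /\
  {within `[a, b], continuous (fun t => Im (phi t))}.
Proof.
move=> H; split; apply/subspace_continuousP => x /=; rewrite in_itv /= => xab;
  apply/cvgrPdist_le => e e0; have [d d0 Hd] := H x xab e e0;
  exists d => //= y; rewrite /ball_ /= distrC => yd; rewrite in_itv /= => yab;
  apply: le_trans (Hd y yab yd); rewrite distrC.
  by rewrite -cReN -cReD; exact: Re_le.
by rewrite -cImN -cImD; exact: Im_le.
Qed.

Lemma within_integrable a b f : {within `[a, b], continuous f} ->
  mu.-integrable `[a, b] (EFin \o f).
Proof. by move=> cf; apply: continuous_compact_integrable => //; exact: segment_compact. Qed.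

Lemma ccont_integrable a b phi : ccont a b phi ->
  mu.-integrable `[a, b] (EFin \o (fun t => Re (phi t))) /\
  mu.-integrable `[a, b] (EFin \o (fun t => Im (phi t))).
Proof. by move=> /ccont_within[h1 h2]; split; exact: within_integrable. Qed.

Lemma ccontW a b c d phi : a <= c -> d <= b -> ccont a b phi -> ccont c d phi.
Proof.
move=> ac db H x /andP[cx xd] e e0.
have [|r r0 Hr] := H x _ e e0; first by apply/andP; split; lra.
by exists r => // y /andP[cy yd]; apply: Hr; apply/andP; split; lra.
Qed.

Lemma ccont_cst a b (z : C) : ccont a b (fun=> z).
Proof. by move=> x _ e e0; exists 1 => // y _ _; rewrite subrr cabs0 ltW. Qed.

Lemma ccont_ext a b phi psi : (forall x, a <= x <= b -> phi x = psi x) ->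
  ccont a b phi -> ccont a b psi.
Proof.
move=> E H x xab e e0; have [d d0 Hd] := H x xab e e0.
by exists d => // y yab yd; rewrite -!E //; exact: Hd.
Qed.

Lemma ccontD a b phi psi : ccont a b phi -> ccont a b psi ->
  ccont a b (fun t => phi t + psi t).
Proof.
move=> H K x xab e e0; have e2 : 0 < e / 2 by rewrite divr_gt0.
have [d d0 Hd] := H x xab _ e2; have [d' d0' Hd'] := K x xab _ e2.
exists (Num.min d d'); first by rewrite lt_min d0.
move=> y yab; rewrite lt_min => /andP[yd yd'].
have -> : phi y + psi y - (phi x + psi x) = (phi y - phi x) + (psi y - psi x) by ring.
by apply: le_trans (cabsD _ _) _; have := Hd y yab yd; have := Hd' y yab yd'; lra.
Qed.

Lemma ccontM a b phi psi : ccont a b phi -> ccont a b psi ->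
  ccont a b (fun t => phi t * psi t).
Proof.
move=> H K x xab e e0.
pose A := cabs (psi x) + 1; pose B := cabs (phi x) + 1.
have A0 : 0 < A by rewrite ltr_wpDl // cabs_ge0.
have B0 : 0 < B by rewrite ltr_wpDl // cabs_ge0.
have eB : 0 < Num.min 1 (e / (2 * B)) by rewrite lt_min ltr01 /= divr_gt0 // mulr_gt0.
have eA : 0 < e / (2 * A) by rewrite divr_gt0 // mulr_gt0.
have [d d0 Hd] := H x xab _ eA; have [d' d0' Hd'] := K x xab _ eB.
exists (Num.min d d'); first by rewrite lt_min d0.
move=> y yab; rewrite lt_min => /andP[yd yd'].
have -> : phi y * psi y - phi x * psi x =
  (phi y - phi x) * psi y + phi x * (psi y - psi x) by ring.
apply: le_trans (cabsD _ _) _; rewrite !cabsM.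
have h1 := Hd y yab yd; have := Hd' y yab yd'; rewrite le_min => /andP[h2 h3].
have h4 : cabs (psi y) <= A.
  by rewrite -(subrK (psi x) (psi y)) /A addrC; apply: le_trans (cabsD _ _) _; lra.
have -> : e = e / (2 * A) * A + B * (e / (2 * B)).
  by field; rewrite !lt0r_neq0.
apply: lerD; apply: ler_pM; rewrite ?cabs_ge0 //.
by rewrite /B lerDl.
Qed.

Lemma ccontN a b phi : ccont a b phi -> ccont a b (fun t => - phi t).
Proof.
move=> H; apply: (@ccont_ext _ _ (fun t => -1 * phi t)) => [x _|]; first by rewrite mulN1r.
by apply: ccontM => //; exact: ccont_cst.
Qed.

Lemma ccontB a b phi psi : ccont a b phi -> ccont a b psi ->
  ccont a b (fun t => phi t - psi t).
Proof. by move=> H K; apply: ccontD => //; exact: ccontN. Qed.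

Lemma ccontV a b phi : (forall x, a <= x <= b -> phi x != 0) ->
  ccont a b phi -> ccont a b (fun t => (phi t)^-1).
Proof.
move=> N H x xab e e0; pose A := cabs (phi x).
have A0 : 0 < A by rewrite cabs_gt0 N.
have eA : 0 < Num.min (A / 2) (e * A ^+ 2 / 2).
  by rewrite lt_min !divr_gt0 // mulr_gt0 // exprn_gt0.
have [d d0 Hd] := H x xab _ eA; exists d => // y yab yd.
have := Hd y yab yd; rewrite le_min => /andP[h1 h2].
have h3 : A / 2 <= cabs (phi y).
  by have := cabs_subl (phi x) (phi y); rewrite cabs_distC -/A; lra.
have -> : (phi y)^-1 - (phi x)^-1 = - (phi y - phi x) * ((phi y)^-1 * (phi x)^-1).
  by field; rewrite !N.
rewrite !cabsM cabsN !cabsV -/A.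
have : (cabs (phi y))^-1 <= (A / 2)^-1 by rewrite lef_pV2 // posrE; lra.
move=> h4; apply: (@le_trans _ _ (e * A ^+ 2 / 2 * ((A / 2)^-1 * A^-1))).
  apply: ler_pM => //; rewrite ?cabs_ge0 ?mulr_ge0 ?invr_ge0 ?cabs_ge0 ?(ltW A0) //.
  by rewrite ler_wpM2r // invr_ge0 ltW.
by rewrite le_eqVlt; apply/orP; left; apply/eqP; field; rewrite lt0r_neq0.
Qed.

Lemma ccontX a b phi n : ccont a b phi -> ccont a b (fun t => phi t ^+ n).
Proof.
move=> H; elim: n => [|n IH]; first exact: ccont_cst.
apply: (@ccont_ext _ _ (fun t => phi t * phi t ^+ n)) => [x _|]; first by rewrite exprS.
exact: ccontM.
Qed.

Lemma cderiv_cont (h : C -> C) w l : cderiv h w l -> forall e : R, 0 < e ->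
  exists2 d : R, 0 < d & forall z, cabs (z - w) < d -> cabs (h z - h w) <= e.
Proof.
move=> H e e0; have [d d0 Hd] := H 1 ltr01.
pose B := cabs l + 1.
have B0 : 0 < B by rewrite ltr_wpDl // cabs_ge0.
exists (Num.min d (e / B)); first by rewrite lt_min d0 divr_gt0.
move=> z; rewrite lt_min => /andP[zd zB].
have E : w + (z - w) = z by ring.
have := Hd _ zd; rewrite E mul1r => h1.
have -> : h z - h w = (h z - h w - l * (z - w)) + l * (z - w) by ring.
apply: le_trans (cabsD _ _) _; rewrite cabsM.
move: zB; rewrite ltr_pdivlMr //.
by rewrite /B; lra.
Qed.

Lemma ccont_comp a b (h : C -> C) phi :
  (forall x, a <= x <= b -> exists l, cderiv h (phi x) l) ->
  ccont a b phi -> ccont a b (fun t => h (phi t)).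
Proof.
move=> H K x xab e e0; have [l /cderiv_cont Hl] := H x xab.
have [d d0 Hd] := Hl e e0.
have d2 : 0 < d / 2 by rewrite divr_gt0.
have [r r0 Hr] := K x xab _ d2.
exists r => // y yab yr; apply: Hd.
by apply: le_lt_trans (Hr y yab yr) _; lra.
Qed.

Lemma continuous_ccont f g a b : continuous f -> continuous g ->
  ccont a b (fun t => (f t +i* g t : C)).
Proof.
move=> cf cg x _ e e0.
have e2 : 0 < e / 2 by rewrite divr_gt0.
have /cvgrPdist_le /(_ _ e2) [d d0 Hd] := cf x.
have /cvgrPdist_le /(_ _ e2) [d' d0' Hd'] := cg x.
exists (Num.min d d'); first by rewrite lt_min d0.
move=> y _; rewrite lt_min distrC => /andP[yd yd'].
have := Hd' y yd'; rewrite /= distrC => h1.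
have := Hd y yd; rewrite /= distrC => h2.
by apply: (le_trans (cabs_le_ReIm _)) => /=; lra.
Qed.

Lemma ccont_id a b : ccont a b (fun t => t%:C).
Proof.
apply: (@continuous_ccont (fun t => t) (fun=> 0)) => x; first exact: cvg_id.
exact: cvg_cst.
Qed.

Lemma cint_ext a b phi psi : (forall x, a <= x <= b -> phi x = psi x) ->
  cint a b phi = cint a b psi.
Proof.
by move=> E; rewrite /cint; congr (_ +i* _); apply: eq_Rintegral => x;
  rewrite inE /= in_itv /= => xab; rewrite E.
Qed.

Lemma cintD a b phi psi : ccont a b phi -> ccont a b psi ->
  cint a b (fun t => phi t + psi t) = cint a b phi + cint a b psi.
Proof.
move=> /ccont_integrable[h1 h2] /ccont_integrable[h3 h4].
apply: complex_ext; rewrite /cint /= -RintegralD //; apply: eq_Rintegral => x _.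
  exact: cReD.
exact: cImD.
Qed.

Lemma cintZ a b (z : C) phi : ccont a b phi ->
  cint a b (fun t => z * phi t) = z * cint a b phi.
Proof.
move=> /ccont_integrable[h1 h2]; case: z => u v.
have hh (k : R) f : mu.-integrable `[a, b] (EFin \o f) ->
  mu.-integrable `[a, b] (EFin \o (fun t => k * f t)).
  move=> hf; have mD : measurable (`[a, b]%classic : set (measurableTypeR R)) by [].
  exact: (integrableZl mD k hf).
apply: complex_ext; rewrite /cint /=.
  rewrite -!RintegralZl // -RintegralB ?hh //.
  by apply: eq_Rintegral => x _; rewrite cReM.
rewrite -!RintegralZl // -RintegralD ?hh //.
by apply: eq_Rintegral => x _; rewrite cImM.
Qed.

Lemma cintB a b phi psi : ccont a b phi -> ccont a b psi ->
  cint a b (fun t => phi t - psi t) = cint a b phi - cint a b psi.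
Proof.
move=> H K; rewrite cintD //; last exact: ccontN.
congr (_ + _); rewrite -[RHS]mulN1r -cintZ //.
by apply: cint_ext => x _; rewrite mulN1r.
Qed.

Lemma rint_split a b c f : a <= b -> b <= c -> {within `[a, c], continuous f} ->
  \int[mu]_(t in `[a, c]) f t =
  \int[mu]_(t in `[a, b]) f t + \int[mu]_(t in `[b, c]) f t.
Proof.
move=> ab bc /within_integrable H.
have := @Rintegral_itvB R f (BLeft a) (BRight c) b H.
rewrite !bnd_simp => /(_ ab bc) /eqP; rewrite subr_eq => /eqP ->.
rewrite addrC Rintegral_itv_obnd_cbnd //.
by apply: integrableS H => //; apply: subset_itvr; rewrite bnd_simp.
Qed.

Lemma cint_split a b c phi : a <= b -> b <= c -> ccont a c phi ->
  cint a c phi = cint a b phi + cint b c phi.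
Proof.
move=> ab bc /ccont_within[h1 h2].
by apply: complex_ext; rewrite /cint /=; exact: rint_split.
Qed.

Lemma rint_cst a b (k : R) : a <= b -> \int[mu]_(t in `[a, b]) k = k * (b - a).
Proof.
move=> ab; rewrite Rintegral_cst //; congr (_ * _).
rewrite /= lebesgue_measure_itv /= lte_fin.
by case: ltgtP ab => // -> _; rewrite subrr.
Qed.

Lemma rint_le a b f (M : R) : a <= b -> {within `[a, b], continuous f} ->
  (forall x, a <= x <= b -> `|f x| <= M) ->
  `|\int[mu]_(t in `[a, b]) f t| <= M * (b - a).
Proof.
move=> ab cf H; apply: le_trans (le_normr_Rintegral _ (within_integrable cf)) _ => //.
rewrite -rint_cst //; apply: le_Rintegral => //.
- exact: (integrable_norm (within_integrable cf)).
- apply/integrableP; split; first exact: measurable_cst.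
  by rewrite integral_cst //= lebesgue_measure_itv /= -(fun_if EFin) -EFinM ltry.
Qed.

(** The factor 2 comes from bounding the real and imaginary parts separately; sharp constants do not
    matter in what follows. *)
Lemma cint_le a b phi (M : R) : a <= b -> ccont a b phi ->
  (forall x, a <= x <= b -> cabs (phi x) <= M) ->
  cabs (cint a b phi) <= 2 * M * (b - a).
Proof.
move=> ab /ccont_within[h1 h2] H.
apply: (le_trans (cabs_le_ReIm _)); rewrite /cint /= -mulrA mulr2n mulrDl mul1r.
by apply: lerD; apply: rint_le => // x xab; apply: le_trans (H x xab);
  [exact: Re_le|exact: Im_le].
Qed.

Lemma cint_point a phi : cint a a phi = 0.
Proof. by rewrite /cint set_itv1 !Rintegral_set1. Qed.

Lemma rint_FTC a b f (F : R -> R) : a <= b -> continuous f ->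
  (forall t : R, is_derive t 1 F (f t)) -> \int[mu]_(t in `[a, b]) f t = F b - F a.
Proof.
rewrite le_eqVlt => /predU1P[->|ab] cf dF.
  by rewrite set_itv1 Rintegral_set1 subrr.
have cF : continuous F.
  move=> x; apply: differentiable_continuous; apply/derivable1_diffP.
  exact: (@ex_derive _ _ _ _ _ _ _ (dF x)).
rewrite /Rintegral (@continuous_FTC2 _ _ F) //.
- exact: continuous_subspaceT.
- split => [x _||]; [exact: (@ex_derive _ _ _ _ _ _ _ (dF x)) | |].
    by apply: cvg_at_right_filter; exact: cF.
  by apply: cvg_at_left_filter; exact: cF.
- by move=> x _; rewrite derive1E (@derive_val _ _ _ _ _ _ _ (dF x)).
Qed.

End ComplexIntegral.

(** * Goursat's theorem on the region swept by dilating a curve *)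

Section Cone.
Context {R : realType}.
Local Notation C := (Cplx R).
Local Notation mu := (@lebesgue_measure R).
Variables (x y dx dy : R -> R).
Hypotheses (xP : forall t : R, is_derive t 1 x (dx t))
  (yP : forall t : R, is_derive t 1 y (dy t)).
Hypotheses (dx_cont : continuous dx) (dy_cont : continuous dy).

Let gam t : C := x t +i* y t.
Let dgam t : C := dx t +i* dy t.

Let derive_cont (f df : R -> R) : (forall t : R, is_derive t 1 f (df t)) ->
  continuous f.
Proof.
move=> H t; apply: differentiable_continuous; apply/derivable1_diffP.
exact: (@ex_derive _ _ _ _ _ _ _ (H t)).
Qed.

Let gam_ccont u v : ccont u v gam.
Proof. by apply: continuous_ccont; apply: derive_cont. Qed.

Let dgam_ccont u v : ccont u v dgam.
Proof. exact: continuous_ccont. Qed.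

Lemma cint_dcurve u v : u <= v -> cint u v dgam = gam v - gam u.
Proof.
move=> uv; apply: complex_ext; rewrite /cint /=.
  exact: rint_FTC.
exact: rint_FTC.
Qed.

(** Together with [cint_dcurve] this evaluates the boundary integral of an affine function
    exactly. *)
Lemma cint_curve_dcurve u v : u <= v ->
  cint u v (fun t => gam t * dgam t) = (gam v ^+ 2 - gam u ^+ 2) / 2.
Proof.
move=> uv.
have cx := derive_cont xP; have cy := derive_cont yP.
have r1 (t : R) : is_derive t 1 (fun t => (x t ^+ 2 - y t ^+ 2) / 2)
    (x t * dx t - y t * dy t).
  have := xP t; have := yP t => h1 h2.
  by apply: is_derive_eq; rewrite /GRing.scale /=; field.
have r2 (t : R) : is_derive t 1 (fun t => x t * y t) (x t * dy t + y t * dx t).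
  have := xP t; have := yP t => h1 h2.
  by apply: is_derive_eq; rewrite /GRing.scale /=; field.
have c1 : continuous (fun t => x t * dx t - y t * dy t).
  by move=> t; exact: (cvgB (cvgM (cx t) (@dx_cont t)) (cvgM (cy t) (@dy_cont t))).
have c2 : continuous (fun t => x t * dy t + y t * dx t).
  by move=> t; exact: (cvgD (cvgM (cx t) (@dy_cont t)) (cvgM (cy t) (@dx_cont t))).
have two : (2 : C)^-1 = (2^-1 : R)%:C by rewrite fmorphV rmorph_nat.
rewrite two /cint; apply: complex_ext; rewrite /= ?mulr0 ?mul0r ?subr0 ?addr0 ?add0r.
  rewrite (rint_FTC uv c1 r1); ring.
rewrite -[RHS](_ : x v * y v - x u * y u = _); last by field.
by rewrite -(rint_FTC uv c2 r2).
Qed.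

Variables (a : C) (G : R) (s0 t0 u0 v0 : R).
Hypotheses (s0_ge0 : 0 <= s0) (u0_ge0 : 0 <= u0) (v0_ge0 : 0 <= v0) (G_ge0 : 0 <= G).
Hypothesis gam_le : forall t, t0 <= t <= t0 + v0 -> cabs (gam t) <= G.
Hypothesis dgam_le : forall t, t0 <= t <= t0 + v0 -> cabs (dgam t) <= G.

Lemma curve_lipschitz t t' : t0 <= t <= t0 + v0 -> t0 <= t' <= t0 + v0 ->
  cabs (gam t' - gam t) <= 2 * G * `|t' - t|.
Proof.
wlog tt' : t t' / t <= t' => [H ht ht'|/andP[h1 h2] /andP[h3 h4]].
  by have [/H|/ltW/H h] := leP t t'; [exact | rewrite cabs_distC distrC h].
rewrite -cint_dcurve // ger0_norm ?subr_ge0 //; apply: cint_le => //.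
by move=> z /andP[z1 z2]; apply: dgam_le; apply/andP; split; lra.
Qed.

(** The boundary of the image of a parameter rectangle under (s, t) -> a + s * gam t consists of two
    radial segments and two dilated arcs; [bound] adds them with orientation. *)
Let radial (h : C -> C) t s s' :=
  cint s s' (fun r => h (a + r%:C * gam t) * gam t).
Let arc (h : C -> C) s t t' :=
  s%:C * cint t t' (fun r => h (a + s%:C * gam r) * dgam r).
Let bound h s t u v : C := radial h (t + v) s (s + u) - radial h t s (s + u)
  - arc h (s + u) t (t + v) + arc h s t (t + v).

Let radial_ccont (h : C -> C) t s s' :
  (forall r, s <= r <= s' -> exists l, cderiv h (a + r%:C * gam t) l) ->
  ccont s s' (fun r => h (a + r%:C * gam t)).
Proof.
move=> H; apply: (ccont_comp H); apply: ccontD; first exact: ccont_cst.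
by apply: ccontM; [exact: ccont_id|exact: ccont_cst].
Qed.

Let arc_ccont (h : C -> C) s t t' :
  (forall r, t <= r <= t' -> exists l, cderiv h (a + s%:C * gam r) l) ->
  ccont t t' (fun r => h (a + s%:C * gam r)).
Proof.
move=> H; apply: (ccont_comp H); apply: ccontD; first exact: ccont_cst.
by apply: ccontM; [exact: ccont_cst|exact: gam_ccont].
Qed.

Let cderiv_affine (al be : C) w : exists l, cderiv (fun w => al + be * (w - a)) w l.
Proof.
exists be => e e0; exists 1 => // k _.
rewrite (_ : _ - _ - _ = 0); last by ring.
by rewrite cabs0 mulr_ge0 ?cabs_ge0 // ltW.
Qed.

(** Explicit antiderivatives turn the four sides into polynomials in s, u and the end values of
    [gam], and these cancel. *)
Let bound_affine (al be : C) s t u v : 0 <= u -> 0 <= v ->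
  bound (fun w => al + be * (w - a)) s t u v = 0.
Proof.
move=> u_ge0 v_ge0.
have rint_id (p q : R) : p <= q -> cint p q (fun r => r%:C) = ((q ^+ 2 - p ^+ 2) / 2)%:C.
  move=> pq; apply: complex_ext; rewrite /cint /=.
    have d (r : R) : is_derive r 1 (fun r : R => r ^+ 2 / 2) r.
      by apply: is_derive_eq; rewrite /GRing.scale /=; field.
    have cid : continuous (id : R -> R) by move=> z; exact: cvg_id.
    by rewrite (rint_FTC pq cid d); field.
  by rewrite rint_cst // mul0r.
have one_int (p q : R) z : p <= q -> cint p q (fun=> z) = (q - p)%:C * z.
  move=> pq; case: z => z1 z2; apply: complex_ext; rewrite /cint /= rint_cst //; ring.
have su : s <= s + u by lra.
have tv : t <= t + v by lra.
have E1 r : radial (fun w => al + be * (w - a)) r s (s + u) =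
    u%:C * (al * gam r) + be * gam r ^+ 2 * (((s + u) ^+ 2 - s ^+ 2) / 2)%:C.
  rewrite /radial (@cint_ext _ _ _ _
    (fun q => al * gam r + (be * gam r ^+ 2) * q%:C)); last by move=> q _; ring.
  have c1 := @ccont_cst R s (s + u) (al * gam r).
  have c2 := @ccont_id R s (s + u).
  rewrite cintD //; last by apply: ccontM => //; exact: ccont_cst.
  rewrite one_int // cintZ // rint_id //.
  by rewrite (_ : s + u - s = u) //; ring.
have E2 q : arc (fun w => al + be * (w - a)) q t (t + v) =
   q%:C * (al * (gam (t + v) - gam t) + be * q%:C *
     ((gam (t + v) ^+ 2 - gam t ^+ 2) / 2)).
  rewrite /arc (@cint_ext _ _ _ _
    (fun r => al * dgam r + (be * q%:C) * (gam r * dgam r))); last by move=> r _; ring.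
  have c1 := @dgam_ccont t (t + v).
  have c2 := ccontM (@gam_ccont t (t + v)) c1.
  rewrite cintD //; try by apply: ccontM => //; exact: ccont_cst.
  by rewrite !cintZ // cint_dcurve // cint_curve_dcurve.
rewrite /bound !E1 !E2 [in LHS]rmorphM /= rmorphB /= !rmorphXn /= !rmorphD /=.
rewrite (_ : (2^-1)%:C = 2^-1); last by rewrite fmorphV rmorph_nat.
by field.
Qed.

Variable h : C -> C.
Hypothesis h_deriv : forall s t, s0 <= s <= s0 + u0 -> t0 <= t <= t0 + v0 ->
  exists l, cderiv h (a + s%:C * gam t) l.

(** The sides shared by adjacent quarters are traversed twice, in opposite directions. *)
Let bound_quarters s t u v : 0 <= u -> 0 <= v ->
  [/\ s0 <= s, s + (u + u) <= s0 + u0, t0 <= t & t + (v + v) <= t0 + v0] ->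
  cabs (bound h s t (u + u) (v + v)) <=
    cabs (bound h s t u v) + cabs (bound h (s + u) t u v)
    + (cabs (bound h s (t + v) u v) + cabs (bound h (s + u) (t + v) u v)).
Proof.
move=> u_ge0 v_ge0 [s_ge su t_ge tv].
have Ea r : t0 <= r <= t0 + v0 -> radial h r s (s + (u + u)) =
    radial h r s (s + u) + radial h r (s + u) (s + u + u).
  move=> hr; rewrite addrA /radial; apply: cint_split; try lra.
  apply: ccontM; last exact: ccont_cst.
  apply: radial_ccont => q /andP[q1 q2]; apply: h_deriv => //.
  by apply/andP; split; lra.
have Eb r : s0 <= r <= s0 + u0 -> arc h r t (t + (v + v)) =
    arc h r t (t + v) + arc h r (t + v) (t + v + v).
  move=> hr; rewrite addrA /arc -mulrDr; congr (_ * _); apply: cint_split; try lra.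
  apply: ccontM; last exact: dgam_ccont.
  apply: arc_ccont => q /andP[q1 q2]; apply: h_deriv => //.
  by apply/andP; split; lra.
have -> : bound h s t (u + u) (v + v) = bound h s t u v + bound h (s + u) t u v
    + (bound h s (t + v) u v + bound h (s + u) (t + v) u v).
  rewrite /bound !Ea ?Eb; try by apply/andP; split; lra.
  have quad (a0 a0' a1 a1' a2 a2' b0 b0' b1 b1' b2 b2' : C) :
    a2 + a2' - (a0 + a0') - (b2 + b2') + (b0 + b0') =
    (a1 - a0 - b1 + b0) + (a1' - a0' - b2 + b1) +
    ((a2 - a1 - b1' + b0') + (a2' - a1' - b2' + b1')) by ring.
  by rewrite !(addrA s) !(addrA t); exact: quad.
by apply: (le_trans (cabsD _ _)); apply: lerD; apply: cabsD.
Qed.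

Let cabs4 (z1 z2 z3 z4 : C) :
  cabs (z1 - z2 - z3 + z4) <= cabs z1 + cabs z2 + cabs z3 + cabs z4.
Proof.
do 3![apply: (le_trans (cabsD _ _)); rewrite ?cabsN; apply: lerD => //].
Qed.

(** Write h near the chosen point as its first-order expansion plus a remainder that is small
    relative to the distance. The affine part integrates to 0. The remainder is at most eps' * L *
    (u + v), on sides whose length is of order u + v, which gives a quadratic bound. *)
Let bound_local s1 t1 : s0 <= s1 <= s0 + u0 -> t0 <= t1 <= t0 + v0 ->
  forall eps, 0 < eps -> exists2 d, 0 < d &
    forall s t u v,
      [/\ s0 <= s, s + u <= s0 + u0, t0 <= t & t + v <= t0 + v0] ->
      s <= s1 <= s + u -> t <= t1 <= t + v ->
      u < d -> v < d -> cabs (bound h s t u v) <= eps * (u + v) ^+ 2.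
Proof.
move=> hs1 ht1 eps eps_gt0.
pose S := s0 + u0; have S_ge0 : 0 <= S by rewrite addr_ge0.
(* L * (u + v) bounds the distance from the chosen point to the points of the small region, and 4 *
   M collects the four sides. *)
pose L := G * (1 + 2 * S); have L_ge0 : 0 <= L by rewrite mulr_ge0 // ; lra.
pose M := L * G * (1 + S); have M_ge0 : 0 <= M by rewrite !mulr_ge0 //; lra.
have [l hl] := h_deriv hs1 ht1; set w1 := a + _ in hl.
have eps'_gt0 : 0 < eps / (4 * M + 1) by rewrite divr_gt0 //; lra.
set eps' := (eps / _) in eps'_gt0.
have [d d_gt0 Hd] := hl _ eps'_gt0.
have aux (l' d' : R) : 0 <= l' -> 0 < d' -> l' * (2 * (d' / (2 * l' + 1))) < d'.
  by move=> l0 dd; rewrite !mulrA ltr_pdivrMr; lra.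
have aux2 (m e : R) : 0 <= m -> 0 < e -> e / (4 * m + 1) * (4 * m) <= e.
  by move=> m0 e0; rewrite mulrAC ler_pdivrMr; [rewrite ler_pM2l //; lra | lra].
have L1_gt0 : 0 < 2 * L + 1 by lra.
exists (d / (2 * L + 1)); first by rewrite divr_gt0.
move=> s t u v [s_ge su t_ge tv] /andP[s1a s1b] /andP[t1a t1b].
rewrite !ltr_pdivlMr // => ud vd.
have u_ge0 : 0 <= u by lra.
have v_ge0 : 0 <= v by lra.
pose aff w := (h w1 - l * (s1%:C * gam t1)) + l * (w - a).
pose rho w := h w - aff w.
have near s' t' : s <= s' <= s + u -> t <= t' <= t + v ->
    cabs (s'%:C * gam t' - s1%:C * gam t1) <= L * (u + v).
  move=> /andP[s'a s'b] /andP[t'a t'b].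
  rewrite (_ : _ - _ = (s' - s1)%:C * gam t' + s1%:C * (gam t' - gam t1)); last first.
    by rewrite rmorphB; ring.
  apply: (le_trans (cabsD _ _)); rewrite !cabsM !cabsR.
  have h1 : `|s' - s1| <= u by rewrite ler_norml; apply/andP; split; lra.
  have h2 : `|t' - t1| <= v by rewrite ler_norml; apply/andP; split; lra.
  have h3 : `|s1| <= S by move/andP: hs1 => [k1 k2]; rewrite ger0_norm // (le_trans s0_ge0).
  have h4 : t0 <= t' <= t0 + v0 by apply/andP; split; lra.
  have h5 := curve_lipschitz ht1 h4.
  have h6 := gam_le h4.
  have h7 : `|s' - s1| * cabs (gam t') <= u * G by apply: ler_pM => //; exact: cabs_ge0.
  have h8 : `|s1| * cabs (gam t' - gam t1) <= S * (2 * G * v).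
    apply: ler_pM => //; first exact: cabs_ge0.
    by apply: (le_trans h5); rewrite ler_wpM2l // mulr_ge0.
  apply: (le_trans (lerD h7 h8)); rewrite /L -subr_ge0.
  rewrite (_ : _ - _ = G * v + 2 * S * G * u); last by ring.
  by rewrite addr_ge0 // !mulr_ge0.
have rho_le s' t' : s <= s' <= s + u -> t <= t' <= t + v ->
    cabs (rho (a + s'%:C * gam t')) <= eps' * (L * (u + v)).
  move=> hs' ht'; have hn := near _ _ hs' ht'.
  have := Hd (s'%:C * gam t' - s1%:C * gam t1).
  rewrite (_ : w1 + (s'%:C * gam t' - s1%:C * gam t1) = a + s'%:C * gam t'); last first.
    by rewrite /w1; ring.
  rewrite (_ : h _ - h w1 - _ = rho (a + s'%:C * gam t')); last by rewrite /rho /aff; ring.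
  have ok : cabs (s'%:C * gam t' - s1%:C * gam t1) < d.
    apply: (le_lt_trans hn).
    have : u + v < 2 * (d / (2 * L + 1)).
      have k1 : u < d / (2 * L + 1) by rewrite ltr_pdivlMr //; lra.
      have k2 : v < d / (2 * L + 1) by rewrite ltr_pdivlMr //; lra.
      lra.
    move=> k; apply: (@le_lt_trans _ _ (L * (2 * (d / (2 * L + 1))))).
      by rewrite ler_wpM2l // ltW.
    exact: aux.
  by move=> /(_ ok) k; apply: (le_trans k); rewrite ler_wpM2l // ltW.
have sub_s r : s <= r <= s + u -> s0 <= r <= s0 + u0.
  by move=> /andP[? ?]; apply/andP; split; lra.
have sub_t r : t <= r <= t + v -> t0 <= r <= t0 + v0.
  by move=> /andP[? ?]; apply/andP; split; lra.
have cr1 r : t <= r <= t + v -> ccont s (s + u) (fun q => h (a + q%:C * gam r)).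
  by move=> hr; apply: radial_ccont => q hq; apply: h_deriv; [exact: sub_s|exact: sub_t].
have cr2 r : ccont s (s + u) (fun q => aff (a + q%:C * gam r)).
  by apply: radial_ccont => q hq; exact: cderiv_affine.
have ca1 q : s <= q <= s + u -> ccont t (t + v) (fun r => h (a + q%:C * gam r)).
  by move=> hq; apply: arc_ccont => r hr; apply: h_deriv; [exact: sub_s|exact: sub_t].
have ca2 q : ccont t (t + v) (fun r => aff (a + q%:C * gam r)).
  by apply: arc_ccont => r hr; exact: cderiv_affine.
have Er r : t <= r <= t + v -> radial h r s (s + u) = radial aff r s (s + u) +
    radial rho r s (s + u).
  move=> hr; rewrite /radial -cintD; last 2 first.
  - by apply: ccontM => //; exact: ccont_cst.
  - apply: ccontM; last exact: ccont_cst.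
    by apply: ccontB => //; exact: cr1.
  by apply: cint_ext => q _; rewrite /rho; ring.
have Ea q : s <= q <= s + u -> arc h q t (t + v) = arc aff q t (t + v) +
    arc rho q t (t + v).
  move=> hq; rewrite /arc -mulrDr -cintD; last 2 first.
  - by apply: ccontM => //; exact: dgam_ccont.
  - apply: ccontM; last exact: dgam_ccont.
    by apply: ccontB => //; exact: ca1.
  by congr (_ * _); apply: cint_ext => r _; rewrite /rho; ring.
have tt : t <= t <= t + v by rewrite lexx /=; lra.
have ttv : t <= t + v <= t + v by rewrite lexx andbT; lra.
have ss : s <= s <= s + u by rewrite lexx /=; lra.
have ssu : s <= s + u <= s + u by rewrite lexx andbT; lra.
have -> : bound h s t u v = bound rho s t u v.
  rewrite -[RHS]add0r -(@bound_affine (h w1 - l * (s1%:C * gam t1)) l s t u v) //.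
  have sum4 (a1 a2 a3 a4 b1 b2 b3 b4 : C) : a1 + b1 - (a2 + b2) - (a3 + b3) + (a4 + b4)
    = (a1 - a2 - a3 + a4) + (b1 - b2 - b3 + b4) by ring.
  by rewrite -/aff /bound !Er // !Ea //; exact: sum4.
pose N := eps' * (L * (u + v)).
have N_ge0 : 0 <= N by apply: mulr_ge0; [exact: ltW|apply: mulr_ge0 => //; exact: addr_ge0].
have Br r : t <= r <= t + v -> cabs (radial rho r s (s + u)) <= 2 * (N * G) * u.
  move=> hr; have -> : 2 * (N * G) * u = 2 * (N * G) * (s + u - s) by ring.
  apply: cint_le; first lra.
    apply: ccontM; last exact: ccont_cst.
    by apply: ccontB => //; exact: cr1.
  move=> q hq; rewrite cabsM; apply: ler_pM; rewrite ?cabs_ge0 //; first exact: rho_le.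
  by apply: gam_le; exact: sub_t.
have Ba q : s <= q <= s + u -> cabs (arc rho q t (t + v)) <= S * (2 * (N * G) * v).
  move=> hq; rewrite cabsM cabsR; apply: ler_pM; rewrite ?cabs_ge0 //.
    by move: (sub_s _ hq) => /andP[k1 k2]; rewrite ger0_norm // (le_trans s0_ge0).
  have -> : 2 * (N * G) * v = 2 * (N * G) * (t + v - t) by ring.
  apply: cint_le; first lra.
    apply: ccontM; last exact: dgam_ccont.
    by apply: ccontB => //; exact: ca1.
  move=> r hr; rewrite cabsM; apply: ler_pM; rewrite ?cabs_ge0 //; first exact: rho_le.
  by apply: dgam_le; exact: sub_t.
apply: (le_trans (cabs4 _ _ _ _)).
apply: (le_trans (lerD (lerD (lerD (Br _ ttv) (Br _ tt)) (Ba _ ssu)) (Ba _ ss))).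
apply: (@le_trans _ _ (eps' * (4 * M) * (u + v) ^+ 2)).
  rewrite -subr_ge0 /N /M.
  rewrite (_ : _ - _ = 4 * eps' * L * G * (u + v) * (v + S * u)); last by ring.
  have ? : 0 <= S * u by exact: mulr_ge0.
  do 2![apply: mulr_ge0; last exact: addr_ge0].
  do 2![apply: mulr_ge0; last by []].
  by apply: mulr_ge0 => //; exact: ltW.
apply: ler_wpM2r; first exact: sqr_ge0.
exact: aux2.
Qed.

(** Cauchy's theorem in the one form on which everything later depends. Since [s0] may be 0, full
    cones with apex [a] are included. *)
Lemma cone_goursat :
  cint s0 (s0 + u0) (fun r => h (a + r%:C * gam (t0 + v0)) * gam (t0 + v0))
  - cint s0 (s0 + u0) (fun r => h (a + r%:C * gam t0) * gam t0) =
  (s0 + u0)%:C * cint t0 (t0 + v0) (fun r => h (a + (s0 + u0)%:C * gam r) * dgam r)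
  - s0%:C * cint t0 (t0 + v0) (fun r => h (a + s0%:C * gam r) * dgam r).
Proof.
have : cabs (bound h s0 t0 u0 v0) <= 0.
  by apply: (bisection_le0 (e := fun s t u v => cabs (bound h s t u v))).
rewrite le_eqVlt ltNge cabs_ge0 orbF cabs_eq0 /bound /radial /arc => /eqP H.
have sub4 (z1 z2 z3 z4 : C) : z1 - z2 - z3 + z4 = 0 -> z1 - z2 = z3 - z4.
  by move=> E; apply/eqP; rewrite -subr_eq0 -E; apply/eqP; ring.
exact: sub4 H.
Qed.

End Cone.

(** * Rules of complex differentiation, and primitives in the disc *)

Section CauchyTheory.
Context {R : realType}.
Local Notation C := (Cplx R).
Local Notation mu := (@lebesgue_measure R).

Definition holo (f : C -> C) := forall z, cabs z < 1 -> exists l, cderiv f z l.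

Lemma analyticP (f : C -> C) : analytic f <-> holo f.
Proof.
split=> [H z /unit_discE/H/derive1_cderiv h|H z /unit_discE/H[l /cderiv_derivable[]//]].
by eexists; exact: h.
Qed.

Lemma cderiv_ext (f g : C -> C) z l d : 0 < d ->
  (forall w, cabs (w - z) < d -> f w = g w) -> cderiv f z l -> cderiv g z l.
Proof.
move=> d0 E H e e0; have [r r0 Hr] := H e e0.
exists (Num.min d r); first by rewrite lt_min d0.
move=> k; rewrite lt_min => /andP[kd kr].
have E1 : z + k - z = k by ring.
by rewrite -!E ?subrr ?cabs0 ?E1 //; exact: Hr.
Qed.

Lemma cderiv_unique (f : C -> C) z l l' : cderiv f z l -> cderiv f z l' -> l = l'.
Proof. by move=> /cderiv_derivable[_ <-] /cderiv_derivable[_ <-]. Qed.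

Lemma cderiv_cst (c z : C) : cderiv (fun=> c) z 0.
Proof.
move=> e e0; exists 1 => // k _; rewrite subrr mul0r subrr cabs0.
by rewrite mulr_ge0 ?cabs_ge0 // ltW.
Qed.

Lemma cderiv_id (z : C) : cderiv id z 1.
Proof.
move=> e e0; exists 1 => // k _; rewrite (_ : _ - _ = 0); last by rewrite /=; ring.
by rewrite cabs0 mulr_ge0 ?cabs_ge0 // ltW.
Qed.

Lemma cderivD (f g : C -> C) z l m : cderiv f z l -> cderiv g z m ->
  cderiv (fun w => f w + g w) z (l + m).
Proof.
move=> H K e e0; have e2 : 0 < e / 2 by rewrite divr_gt0.
have [d d0 Hd] := H _ e2; have [r r0 Hr] := K _ e2.
exists (Num.min d r); first by rewrite lt_min d0.
move=> k; rewrite lt_min => /andP[kd kr].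
have h1 := Hd k kd; have h2 := Hr k kr.
rewrite (_ : _ - _ = (f (z + k) - f z - l * k) + (g (z + k) - g z - m * k)); last by ring.
apply: (le_trans (cabsD _ _)); apply: (le_trans (lerD h1 h2)).
by rewrite -mulrDl -splitr.
Qed.

Lemma cderivM (f g : C -> C) z l m : cderiv f z l -> cderiv g z m ->
  cderiv (fun w => f w * g w) z (l * g z + f z * m).
Proof.
move=> H K e e0.
pose A := cabs (f z) + cabs (g z) + cabs l + 2.
have A0 : 0 < A.
  by rewrite /A; have := cabs_ge0 (f z); have := cabs_ge0 (g z); have := cabs_ge0 l; lra.
have eA : 0 < Num.min 1 (e / (3 * A)) by rewrite lt_min ltr01 /= divr_gt0 ?mulr_gt0.
have [d d0 Hd] := H _ eA; have [r r0 Hr] := K _ eA.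
have [s s0 Hs] := cderiv_cont K eA.
exists (Num.min (Num.min d r) s); first by rewrite !lt_min d0 r0.
move=> k; rewrite !lt_min => /andP[/andP[kd kr] ks].
have h1 := Hd k kd; have h2 := Hr k kr.
have h3 := Hs (z + k); rewrite (_ : z + k - z = k) in h3; last by ring.
have {}h3 := h3 ks.
set p := f (z + k) - f z - l * k in h1; set q := g (z + k) - g z - m * k in h2.
set t := g (z + k) - g z in h3.
rewrite (_ : _ - _ = p * g z + p * t + l * k * t + f z * q); last first.
  by rewrite /p /q /t; ring.
have k0 := cabs_ge0 k.
have m1 : Num.min 1 (e / (3 * A)) <= 1 by rewrite ge_min lexx.
have m2 : Num.min 1 (e / (3 * A)) <= e / (3 * A) by rewrite ge_min lexx orbT.
set mm := Num.min _ _ in m1 m2 h1 h2 h3 eA.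
have b1 : cabs (p * g z) <= mm * cabs k * cabs (g z).
  by rewrite cabsM; apply: ler_wpM2r => //; exact: cabs_ge0.
have b2 : cabs (p * t) <= mm * cabs k * 1.
  by rewrite cabsM; apply: ler_pM; rewrite ?cabs_ge0 //; exact: (le_trans h3).
have b3 : cabs (l * k * t) <= cabs l * cabs k * mm.
  by rewrite !cabsM; apply: ler_wpM2l => //; rewrite mulr_ge0 ?cabs_ge0.
have b4 : cabs (f z * q) <= cabs (f z) * (mm * cabs k).
  by rewrite cabsM; apply: ler_wpM2l => //; exact: cabs_ge0.
apply: (le_trans (cabsD _ _)); apply: (le_trans (lerD (le_trans (cabsD _ _)
  (lerD (le_trans (cabsD _ _) (lerD b1 b2)) b3)) b4)).
rewrite (_ : _ + _ = (mm * (A - 1)) * cabs k); last by rewrite /A; ring.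
apply: ler_wpM2r => //; apply: (@le_trans _ _ (e / (3 * A) * A)).
  by apply: ler_pM => //; [exact: ltW| |]; rewrite /A;
    have := cabs_ge0 (f z); have := cabs_ge0 (g z); have := cabs_ge0 l; lra.
rewrite (_ : _ * _ = e / 3); last by field; rewrite lt0r_neq0.
by rewrite ler_pdivrMr //; lra.
Qed.

Lemma cderivV (z : C) : z != 0 -> cderiv (fun w => w^-1) z (- (z ^+ 2)^-1).
Proof.
move=> z0 e e0; have n0 : 0 < cabs z by rewrite cabs_gt0.
exists (Num.min (cabs z / 2) (e * cabs z ^+ 3 / 2)).
  by rewrite lt_min !divr_gt0 // mulr_gt0 // exprn_gt0.
move=> k; rewrite lt_min => /andP[k1 k2].
have h : cabs z / 2 <= cabs (z + k).
  have := cabs_subl z (- k); rewrite opprK cabsN; lra.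
have zk0 : z + k != 0 by rewrite -cabs_gt0; apply: lt_le_trans h; rewrite divr_gt0.
rewrite (_ : _ - _ = k * (k * ((z ^+ 2)^-1 * (z + k)^-1))); last first.
  by field; rewrite ?z0 ?zk0.
rewrite cabsM mulrC; apply: ler_wpM2r; first exact: cabs_ge0.
rewrite !cabsM !cabsV cabsX.
have : (cabs (z + k))^-1 <= (cabs z / 2)^-1 by rewrite lef_pV2 ?posrE ?divr_gt0 ?cabs_gt0.
move=> h4; apply: (@le_trans _ _ (e * cabs z ^+ 3 / 2 * ((cabs z ^+ 2)^-1 * (cabs z / 2)^-1))).
  apply: ler_pM; rewrite ?cabs_ge0 ?mulr_ge0 ?invr_ge0 ?exprn_ge0 ?cabs_ge0 //; first exact: ltW.
  by apply: ler_wpM2l => //; rewrite invr_ge0 exprn_ge0 // ltW.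
by rewrite le_eqVlt; apply/orP; left; apply/eqP; field; rewrite lt0r_neq0.
Qed.

Lemma cderiv_comp (f g : C -> C) z l m : cderiv g z m -> cderiv f (g z) l ->
  cderiv (fun w => f (g w)) z (l * m).
Proof.
move=> K H e e0.
pose A := cabs l + cabs m + 2.
have A0 : 0 < A by rewrite /A; have := cabs_ge0 l; have := cabs_ge0 m; lra.
have eA : 0 < Num.min 1 (e / (2 * A)) by rewrite lt_min ltr01 /= divr_gt0 ?mulr_gt0.
have [d d0 Hd] := H _ eA; have [r r0 Hr] := K _ eA.
have d2 : 0 < d / 2 by rewrite divr_gt0.
have [s s0 Hs] := cderiv_cont K d2.
exists (Num.min r s); first by rewrite !lt_min r0.
move=> k; rewrite !lt_min => /andP[kr ks].
have h2 := Hr k kr.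
have h3 := Hs (z + k); rewrite (_ : z + k - z = k) in h3; last by ring.
have {}h3 := h3 ks.
set j := g (z + k) - g z in h3 h2.
have h1 := Hd j; rewrite (_ : g z + j = g (z + k)) in h1; last by rewrite /j; ring.
have {}h1 : cabs (f (g (z + k)) - f (g z) - l * j) <= Num.min 1 (e / (2 * A)) * cabs j.
  by apply: h1; apply: le_lt_trans h3 _; lra.
have k0 := cabs_ge0 k.
have m1 : Num.min 1 (e / (2 * A)) <= 1 by rewrite ge_min lexx.
have m2 : Num.min 1 (e / (2 * A)) <= e / (2 * A) by rewrite ge_min lexx orbT.
set mm := Num.min _ _ in m1 m2 h1 h2 eA.
have hj : cabs j <= (1 + cabs m) * cabs k.
  rewrite (_ : j = (j - m * k) + m * k); last by ring.
  apply: (le_trans (cabsD _ _)); rewrite cabsM mulrDl lerD2r mul1r.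
  by apply: (le_trans h2); rewrite ler_piMl.
rewrite (_ : _ - _ = (f (g (z + k)) - f (g z) - l * j) + l * (j - m * k)); last by ring.
apply: (le_trans (cabsD _ _)); rewrite (cabsM l).
have mm0 := ltW eA.
apply: (@le_trans _ _ (mm * ((1 + cabs m) * cabs k) + cabs l * (mm * cabs k))).
  apply: lerD; first by apply: (le_trans h1); rewrite ler_wpM2l.
  by apply: ler_wpM2l => //; exact: cabs_ge0.
rewrite (_ : _ + _ = mm * (A - 1) * cabs k); last by rewrite /A; ring.
apply: ler_wpM2r => //; apply: (@le_trans _ _ (e / (2 * A) * A)).
  by apply: ler_pM => //; rewrite /A; have := cabs_ge0 l; have := cabs_ge0 m; lra.
rewrite (_ : _ * _ = e / 2); last by field; rewrite lt0r_neq0.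
by rewrite ler_pdivrMr //; lra.
Qed.

Lemma cderivX (f : C -> C) z l n : cderiv f z l ->
  exists m, cderiv (fun w => f w ^+ n) z m.
Proof.
move=> H; elim: n => [|n [m IH]].
  by exists 0; under eq_fun do rewrite expr0; exact: cderiv_cst.
by eexists; under eq_fun do rewrite exprS; exact: cderivM H IH.
Qed.

Lemma is_derive_affine (p q : R) (t : R) : is_derive t 1 (fun t => p + t * q) q.
Proof. by apply: is_derive_eq; rewrite /GRing.scale /=; ring. Qed.

(** The integral along the segment from 0 to z, which is what the operator with symbol the identity
    computes. *)
Definition primitive (h : C -> C) z := cint 0 1 (fun t => h (t%:C * z) * z).

Lemma cabs_segment (z k : C) (s t r : R) : 0 <= s <= 1 -> 0 <= t <= 1 ->
  cabs z < r -> cabs (z + k) < r -> cabs (s%:C * (z + t%:C * k)) < r.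
Proof.
move=> /andP[s0 s1] /andP[t0 t1] h1 h2.
rewrite (_ : _ * _ = s%:C * ((1 - t)%:C * z + t%:C * (z + k))); last by rewrite rmorphB rmorph1; ring.
rewrite cabsM cabsR ger0_norm //.
have b : cabs ((1 - t)%:C * z + t%:C * (z + k)) <= (1 - t) * cabs z + t * cabs (z + k).
  apply: (le_trans (cabsD _ _)); rewrite !cabsM !cabsR.
  by rewrite !ger0_norm ?subr_ge0.
have c : (1 - t) * cabs z + t * cabs (z + k) < r.
  have [->|tn0] := eqVneq t 0; first by rewrite subr0 mul1r mul0r addr0.
  rewrite (_ : r = (1 - t) * r + t * r); last by ring.
  apply: ler_ltD; first by rewrite ler_wpM2l ?subr_ge0 // ltW.
  by rewrite ltr_pM2l // lt_def tn0.
apply: (le_lt_trans _ (le_lt_trans b c)).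
by rewrite ler_piMl // cabs_ge0.
Qed.

(** Goursat for the triangle with vertices 0, z and z + k, seen as the cone with apex 0 over the
    segment from z to z + k. *)
Lemma primitive_diff (h : C -> C) z k : holo h -> cabs z < 1 -> cabs (z + k) < 1 ->
  primitive h (z + k) - primitive h z = k * cint 0 1 (fun t => h (z + t%:C * k)).
Proof.
move=> Hh z1 zk1.
pose x t := Re z + t * Re k; pose y t := Im z + t * Im k.
have cc (c : R) : continuous (fun _ : R => c) by move=> ?; exact: cvg_cst.
have gE t : (x t +i* y t : C) = z + t%:C * k.
  by apply: complex_ext; rewrite ?cReD ?cImD ?cReM ?cImM /x /y /=; ring.
have dgE : ((Re k) +i* (Im k) : C) = k by case: (k).
have := @cone_goursat R x y (fun=> Re k) (fun=> Im k) (is_derive_affine _ _)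
  (is_derive_affine _ _) (cc _) (cc _) 0 (cabs z + cabs k) 0 0 1 1 (lexx _) ler01 ler01
  (addr_ge0 (cabs_ge0 _) (cabs_ge0 _)) _ _ h _.
rewrite !add0r rmorph0 mul0r subr0 mul1r => H.
have -> : primitive h (z + k) - primitive h z =
    cint 0 1 (fun r : R => h (0 + r%:C * (x 1 +i* y 1)) * (x 1 +i* y 1)) -
    cint 0 1 (fun r : R => h (0 + r%:C * (x 0 +i* y 0)) * (x 0 +i* y 0)).
  by rewrite /primitive; congr (_ - _); apply: cint_ext => t _;
    rewrite add0r gE ?mul1r // mul0r addr0.
rewrite H.
- rewrite -cintZ; last first.
    apply: ccont_comp => [t /andP[t0 t1]|].
      rewrite -[z + _]mul1r; apply: Hh; apply: (@cabs_segment z k 1 t) => //.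
        by rewrite ler01 lexx.
      by rewrite t0.
    by apply: ccontD; [exact: ccont_cst|apply: ccontM; [exact: ccont_id|exact: ccont_cst]].
  by apply: cint_ext => t _; rewrite gE dgE add0r mul1r mulrC.
- move=> t /andP[t0 t1]; rewrite gE; apply: (le_trans (cabsD _ _)); rewrite lerD2l cabsM cabsR.
  by rewrite ger0_norm // ler_piMl // cabs_ge0.
- by move=> t _; rewrite dgE lerDr cabs_ge0.
- by move=> s t hs ht; rewrite add0r gE; apply: Hh; exact: cabs_segment.
Qed.

Lemma holo_cont (h : C -> C) z : holo h -> cabs z < 1 -> forall e : R, 0 < e ->
  exists2 d : R, 0 < d & forall w, cabs (w - z) < d -> cabs (h w - h z) <= e.
Proof. by move=> Hh /Hh[l /cderiv_cont]. Qed.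

Lemma primitive_cderiv (h : C -> C) z : holo h -> cabs z < 1 ->
  cderiv (primitive h) z (h z).
Proof.
move=> Hh z1 e e0.
have e4 : 0 < e / 2 by rewrite divr_gt0.
have [d d0 Hd] := holo_cont Hh z1 e4.
exists (Num.min d (1 - cabs z)); first by rewrite lt_min d0 subr_gt0.
move=> k; rewrite lt_min => /andP[kd kz].
have zk : cabs (z + k) < 1 by apply: (le_lt_trans (cabsD _ _)); lra.
rewrite primitive_diff //.
have cs : ccont 0 1 (fun t => h (z + t%:C * k)).
  apply: ccont_comp => [t /andP[t0 t1]|].
    rewrite -[z + _]mul1r; apply: Hh; apply: (@cabs_segment z k 1 t) => //.
      by rewrite ler01 lexx.
    by rewrite t0.
  by apply: ccontD; [exact: ccont_cst|apply: ccontM; [exact: ccont_id|exact: ccont_cst]].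
have E : h z = cint 0 1 (fun=> h z).
  by apply: complex_ext; rewrite /cint /= rint_cst // subr0 mulr1.
rewrite (_ : _ - _ = k * (cint 0 1 (fun t => h (z + t%:C * k)) - cint 0 1 (fun=> h z))); last first.
  by rewrite -E; ring.
rewrite -cintB //; last exact: ccont_cst.
rewrite cabsM mulrC; apply: ler_wpM2r; first exact: cabs_ge0.
rewrite (_ : e = 2 * (e / 2) * (1 - 0)); last by field.
apply: cint_le => //; first by apply: ccontB => //; exact: ccont_cst.
move=> t /andP[t0 t1]; apply: Hd.
rewrite (_ : z + t%:C * k - z = t%:C * k); last by ring.
rewrite cabsM cabsR ger0_norm //; apply: le_lt_trans kd.
by rewrite ler_piMl // cabs_ge0.
Qed.

End CauchyTheory.

(** * Circles: Fourier coefficients and the Cauchy kernel *)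

Section Circle.
Context {R : realType}.
Local Notation C := (Cplx R).
Local Notation mu := (@lebesgue_measure R).

Definition cis (t : R) : C := cos t +i* sin t.

Lemma cabs_cis t : cabs (cis t) = 1.
Proof.
apply/eqP; rewrite -(@eqrXn2 _ 2) ?cabs_ge0 //; apply/eqP.
by rewrite cabs_sqr expr1n /= cos2Dsin2.
Qed.

Lemma cis_neq0 t : cis t != 0.
Proof. by rewrite -cabs_gt0 cabs_cis. Qed.

Lemma cis0 : cis 0 = 1.
Proof. by rewrite /cis cos0 sin0. Qed.

Lemma cis2pi : cis (2 * pi) = 1.
Proof. by rewrite /cis mulr2n mulrDl mul1r -mulr2n cos2pi sin2pi. Qed.

Lemma twopi_ge0 : 0 <= 2 * pi :> R.
Proof. by rewrite mulr_ge0 // pi_ge0. Qed.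

Lemma twopi_gt0 : 0 < 2 * pi :> R.
Proof. by rewrite mulr_gt0 // pi_gt0. Qed.

Lemma cis_ccont a b : ccont a b cis.
Proof. by apply: continuous_ccont; [exact: continuous_cos|exact: continuous_sin]. Qed.

Lemma ci2 : (0 +i* 1 : C) * (0 +i* 1) = -1.
Proof. by apply: complex_ext; rewrite /= ?mul0r ?mulr0 ?mulr1 ?sub0r ?addr0 ?oppr0. Qed.

Let ii : C := 0 +i* 1.

(* Cauchy's theorem on the region between two dilates, with centre z, of a circle. *)
Lemma circle_cone (z : C) (rho s0 s1 : R) (h : C -> C) : 0 <= s0 -> s0 <= s1 -> 0 <= rho ->
  (forall s t, s0 <= s <= s1 -> exists l, cderiv h (z + s%:C * (rho%:C * cis t - z)) l) ->
  s1%:C * cint 0 (2 * pi) (fun t => h (z + s1%:C * (rho%:C * cis t - z)) * (ii * rho%:C * cis t)) =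
  s0%:C * cint 0 (2 * pi) (fun t => h (z + s0%:C * (rho%:C * cis t - z)) * (ii * rho%:C * cis t)).
Proof.
move=> s0_ge0 s01 rho_ge0 Hh.
pose x t := rho * cos t - Re z; pose y t := rho * sin t - Im z.
pose dx t := - (rho * sin t); pose dy t := rho * cos t.
have xP (t : R) : is_derive t 1 x (dx t).
  by apply: is_derive_eq; rewrite /dx /GRing.scale /=; ring.
have yP (t : R) : is_derive t 1 y (dy t).
  by apply: is_derive_eq; rewrite /dy /GRing.scale /=; ring.
have cdx : continuous dx.
  move=> t; apply: cvgN; apply: cvgM; [exact: cvg_cst|exact: continuous_sin].
have cdy : continuous dy.
  move=> t; apply: cvgM; [exact: cvg_cst|exact: continuous_cos].
have gE t : (x t +i* y t : C) = rho%:C * cis t - z.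
  by apply: complex_ext; rewrite /x /y ?cReD ?cImD ?cReN ?cImN ?cReM ?cImM /=; ring.
have dgE t : (dx t +i* dy t : C) = ii * rho%:C * cis t.
  by apply: complex_ext; rewrite /dx /dy ?cReD ?cImD ?cReN ?cImN ?cReM ?cImM /=; ring.
have := @cone_goursat R x y dx dy xP yP cdx cdy z (rho + cabs z) s0 0 (s1 - s0) (2 * pi)
  s0_ge0 _ twopi_ge0 (addr_ge0 rho_ge0 (cabs_ge0 _)) _ _ h _.
rewrite subr_ge0 s01 !add0r (addrC s0) subrK => /(_ isT) H.
have E s : cint 0 (2 * pi) (fun t => h (z + s%:C * (rho%:C * cis t - z)) * (ii * rho%:C * cis t))
    = cint 0 (2 * pi) (fun t => h (z + s%:C * (x t +i* y t)) * (dx t +i* dy t)).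
  by apply: cint_ext => t _; rewrite gE dgE.
rewrite !E; apply/eqP; rewrite -subr_eq0 -H.
- by rewrite !gE cis0 cis2pi; apply/eqP; exact: subrr.
- move=> t _; rewrite gE; apply: (le_trans (cabsB _ _)).
  by rewrite cabsM cabsR cabs_cis mulr1 ger0_norm.
- move=> t _; rewrite dgE !cabsM cabsR cabs_cis mulr1 ger0_norm //.
  rewrite (_ : cabs ii = 1) ?mul1r ?lerDl ?cabs_ge0 //.
  by rewrite /cabs /= expr0n expr1n add0r sqrtr1.
- by move=> s t hs _; rewrite gE; exact: Hh.
Qed.

Lemma cabs_ii : cabs ii = 1.
Proof. by rewrite /cabs /= expr0n expr1n add0r sqrtr1. Qed.

Lemma ii_neq0 : ii != 0.
Proof. by rewrite -cabs_gt0 cabs_ii. Qed.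

(* n-th Fourier coefficient, up to the factor 2 pi *)
Definition fcoef (f : C -> C) (n : nat) (s : R) :=
  cint 0 (2 * pi) (fun t => f (s%:C * cis t) * (cis t ^+ n)^-1).

Lemma holo_circle_ccont (f : C -> C) s a b : holo f -> 0 <= s -> s < 1 ->
  ccont a b (fun t => f (s%:C * cis t)).
Proof.
move=> Hf s0 s1; apply: ccont_comp => [t _|].
  by apply: Hf; rewrite cabsM cabs_cis cabsR mulr1 ger0_norm.
by apply: ccontM; [exact: ccont_cst|exact: cis_ccont].
Qed.

Lemma cisX_ccont n a b : ccont a b (fun t => (cis t ^+ n)^-1).
Proof.
apply: ccontV => [t _|]; first by rewrite expf_neq0 // cis_neq0.
by apply: ccontX; exact: cis_ccont.
Qed.

(** Cauchy's theorem for f(w) / w^(n+1) between two circles about 0: the coefficient on radius s is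
    s^n times a Taylor coefficient independent of s. *)
Lemma fcoef_homog (f : C -> C) n s s' : holo f -> 0 < s -> s < s' -> s' < 1 ->
  s%:C ^+ n * fcoef f n s' = s'%:C ^+ n * fcoef f n s.
Proof.
move=> Hf s0 ss' s'1.
have s'0 : 0 < s' by exact: lt_trans ss'.
have cder q t : s <= q <= s' ->
    exists l, cderiv (fun w => f w * (w ^+ n.+1)^-1) (0 + q%:C * (1%:C * cis t - 0)) l.
  move=> /andP[q1 q2]; have q0 : 0 < q by exact: lt_le_trans q1.
  rewrite add0r subr0 mul1r; set w := q%:C * cis t.
  have wq : cabs w = q by rewrite cabsM cabs_cis cabsR mulr1 ger0_norm // ltW.
  have [l Hl] : exists l, cderiv f w l by apply: Hf; rewrite wq; exact: le_lt_trans s'1.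
  have [m Hm] := cderivX n.+1 (@cderiv_id _ w).
  have wn0 : w ^+ n.+1 != 0 by rewrite expf_neq0 // -cabs_gt0 wq.
  by eexists; exact: cderivM Hl (cderiv_comp Hm (cderivV wn0)).
have := circle_cone (ltW s0) (ltW ss') ler01 cder.
have E q : 0 < q -> q < 1 -> q%:C * cint 0 (2 * pi) (fun t =>
    f (0 + q%:C * (1%:C * cis t - 0)) * ((0 + q%:C * (1%:C * cis t - 0)) ^+ n.+1)^-1 *
    (ii * 1%:C * cis t)) = ii * (q%:C ^+ n)^-1 * fcoef f n q.
  move=> q0 q1; rewrite /fcoef.
  have qC0 : (q%:C : C) != 0 by rewrite -cabs_gt0 cabsR normr_gt0 lt0r_neq0.
  rewrite -!cintZ; last 2 first.
  - apply: (@ccont_ext _ _ _ (fun t => f (q%:C * cis t) * (cis t ^+ n)^-1 * ((q%:C ^+ n.+1)^-1 * ii))).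
      move=> t _; rewrite add0r subr0 !mul1r mulr1 exprMn !exprS; field.
      by rewrite ?qC0 ?cis_neq0 ?expf_neq0 ?cis_neq0.
    apply: ccontM; last exact: ccont_cst.
    by apply: ccontM; [apply: holo_circle_ccont => //; exact: ltW|exact: cisX_ccont].
  - by apply: ccontM; [apply: holo_circle_ccont => //; exact: ltW|exact: cisX_ccont].
  apply: cint_ext => t _; rewrite add0r subr0 !mul1r mulr1 exprMn !exprS; field.
  by rewrite ?qC0 ?cis_neq0 ?expf_neq0 ?cis_neq0.
rewrite !E //; last exact: lt_trans s'1.
have a0 : (s%:C : C) ^+ n != 0 by rewrite expf_neq0 // -cabs_gt0 cabsR normr_gt0 lt0r_neq0.
have b0 : (s'%:C : C) ^+ n != 0 by rewrite expf_neq0 // -cabs_gt0 cabsR normr_gt0 lt0r_neq0.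
move=> H; apply: (mulfI ii_neq0); apply: (mulfI (invr_neq0 a0)); apply: (mulfI (invr_neq0 b0)).
rewrite (_ : (s'%:C ^+ n)^-1 * _ = ii * (s'%:C ^+ n)^-1 * fcoef f n s'); last by field; rewrite a0 b0.
by rewrite H; field; rewrite ?a0 ?b0.
Qed.

Lemma cabs_circle_sub (z : C) rho t : cabs z < rho -> rho - cabs z <= cabs (rho%:C * cis t - z).
Proof.
move=> h; apply: le_trans (cabs_subl _ _); rewrite cabsM cabs_cis cabsR mulr1.
by rewrite ger0_norm // ltW // (le_lt_trans (cabs_ge0 z)).
Qed.

Lemma circle_sub_neq0 (z : C) rho t : cabs z < rho -> rho%:C * cis t - z != 0.
Proof.
by move=> h; rewrite -cabs_gt0; apply: lt_le_trans (cabs_circle_sub t h); rewrite subr_gt0.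
Qed.

Lemma ker_ccont (z : C) rho a b : cabs z < rho ->
  ccont a b (fun t => (rho%:C * cis t) / (rho%:C * cis t - z)).
Proof.
move=> h.
have c : ccont a b (fun t => rho%:C * cis t).
  by apply: ccontM; [exact: ccont_cst|exact: cis_ccont].
apply: ccontM => //; apply: ccontV => [t _|]; first exact: circle_sub_neq0.
by apply: ccontB => //; exact: ccont_cst.
Qed.

Lemma ccont_bounded a b (phi : R -> C) : a <= b -> ccont a b phi ->
  exists2 M : R, 0 <= M & forall t, a <= t <= b -> cabs (phi t) <= M.
Proof.
move=> ab /ccont_within[h1 h2].
have [x1 _ H1] := @EVT_max R (fun t => `|Re (phi t)|) a b ab
  (fun x => cvg_norm (h1 x)).
have [x2 _ H2] := @EVT_max R (fun t => `|Im (phi t)|) a b ab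
  (fun x => cvg_norm (h2 x)).
exists (`|Re (phi x1)| + `|Im (phi x2)|); first exact: addr_ge0.
move=> t tab; apply: (le_trans (cabs_le_ReIm _)); apply: lerD; [apply: H1|apply: H2];
  by rewrite in_itv.
Qed.

(** Expand the kernel in powers of q = z / (rho e^(it)). Every positive power integrates to 0
    against phi, and the remainder after n terms is of order (|z| / rho)^n. *)
Lemma kernel_integral (phi : R -> C) (z : C) rho : cabs z < rho ->
  ccont 0 (2 * pi) phi ->
  (forall n, cint 0 (2 * pi) (fun t => phi t * (cis t ^+ n.+1)^-1) = 0) ->
  cint 0 (2 * pi) (fun t => phi t * ((rho%:C * cis t) / (rho%:C * cis t - z))) =
  cint 0 (2 * pi) phi.
Proof.
move=> h cphi H.
have rho0 : 0 < rho by exact: le_lt_trans (cabs_ge0 z) h.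
have rhoC0 : (rho%:C : C) != 0 by rewrite -cabs_gt0 cabsR normr_gt0 lt0r_neq0.
pose q t : C := z / rho%:C * (cis t)^-1.
have qccont : ccont 0 (2 * pi) q.
  apply: ccontM; first exact: ccont_cst.
  by apply: ccontV => [t _|]; [exact: cis_neq0|exact: cis_ccont].
pose K t := rho%:C * cis t / (rho%:C * cis t - z).
have cK : ccont 0 (2 * pi) K by exact: ker_ccont.
pose I n := cint 0 (2 * pi) (fun t => phi t * q t ^+ n * K t).
(* One step of the geometric series, K = 1 + q * K. *)
have step n : I n = cint 0 (2 * pi) (fun t => phi t * q t ^+ n) + I n.+1.
  rewrite /I -cintD; last 2 first.
  - by apply: ccontM => //; exact: ccontX.
  - by do 2!apply: ccontM => //; exact: ccontX.
  apply: cint_ext => t _.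
  have -> : phi t * q t ^+ n + phi t * q t ^+ n.+1 * K t = phi t * q t ^+ n * (1 + q t * K t).
    by rewrite exprS; ring.
  congr (_ * _); rewrite /K /q; field.
  by rewrite ?circle_sub_neq0 ?cis_neq0 ?rhoC0.
have Iz n : cint 0 (2 * pi) (fun t => phi t * q t ^+ n.+1) = 0.
  rewrite (@cint_ext _ _ _ _ (fun t => (z / rho%:C) ^+ n.+1 * (phi t * (cis t ^+ n.+1)^-1))).
    rewrite cintZ ?H ?mulr0 //; apply: ccontM => //; exact: cisX_ccont.
  by move=> t _; rewrite /q exprMn exprVn; ring.
have I1 n : I 1%N = I n.+1 by elim: n => // n ->; rewrite step Iz add0r.
suff I1_0 : I 1%N = 0.
  transitivity (I 0%N); first by apply: cint_ext => t _; rewrite expr0 mulr1.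
  by rewrite step I1_0 addr0; apply: cint_ext => t _; rewrite expr0 mulr1.
have [M M0 HM] := ccont_bounded twopi_ge0 (ccontM cphi cK).
pose r := cabs z / rho.
have r01 : 0 <= r < 1 by rewrite divr_ge0 ?cabs_ge0 ?(ltW rho0) //= ltr_pdivrMr // mul1r.
have bnd n : cabs (I 1%N) <= 2 * (M * r ^+ n.+1) * (2 * pi - 0).
  rewrite (I1 n); apply: cint_le; first exact: twopi_ge0.
    by do 2!apply: ccontM => //; exact: ccontX.
  move=> t ht; rewrite (_ : _ * _ = phi t * K t * q t ^+ n.+1); last by ring.
  rewrite cabsM cabsX; apply: ler_pM; rewrite ?cabs_ge0 ?exprn_ge0 ?cabs_ge0 ?HM //.
  by rewrite /q !cabsM !cabsV cabs_cis cabsR invr1 mulr1 ger0_norm // ltW.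
apply/eqP; rewrite -cabs_eq0; apply/negPn/negP => I_n0.
have I_gt0 : 0 < cabs (I 1%N) by rewrite lt_def I_n0 cabs_ge0.
have cv : (fun n => 2 * (M * r ^+ n.+1) * (2 * pi - 0)) @ \oo --> 2 * (M * 0) * (2 * pi - 0 : R).
  apply: cvgM; last exact: cvg_cst.
  apply: cvgM; first exact: cvg_cst.
  apply: cvgM; first exact: cvg_cst.
  rewrite (_ : (fun n => r ^+ n.+1) = (fun n => r ^+ (n + 1))); last by apply/funext => n; rewrite addn1.
  rewrite (cvg_shiftn 1 (fun n => r ^+ n)).
  by apply: cvg_expr; rewrite ger0_norm; case/andP: r01.
have := limr_ge (cvgP _ cv) (nearW _ bnd).
by rewrite (cvg_lim _ cv) // !mulr0 mul0r leNgt I_gt0 => hh; have := hh eventually_filter eventually_filter.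
Qed.

End Circle.

(** * Cauchy's integral formula and differentiability of the derivative *)

Section CauchyFormula.
Context {R : realType}.
Local Notation C := (Cplx R).

Lemma holo_cst (c : C) : holo (fun=> c).
Proof. by move=> z _; exists 0; exact: cderiv_cst. Qed.

(** Homogeneity for the constant function at the radii 1/3 and 1/2 multiplies the same number by two
    different factors. *)
Lemma cis_integral n : cint 0 (2 * pi) (fun t : R => 1 * (cis t ^+ n.+1)^-1) = 0.
Proof.
have h1 : 0 < 3^-1 :> R by rewrite invr_gt0.
have h2 : 3^-1 < 2^-1 :> R by rewrite ltf_pV2 ?posrE // ltr_nat.
have h3 : 2^-1 < 1 :> R by rewrite invf_lt1 // ltr1n.
have := fcoef_homog n.+1 (@holo_cst 1) h1 h2 h3; rewrite /fcoef.
set I := cint _ _ _ => /eqP; rewrite -subr_eq0 -mulrBl mulf_eq0 => /orP[|/eqP//].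
rewrite subr_eq0 -!rmorphXn /= => /eqP /complexI /eqP.
by rewrite eqrXn2 ?invr_ge0 // => /eqP E; move: h2; rewrite E ltxx.
Qed.

Lemma kernel_integral1 (z : C) rho : cabs z < rho ->
  cint 0 (2 * pi) (fun t => (rho%:C * cis t) / (rho%:C * cis t - z)) = (2 * pi)%:C.
Proof.
move=> h; transitivity (cint 0 (2 * pi) (fun=> 1 : C)).
  rewrite -(@kernel_integral _ (fun=> 1) z rho h (ccont_cst _) cis_integral).
  by apply: cint_ext => t _; rewrite mul1r.
by apply: complex_ext; rewrite /cint /= rint_cst ?twopi_ge0 // subr0 ?mul1r ?mul0r.
Qed.

(** Shrink the circle towards z by a factor s. By Cauchy's theorem for f(w) / (w - z) the integral J
    s does not depend on s, and as s tends to 0 continuity of f at z leaves f z times the integral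
    of the kernel. *)
Lemma cauchy_formula (f : C -> C) (z : C) rho : holo f -> cabs z < rho -> rho < 1 ->
  cint 0 (2 * pi) (fun t => f (rho%:C * cis t) *
    ((rho%:C * cis t) / (rho%:C * cis t - z))) = (2 * pi)%:C * f z.
Proof.
move=> Hf h rho1; rewrite -(kernel_integral1 h) [RHS]mulrC -cintZ; last exact: ker_ccont.
have rho_gt0 : 0 < rho by exact: le_lt_trans (cabs_ge0 z) h.
have rhoC0 : (rho%:C : C) != 0 by rewrite -cabs_gt0 cabsR normr_gt0 lt0r_neq0.
pose gam t := rho%:C * cis t - z.
have gam0 t : gam t != 0 by exact: circle_sub_neq0.
pose K t := (rho%:C * cis t) / gam t.
have cK : ccont 0 (2 * pi) K by exact: ker_ccont.
have inside s t : 0 <= s <= 1 -> cabs (z + s%:C * gam t) < 1.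
  move=> /andP[s0 s1]; rewrite -[z + _]mul1r; apply: (@cabs_segment _ z (gam t) 1 s) => //.
  - by rewrite ler01 lexx.
  - by rewrite s0.
  - exact: lt_trans rho1.
  - rewrite /gam addrC subrK cabsM cabs_cis cabsR mulr1 ger0_norm //; exact: ltW.
have cf s : 0 <= s <= 1 -> ccont 0 (2 * pi) (fun t => f (z + s%:C * gam t)).
  move=> hs; apply: ccont_comp => [t _|]; first by apply: Hf; exact: inside.
  apply: ccontD; first exact: ccont_cst.
  apply: ccontM; first exact: ccont_cst.
  apply: ccontB; last exact: ccont_cst.
  by apply: ccontM; [exact: ccont_cst|exact: cis_ccont].
pose J s := cint 0 (2 * pi) (fun t => f (z + s%:C * gam t) * K t).
have JE e : 0 < e -> e <= 1 -> J 1 = J e.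
  move=> e0 e1.
  have cder s t : e <= s <= 1 -> exists l, cderiv (fun w => f w * (w - z)^-1)
      (z + s%:C * (rho%:C * cis t - z)) l.
    move=> /andP[es s1]; have s0 : 0 < s by exact: lt_le_trans es.
    have [l Hl] : exists l, cderiv f (z + s%:C * gam t) l.
      by apply: Hf; apply: inside; rewrite s1 ltW.
    have nz : (z + s%:C * gam t) + - z != 0.
      by rewrite addrAC subrr add0r mulf_neq0 // -cabs_gt0 cabsR normr_gt0 lt0r_neq0.
    eexists; apply: (cderivM Hl).
    exact: (cderiv_comp (cderivD (@cderiv_id _ _) (cderiv_cst _ _)) (cderivV nz)).
  have := circle_cone (ltW e0) e1 (ltW rho_gt0) cder.
  have E s : 0 < s -> s <= 1 -> s%:C * cint 0 (2 * pi) (fun t =>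
     f (z + s%:C * (rho%:C * cis t - z)) * (z + s%:C * (rho%:C * cis t - z) - z)^-1 *
      ((0 +i* 1) * rho%:C * cis t)) = (0 +i* 1) * J s.
    move=> s0 s1.
    have sC0 : (s%:C : C) != 0 by rewrite -cabs_gt0 cabsR normr_gt0 lt0r_neq0.
    rewrite /J -cintZ; last first.
      apply: (@ccont_ext _ _ _ (fun t => f (z + s%:C * gam t) * K t * ((0 +i* 1) / s%:C))).
        by move=> t _; rewrite -/(gam t) /K; field; rewrite ?sC0 ?gam0 ?addrK ?mulf_neq0 ?sC0 ?gam0 ?(addrC z) ?addrK ?mulf_neq0.
      by apply: ccontM; [apply: ccontM => //; apply: cf; rewrite s1 ltW|exact: ccont_cst].
    rewrite -cintZ; last by apply: ccontM => //; apply: cf; rewrite s1 ltW.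
    apply: cint_ext => t _; rewrite -/(gam t) /K; field.
    by rewrite ?gam0 ?(addrC z) ?addrK ?mulf_neq0.
  rewrite !E ?ltr01 // => /(mulfI _); apply; exact: ii_neq0.
have -> : cint 0 (2 * pi) (fun t => f (rho%:C * cis t) * K t) = J 1.
  by apply: cint_ext => t _; rewrite /gam mul1r addrC subrK.
apply/eqP; rewrite -subr_eq0 -cabs_eq0; apply/negPn/negP => n0.
set D := cabs _ in n0; have D0 : 0 < D by rewrite lt_def n0 cabs_ge0.
have [M M0 HM] := ccont_bounded twopi_ge0 cK.
have z1 : cabs z < 1 by exact: lt_trans rho1.
have e0 : 0 < D / (2 * (2 * (M + 1) * (2 * pi))).
  by rewrite divr_gt0 // !mulr_gt0 ?pi_gt0 ?ltr_wpDl.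
have [d d0 Hd] := holo_cont Hf z1 e0.
(* This dilation brings the whole circle within d of z. *)
pose e := Num.min 1 (d / (2 * (rho + cabs z))).
have e_gt0 : 0 < e.
  by rewrite lt_min ltr01 divr_gt0 // mulr_gt0 // ltr_pwDl // cabs_ge0.
have e_le1 : e <= 1 by rewrite ge_min lexx.
have hs : 0 <= e <= 1 by rewrite e_le1 ltW.
have : D <= 2 * (D / (2 * (2 * (M + 1) * (2 * pi))) * M) * (2 * pi - 0).
  rewrite {1}/D (JE _ e_gt0 e_le1) -cintB; last 2 first.
  - by apply: ccontM => //; exact: cf.
  - by apply: ccontM => //; exact: ccont_cst.
  apply: cint_le; first exact: twopi_ge0.
    apply: ccontB; apply: ccontM => //; [exact: cf|exact: ccont_cst].
  move=> t ht; rewrite -mulrBl cabsM; apply: ler_pM; rewrite ?cabs_ge0 ?HM //.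
  apply: Hd; rewrite addrAC subrr add0r cabsM cabsR ger0_norm ?(ltW e_gt0) //.
  apply: (@le_lt_trans _ _ (d / (2 * (rho + cabs z)) * (rho + cabs z))).
    apply: ler_pM; rewrite ?cabs_ge0 ?(ltW e_gt0) //; first by rewrite ge_min lexx orbT.
    by apply: (le_trans (cabsB _ _)); rewrite cabsM cabs_cis cabsR mulr1 ger0_norm ?(ltW rho_gt0).
  rewrite (_ : _ * _ = d / 2); first lra.
  by field; rewrite ?lt0r_neq0 // ltr_pwDl // cabs_ge0.
have M1 : M + 1 != 0 by rewrite lt0r_neq0 // ltr_wpDl.
have piE (q : R) : q != 0 ->
    2 * (D / (2 * (2 * (M + 1) * (2 * q))) * M) * (2 * q) = D * (M / (2 * (M + 1))).
  by move=> q0; field; rewrite M1 q0.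
rewrite subr0 piE; last by rewrite lt0r_neq0 // pi_gt0.
rewrite leNgt => /negP; apply; rewrite -[ltRHS]mulr1 ltr_pM2l //.
by rewrite ltr_pdivrMr; lra.
Qed.

(** Cauchy's formula together with the expansion of the kernel reduces f z to the coefficient of
    order 0. *)
Lemma fcoef_eq0 (f : C -> C) z : holo f ->
  (forall n s, 0 < s -> s < 1 -> fcoef f n s = 0) -> cabs z < 1 -> f z = 0.
Proof.
move=> Hf H z1; pose rho := (1 + cabs z) / 2.
have zr : cabs z < rho by rewrite /rho ltr_pdivlMr //; lra.
have rho1 : rho < 1 by rewrite /rho ltr_pdivrMr //; lra.
have rho0 : 0 < rho by exact: le_lt_trans (cabs_ge0 z) zr.
have := cauchy_formula Hf zr rho1.
rewrite kernel_integral //; last 2 first.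
- by apply: holo_circle_ccont => //; exact: ltW.
- by move=> n; exact: H.
have -> : cint 0 (2 * pi) (fun t => f (rho%:C * cis t)) = fcoef f 0 rho.
  by apply: cint_ext => t _; rewrite expr0 invr1 mulr1.
rewrite H // => /esym/eqP; rewrite mulf_eq0 => /orP[|/eqP//].
by rewrite -cabs_eq0 cabsR normr_eq0 => /eqP h; move: (@twopi_gt0 R); rewrite h ltxx.
Qed.

(** Differentiation under the integral sign: the second-order estimate on K is uniform over the
    circle, so it can be integrated. *)
Lemma circle_integral_cderiv (K K1 : C -> C) (phi : R -> C) (z : C) rho B :
  cabs z < rho -> 0 <= B -> ccont 0 (2 * pi) phi ->
  (forall w, cabs w < rho -> ccont 0 (2 * pi) (fun t => K (rho%:C * cis t - w))) ->
  (forall w, cabs w < rho -> ccont 0 (2 * pi) (fun t => K1 (rho%:C * cis t - w))) ->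
  (forall u k, rho - cabs z <= cabs u -> cabs u <= 2 * rho ->
     cabs k <= (rho - cabs z) / 2 ->
     cabs (K (u - k) - K u - k * K1 u) <= B * cabs k ^+ 2) ->
  cderiv (fun w => cint 0 (2 * pi) (fun t => phi t * K (rho%:C * cis t - w))) z
    (cint 0 (2 * pi) (fun t => phi t * K1 (rho%:C * cis t - z))).
Proof.
move=> zr B0 cphi cK cK1 HK e e0.
have [M M0 HM] := ccont_bounded twopi_ge0 cphi.
pose A := 2 * (M * B) * (2 * pi) + 1.
have A0 : 0 < A by rewrite ltr_wpDl // !mulr_ge0 // pi_ge0.
exists (Num.min ((rho - cabs z) / 2) (e / A)).
  by rewrite lt_min !divr_gt0 // subr_gt0.
move=> k; rewrite lt_min => /andP[k1 k2].
have zk : cabs (z + k) < rho by apply: (le_lt_trans (cabsD _ _)); lra.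
have c1 := ccontM cphi (cK _ zk); have c2 := ccontM cphi (cK _ zr).
have c3 := ccontM cphi (cK1 _ zr).
rewrite -cintB // [cint _ _ _ * k]mulrC -cintZ // -cintB //; last 2 first.
- exact: ccontB.
- by apply: ccontM => //; exact: ccont_cst.
apply: (@le_trans _ _ (2 * (M * (B * cabs k ^+ 2)) * (2 * pi - 0))).
  apply: cint_le; first exact: twopi_ge0.
    by apply: ccontB; [exact: ccontB|apply: ccontM => //; exact: ccont_cst].
  move=> t ht.
  rewrite (_ : _ - _ = phi t * (K (rho%:C * cis t - z - k) - K (rho%:C * cis t - z)
     - k * K1 (rho%:C * cis t - z))); last by rewrite opprD addrA; ring.
  rewrite cabsM; apply: ler_pM; rewrite ?cabs_ge0 ?HM //; apply: HK; last exact: ltW.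
    exact: cabs_circle_sub.
  apply: (le_trans (cabsB _ _)); rewrite cabsM cabs_cis cabsR mulr1 ger0_norm; first lra.
  by rewrite ltW // (le_lt_trans _ zr) // cabs_ge0.
have k0 := cabs_ge0 k.
rewrite (_ : _ * (2 * pi - 0) = ((A - 1) * cabs k) * cabs k); last by rewrite /A; ring.
apply: ler_wpM2r => //; apply: (@le_trans _ _ (A * (e / A))).
  apply: ler_pM => //; [by rewrite /A addrK !mulr_ge0 // pi_ge0|lra|exact: ltW].
by rewrite mulrC divfK // lt0r_neq0.
Qed.

Lemma circle_pow_ccont (w : C) rho n : cabs w < rho ->
  ccont 0 (2 * pi) (fun t => ((rho%:C * cis t - w) ^+ n)^-1).
Proof.
move=> h; apply: ccontV => [t _|]; first by rewrite expf_neq0 // circle_sub_neq0.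
apply: ccontX; apply: ccontB; last exact: ccont_cst.
by apply: ccontM; [exact: ccont_cst|exact: cis_ccont].
Qed.

Let sub_le (u k : C) d : d <= cabs u -> cabs k <= d / 2 -> d / 2 <= cabs (u - k).
Proof. by have := cabs_subl u k; lra. Qed.

Let inv_le (x : C) d n : 0 < d -> d <= cabs x -> cabs (x ^+ n)^-1 <= (d ^+ n)^-1.
Proof.
move=> d0 h; rewrite cabsV cabsX lef_pV2 ?posrE ?exprn_gt0 //; last exact: lt_le_trans h.
by apply: lerXn2r => //; rewrite nnegrE ?cabs_ge0 // ltW.
Qed.

(** Differentiating Cauchy's formula for g represents g' by the kernel u^-2, and that representation
    can be differentiated again. *)
Lemma holo_deriv (g g' : C -> C) : (forall z, cabs z < 1 -> cderiv g z (g' z)) -> holo g'.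
Proof.
move=> Hg z z1; pose rho := (1 + cabs z) / 2.
have zr : cabs z < rho by rewrite /rho ltr_pdivlMr //; lra.
have rho1 : rho < 1 by rewrite /rho ltr_pdivrMr //; lra.
have rho0 : 0 < rho by exact: le_lt_trans (cabs_ge0 z) zr.
have Hh : holo g by move=> w /Hg H; exists (g' w).
pose phi t := g (rho%:C * cis t) * (rho%:C * cis t).
have cphi : ccont 0 (2 * pi) phi.
  apply: ccontM; first by apply: holo_circle_ccont => //; exact: ltW.
  by apply: ccontM; [exact: ccont_cst|exact: cis_ccont].
have pi0 : ((2 * pi)%:C : C) != 0 by rewrite -cabs_gt0 cabsR normr_gt0 lt0r_neq0 // twopi_gt0.
have gE w : cabs w < rho -> g w = ((2 * pi)%:C)^-1 *
    cint 0 (2 * pi) (fun t => phi t * ((rho%:C * cis t - w) ^+ 1)^-1).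
  move=> wr; apply: (mulfI pi0); rewrite mulVKf // -(cauchy_formula Hh wr rho1).
  by apply: cint_ext => t _; rewrite /phi expr1 mulrA.
have cc n w : cabs w < rho -> ccont 0 (2 * pi) (fun t => (n%:R : C) * ((rho%:C * cis t - w) ^+ n.+1)^-1).
  by move=> wr; apply: ccontM; [exact: ccont_cst|exact: circle_pow_ccont].
have cderZ (f : C -> C) w l (c : C) : cderiv f w l -> cderiv (fun w => c * f w) w (c * l).
  move=> H; have := cderivM (@cderiv_cst R c w) H; rewrite mul0r add0r; exact.
have g'E w : cabs w < rho -> g' w = ((2 * pi)%:C)^-1 *
    cint 0 (2 * pi) (fun t => phi t * (1%:R * ((rho%:C * cis t - w) ^+ 2)^-1)).
  move=> wr; apply: (@cderiv_unique _ g w); first by apply: Hg; exact: lt_trans rho1.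
  have wr0 : 0 < rho - cabs w by rewrite subr_gt0.
  apply: (@cderiv_ext _ _ g w _ _ wr0 _ (cderZ _ _ _ _ _)) => [v vw|].
    rewrite gE //; rewrite -(subrK w v); apply: (le_lt_trans (cabsD _ _)); lra.
  pose d := rho - cabs w; pose B := ((d ^+ 2)^-1 * ((d / 2) ^+ 1)^-1).
  have B0 : 0 <= B by rewrite mulr_ge0 // invr_ge0 exprn_ge0 // ?divr_ge0 // ltW.
  apply: (@circle_integral_cderiv (fun u => (u ^+ 1)^-1) (fun u => 1%:R * (u ^+ 2)^-1) _ _ _ B) => //.
  - by move=> v vr; exact: circle_pow_ccont.
  - by move=> v vr; exact: cc.
  - move=> u k u1 u2 k1.
    have u0 : u != 0 by rewrite -cabs_gt0 (lt_le_trans _ u1).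
    have uk := sub_le u1 k1.
    have uk0 : u - k != 0 by rewrite -cabs_gt0; apply: lt_le_trans uk; rewrite divr_gt0.
    rewrite (_ : _ - _ = ((u ^+ 2)^-1 * ((u - k) ^+ 1)^-1) * k ^+ 2); last first.
      by field; rewrite u0 uk0.
    rewrite cabsM cabsX; apply: ler_wpM2r; first by rewrite exprn_ge0 // cabs_ge0.
    rewrite cabsM; apply: ler_pM; rewrite ?cabs_ge0 //; apply: inv_le => //.
    by rewrite divr_gt0.
eexists.
have zr0 : 0 < rho - cabs z by rewrite subr_gt0.
apply: (@cderiv_ext _ _ g' z _ _ zr0 _ (cderZ _ _ _ _ _)) => [v vw|].
  rewrite g'E //; rewrite -(subrK z v); apply: (le_lt_trans (cabsD _ _)); lra.
pose d := rho - cabs z; pose B := 8 * ((d ^+ 3)^-1 * ((d / 2) ^+ 2)^-1).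
have B0 : 0 <= B by rewrite !mulr_ge0 // invr_ge0 exprn_ge0 // ?divr_ge0 // ltW.
apply: (@circle_integral_cderiv (fun u => 1%:R * (u ^+ 2)^-1) (fun u => 2%:R * (u ^+ 3)^-1) _ _ _ B) => //.
- by move=> v vr; exact: (cc 1%N).
- by move=> v vr; exact: (cc 2%N).
- move=> u k u1 u2 k1.
  have u0 : u != 0 by rewrite -cabs_gt0 (lt_le_trans _ u1).
  have uk := sub_le u1 k1.
  have uk0 : u - k != 0 by rewrite -cabs_gt0; apply: lt_le_trans uk; rewrite divr_gt0.
  rewrite (_ : _ - _ = (3%:R * u - 2%:R * k) * ((u ^+ 3)^-1 * ((u - k) ^+ 2)^-1) * k ^+ 2); last first.
    by field; rewrite u0 uk0.
  rewrite cabsM cabsX; apply: ler_wpM2r; first by rewrite exprn_ge0 // cabs_ge0.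
  rewrite cabsM; apply: ler_pM; rewrite ?cabs_ge0 //.
    have nat n : cabs (n%:R : C) = n%:R by rewrite -(rmorph_nat (real_complex R)) cabsR ger0_norm.
    apply: (le_trans (cabsB _ _)); rewrite !cabsM !nat.
    by have := cabs_ge0 z; lra.
  rewrite cabsM; apply: ler_pM; rewrite ?cabs_ge0 //; apply: inv_le => //.
  by rewrite divr_gt0.
Qed.

End CauchyFormula.

(** * Cauchy's formula on rectangles and a boundary mean value inequality *)

Section Rectangle.
Context {R : realType}.
Local Notation C := (Cplx R).
Local Notation mu := (@lebesgue_measure R).

Definition vseg (b : R) (t : R) : C := b +i* t.
Definition hseg (d : R) (t : R) : C := t +i* d.

Let ii : C := 0 +i* 1.

Lemma vseg_ccont b u v : ccont u v (vseg b).
Proof. by apply: continuous_ccont => x; [exact: cvg_cst|exact: cvg_id]. Qed.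

Lemma hseg_ccont d u v : ccont u v (hseg d).
Proof. by apply: continuous_ccont => x; [exact: cvg_id|exact: cvg_cst]. Qed.

(** The counterclockwise boundary integral; [ii] is the derivative of the vertical
    parametrization. *)
Definition rect_sum (a b c d : R) (F : C -> C) : C :=
  cint c d (fun t => ii * F (vseg b t)) - cint c d (fun t => ii * F (vseg a t))
  - cint a b (fun t => F (hseg d t)) + cint a b (fun t => F (hseg c t)).

Variables (z : C) (a b c d : R) (f : C -> C).
Hypotheses (az : a < Re z) (zb : Re z < b) (cz : c < Im z) (zd : Im z < d).
Hypothesis Hf : holo f.
Hypothesis rect_in : forall x y, a <= x <= b -> c <= y <= d -> cabs (x +i* y : C) < 1.

Let scale (s : R) (w : C) : C := z + s%:C * (w - z).

Let scaleE s (w : C) : scale s w =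
  (Re z + s * (Re w - Re z)) +i* (Im z + s * (Im w - Im z)).
Proof.
by apply: complex_ext; rewrite /scale ?cReD ?cImD ?cReM ?cImM ?cReD ?cImD ?cReN ?cImN /=; ring.
Qed.

Let scale1 w : scale 1 w = w.
Proof. by rewrite /scale -[1%:C]/(1 : C) mul1r; ring. Qed.

Let z_in : cabs z < 1.
Proof.
have -> : z = (Re z) +i* (Im z) by case: (z).
by apply: rect_in; rewrite !ltW.
Qed.

Let scale_in s x y : 0 <= s <= 1 -> a <= x <= b -> c <= y <= d ->
  cabs (scale s (x +i* y)) < 1.
Proof.
move=> hs hx hy; rewrite /scale -[_ + _]mul1r.
apply: (@cabs_segment _ z (x +i* y - z) 1 s) => //; first by rewrite ler01 lexx.
by rewrite addrC subrK; exact: rect_in.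
Qed.

Let H (w : C) := f w / (w - z).

(** Goursat between a side and its dilate towards z by the factor s. On the dilated side the s from
    the length element cancels the s in w - z, so the kernel stays that of the original side. *)
Let cone_side (p q : R -> R) (dp dq : R) (t0 t1 s : R) :
  (forall t : R, is_derive t 1 p dp) -> (forall t : R, is_derive t 1 q dq) ->
  t0 <= t1 -> 0 < s -> s <= 1 ->
  (forall t, t0 <= t <= t1 -> a <= p t <= b /\ c <= q t <= d) ->
  (forall t, t0 <= t <= t1 -> (p t +i* q t : C) != z) ->
  cint s 1 (fun r => H (scale r (p t1 +i* q t1)) * (p t1 +i* q t1 - z))
  - cint s 1 (fun r => H (scale r (p t0 +i* q t0)) * (p t0 +i* q t0 - z)) =
  cint t0 t1 (fun t => f (p t +i* q t) / (p t +i* q t - z) * (dp +i* dq)) -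
  cint t0 t1 (fun t => f (scale s (p t +i* q t)) / (p t +i* q t - z) * (dp +i* dq)).
Proof.
move=> Hp Hq t01 s0 s1 Hin Hz; move: (az) (zb) (cz) (zd) => az' zb' cz' zd'.
pose x t := p t - Re z; pose y t := q t - Im z.
have xP (t : R) : is_derive t 1 x dp.
  by have := Hp t => h; apply: is_derive_eq; rewrite subr0.
have yP (t : R) : is_derive t 1 y dq.
  by have := Hq t => h; apply: is_derive_eq; rewrite subr0.
have cc (k : R) : continuous (fun _ : R => k) by move=> ?; exact: cvg_cst.
have gE t : (x t +i* y t : C) = p t +i* q t - z.
  by apply: complex_ext; rewrite ?cReD ?cImD ?cReN ?cImN.
pose G := (b - a) + (d - c) + cabs (dp +i* dq : C).
have G0 : 0 <= G by apply: addr_ge0; [lra|exact: cabs_ge0].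
have := @cone_goursat R x y (fun=> dp) (fun=> dq) xP yP (cc _) (cc _) z G s t0 (1 - s) (t1 - t0)
  (ltW s0) _ _ G0 _ _ H _.
rewrite !subr_ge0 s1 t01 !(addrC _ (_ - _)) !subrK => /(_ isT isT) K.
have E (r : R) : 0 < r -> r <= 1 -> r%:C * cint t0 t1 (fun t => H (z + r%:C * (x t +i* y t)) * (dp +i* dq))
   = cint t0 t1 (fun t => f (scale r (p t +i* q t)) / (p t +i* q t - z) * (dp +i* dq)).
  move=> r0 r1; have rC0 : (r%:C : C) != 0 by rewrite -cabs_gt0 cabsR normr_gt0 lt0r_neq0.
  have e t : t0 <= t <= t1 -> r%:C * (H (z + r%:C * (x t +i* y t)) * (dp +i* dq)) =
     f (scale r (p t +i* q t)) / (p t +i* q t - z) * (dp +i* dq).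
    move=> ht; have n0 : p t +i* q t - z != 0 by rewrite subr_eq0 Hz.
    rewrite gE -/(scale r _) /H {2}/scale [z + _]addrC addrK invfM.
    move: (p t +i* q t - z) n0 => u n0; field.
    by rewrite rC0 n0.
  have cp : continuous p.
    by move=> t; apply: differentiable_continuous; apply/derivable1_diffP; exact: (@ex_derive _ _ _ _ _ _ _ (Hp t)).
  have cq : continuous q.
    by move=> t; apply: differentiable_continuous; apply/derivable1_diffP; exact: (@ex_derive _ _ _ _ _ _ _ (Hq t)).
  rewrite -cintZ; first by apply: cint_ext; exact: e.
  apply: (@ccont_ext _ _ _ (fun t => r%:C^-1 * (f (scale r (p t +i* q t)) / (p t +i* q t - z) * (dp +i* dq)))).
    by move=> t ht; rewrite -e // mulKf.
  apply: ccontM; first exact: ccont_cst.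
  apply: ccontM; last exact: ccont_cst.
  have cpq : ccont t0 t1 (fun t => p t +i* q t : C) by exact: continuous_ccont.
  have cs : ccont t0 t1 (fun t => p t +i* q t - z) by apply: ccontB => //; exact: ccont_cst.
  apply: ccontM.
    apply: ccont_comp.
      move=> t ht; apply: Hf; have [h1 h2] := Hin t ht; apply: scale_in => //.
      by rewrite r1 ltW.
    apply: ccontD; first exact: ccont_cst.
    by apply: ccontM => //; exact: ccont_cst.
  by apply: ccontV => // t ht; rewrite subr_eq0 Hz.
have E1 : cint t0 t1 (fun t => f (p t +i* q t) / (p t +i* q t - z) * (dp +i* dq)) =
   1%:C * cint t0 t1 (fun t => H (z + 1%:C * (x t +i* y t)) * (dp +i* dq)).
  by rewrite E //; apply: cint_ext => t _; rewrite scale1.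
rewrite E1 -(E s) // -K.
- by congr (_ - _); apply: cint_ext => r _; rewrite gE.
- move=> t /Hin[/andP[h1 h2] /andP[h3 h4]].
  apply: (le_trans (cabs_le_ReIm _)); rewrite /= /x /y /G.
  have k1 : `|p t - Re z| <= b - a by rewrite ler_norml; apply/andP; split; lra.
  have k2 : `|q t - Im z| <= d - c by rewrite ler_norml; apply/andP; split; lra.
  have := cabs_ge0 (dp +i* dq : C); lra.
- by move=> t _; rewrite /G lerDr; lra.
- move=> r t /andP[r0 r1] ht; rewrite gE -/(scale _ _).
  have r_gt0 : 0 < r by exact: lt_le_trans r0.
  have [h1 h2] := Hin t ht.
  have [l Hl] : exists l, cderiv f (scale r (p t +i* q t)) l.
    by apply: Hf; apply: scale_in => //; rewrite r1 ltW.
  have nz : scale r (p t +i* q t) + - z != 0.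
    rewrite /scale [z + _]addrC addrK mulf_neq0 //.
      by rewrite -cabs_gt0 cabsR normr_gt0 lt0r_neq0.
    by rewrite subr_eq0 Hz.
  eexists; apply: (cderivM Hl).
  exact: (cderiv_comp (cderivD (@cderiv_id _ _) (cderiv_cst _ _)) (cderivV nz)).
Qed.

Let ab : a < b. Proof. exact: lt_trans zb. Qed.
Let cd : c < d. Proof. exact: lt_trans zd. Qed.

Let neq_z (x y : R) : x != Re z \/ y != Im z -> (x +i* y : C) != z.
Proof.
by move=> h; apply/eqP => e; case: h => /eqP; apply; rewrite -e.
Qed.

(** Add the four sides; the radial segments through the corners cancel in pairs. *)
Let side_const s : 0 < s -> s <= 1 ->
  rect_sum a b c d (fun w => f w / (w - z)) =
  rect_sum a b c d (fun w => f (scale s w) / (w - z)).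
Proof.
move=> s0 s1.
have idP (t : R) : is_derive t 1 (id : R -> R) 1 by exact: is_derive_id.
have cP (k t : R) : is_derive t 1 (fun _ : R => k) 0 by exact: is_derive_cst.
have hb t : c <= t <= d -> a <= b <= b /\ c <= id t <= d by rewrite lexx andbT (ltW ab).
have ha t : c <= t <= d -> a <= a <= b /\ c <= id t <= d by rewrite lexx /= (ltW ab).
have hd t : a <= t <= b -> a <= id t <= b /\ c <= d <= d by rewrite lexx andbT (ltW cd).
have hc t : a <= t <= b -> a <= id t <= b /\ c <= c <= d by rewrite lexx /= (ltW cd).
have nb t : c <= t <= d -> (b +i* id t : C) != z by move=> _; apply: neq_z; left; rewrite gt_eqF.
have na t : c <= t <= d -> (a +i* id t : C) != z by move=> _; apply: neq_z; left; rewrite lt_eqF.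
have nd t : a <= t <= b -> (id t +i* d : C) != z by move=> _; apply: neq_z; right; rewrite gt_eqF.
have nc t : a <= t <= b -> (id t +i* c : C) != z by move=> _; apply: neq_z; right; rewrite lt_eqF.
have K1 := cone_side (cP b) idP (ltW cd) s0 s1 hb nb.
have K2 := cone_side (cP a) idP (ltW cd) s0 s1 ha na.
have K3 := cone_side idP (cP d) (ltW ab) s0 s1 hd nd.
have K4 := cone_side idP (cP c) (ltW ab) s0 s1 hc nc.
have ver (g : C -> C) x : cint c d (fun t => g (x +i* t) / (x +i* t - z) * (0 +i* 1)) =
    cint c d (fun t => ii * (g (vseg x t) / (vseg x t - z))).
  by apply: cint_ext => t _; rewrite mulrC.
have hor (g : C -> C) y : cint a b (fun t => g (t +i* y) / (t +i* y - z) * (1 +i* 0)) =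
    cint a b (fun t => g (hseg y t) / (hseg y t - z)).
  by apply: cint_ext => t _; rewrite (_ : (1 +i* 0 : C) = 1) ?mulr1.
rewrite /= (ver f) (ver (fun w => f (scale s w))) in K1.
rewrite /= (ver f) (ver (fun w => f (scale s w))) in K2.
rewrite /= (hor f) (hor (fun w => f (scale s w))) in K3.
rewrite /= (hor f) (hor (fun w => f (scale s w))) in K4.
have alg (r1 r2 r3 r4 a1 a2 a3 a4 e1 e2 e3 e4 : C) :
    r1 - r2 = a1 - e1 -> r3 - r4 = a2 - e2 -> r1 - r3 = a3 - e3 -> r2 - r4 = a4 - e4 ->
    a1 - a2 - a3 + a4 = e1 - e2 - e3 + e4.
  move=> h1 h2 h3 h4; apply/eqP; rewrite -subr_eq0; apply/eqP.
  rewrite (_ : _ - _ = (a1 - e1) - (a2 - e2) - (a3 - e3) + (a4 - e4)); last by ring.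
  by rewrite -h1 -h2 -h3 -h4; ring.
exact: alg K1 K2 K3 K4.
Qed.

Let quot_ccont (u v : R) (g : C -> C) (seg : R -> C) :
  (forall t, u <= t <= v -> seg t != z) -> ccont u v seg ->
  (forall t, u <= t <= v -> exists l, cderiv g (seg t) l) ->
  ccont u v (fun t => g (seg t) / (seg t - z)).
Proof.
move=> nz cs Hg; apply: ccontM; first exact: ccont_comp.
apply: ccontV; first by move=> t ht; rewrite subr_eq0 nz.
by apply: ccontB => //; exact: ccont_cst.
Qed.

Let vseg_neq b' t : b' != Re z -> vseg b' t != z.
Proof. by move=> h; apply: neq_z; left. Qed.
Let hseg_neq d' t : d' != Im z -> hseg d' t != z.
Proof. by move=> h; apply: neq_z; right. Qed.

(* The crude factor 2 comes from bounding a complex integral through its real and imaginary parts. *)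
Lemma rect_sum_le (F : C -> C) (m : R) :
  ccont c d (fun t => F (vseg b t)) -> ccont c d (fun t => F (vseg a t)) ->
  ccont a b (fun t => F (hseg d t)) -> ccont a b (fun t => F (hseg c t)) ->
  (forall x y, a <= x <= b -> c <= y <= d -> (x = a \/ x = b) \/ (y = c \/ y = d) ->
     cabs (F (x +i* y)) <= m) ->
  cabs (rect_sum a b c d F) <= 4 * m * ((b - a) + (d - c)).
Proof.
move=> c1 c2 c3 c4 HF.
have cZ u v g : ccont u v g -> ccont u v (fun t => ii * g t).
  by move=> h; apply: ccontM => //; exact: ccont_cst.
have tri (z1 z2 z3 z4 : C) :
  cabs (z1 - z2 - z3 + z4) <= cabs z1 + cabs z2 + cabs z3 + cabs z4.
  by do 3![apply: (le_trans (cabsD _ _)); rewrite ?cabsN; apply: lerD => //].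
have ab' := ltW ab; have cd' := ltW cd.
have i1 w : cabs (ii * w) = cabs w by rewrite cabsM cabs_ii mul1r.
have b1 : cabs (cint c d (fun t => ii * F (vseg b t))) <= 2 * m * (d - c).
  apply: cint_le => // [|t ht]; first exact: cZ.
  by rewrite i1; apply: HF => //; [rewrite lexx andbT|left; right].
have b2 : cabs (cint c d (fun t => ii * F (vseg a t))) <= 2 * m * (d - c).
  apply: cint_le => // [|t ht]; first exact: cZ.
  by rewrite i1; apply: HF => //; [rewrite lexx|left; left].
have b3 : cabs (cint a b (fun t => F (hseg d t))) <= 2 * m * (b - a).
  by apply: cint_le => // t ht; apply: HF => //; [rewrite lexx andbT|right; right].
have b4 : cabs (cint a b (fun t => F (hseg c t))) <= 2 * m * (b - a).
  by apply: cint_le => // t ht; apply: HF => //; [rewrite lexx|right; left].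
apply: (le_trans (tri _ _ _ _)).
apply: (le_trans (lerD (lerD (lerD b1 b2) b3) b4)).
by rewrite le_eqVlt; apply/orP; left; apply/eqP; ring.
Qed.

Lemma rect_sumB (F G : C -> C) :
  ccont c d (fun t => F (vseg b t)) -> ccont c d (fun t => F (vseg a t)) ->
  ccont a b (fun t => F (hseg d t)) -> ccont a b (fun t => F (hseg c t)) ->
  ccont c d (fun t => G (vseg b t)) -> ccont c d (fun t => G (vseg a t)) ->
  ccont a b (fun t => G (hseg d t)) -> ccont a b (fun t => G (hseg c t)) ->
  rect_sum a b c d (fun w => F w - G w) = rect_sum a b c d F - rect_sum a b c d G.
Proof.
move=> f1 f2 f3 f4 g1 g2 g3 g4.
have cZ u v g : ccont u v g -> ccont u v (fun t => ii * g t).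
  by move=> h; apply: ccontM => //; exact: ccont_cst.
have E x : ccont c d (fun t => F (vseg x t)) -> ccont c d (fun t => G (vseg x t)) ->
    cint c d (fun t => ii * (F (vseg x t) - G (vseg x t))) =
    cint c d (fun t => ii * F (vseg x t)) - cint c d (fun t => ii * G (vseg x t)).
  move=> h1 h2; rewrite -cintB; [|exact: cZ..].
  by apply: cint_ext => t _; rewrite mulrBr.
by rewrite /rect_sum !E // !cintB //; ring.
Qed.

Lemma rect_sumZ (k : C) (F : C -> C) :
  ccont c d (fun t => F (vseg b t)) -> ccont c d (fun t => F (vseg a t)) ->
  ccont a b (fun t => F (hseg d t)) -> ccont a b (fun t => F (hseg c t)) ->
  rect_sum a b c d (fun w => k * F w) = k * rect_sum a b c d F.
Proof.
move=> f1 f2 f3 f4.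
have E x : ccont c d (fun t => F (vseg x t)) ->
    cint c d (fun t => ii * (k * F (vseg x t))) = k * cint c d (fun t => ii * F (vseg x t)).
  move=> h1; rewrite -cintZ; last by apply: ccontM => //; exact: ccont_cst.
  by apply: cint_ext => t _; ring.
by rewrite /rect_sum !E // !cintZ //; ring.
Qed.

Variable eta : R.
Hypotheses (eta_gt0 : 0 < eta) (az_eta : a <= Re z - eta) (zb_eta : Re z + eta <= b)
  (cz_eta : c <= Im z - eta) (zd_eta : Im z + eta <= d).

Let bneq : b != Re z. Proof. by rewrite gt_eqF. Qed.
Let aneq : a != Re z. Proof. by rewrite lt_eqF. Qed.
Let dneq : d != Im z. Proof. by rewrite gt_eqF. Qed.
Let cneq : c != Im z. Proof. by rewrite lt_eqF. Qed.

Let side_dist x y : (x = a \/ x = b) \/ (y = c \/ y = d) ->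
  eta <= cabs (x +i* y - z).
Proof.
move: eta_gt0 az_eta zb_eta cz_eta zd_eta => e0 h1 h2 h3 h4 [|] h.
  apply: le_trans (Re_le _); rewrite cReD cReN /= ler_normr.
  by apply/orP; case: h => ->; [right|left]; lra.
apply: le_trans (Im_le _); rewrite cImD cImN /= ler_normr.
by apply/orP; case: h => ->; [right|left]; lra.
Qed.

Let hin_v x t : (x = a \/ x = b) -> c <= t <= d -> cabs (vseg x t) < 1.
Proof. by move=> hx ht; apply: rect_in => //; case: hx => ->; rewrite lexx ltW. Qed.
Let hin_h y t : (y = c \/ y = d) -> a <= t <= b -> cabs (hseg y t) < 1.
Proof. by move=> hy ht; apply: rect_in => //; case: hy => ->; rewrite lexx ltW. Qed.

Let quot_all (g : C -> C) : holo g ->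
  [/\ ccont c d (fun t => g (vseg b t) / (vseg b t - z)),
      ccont c d (fun t => g (vseg a t) / (vseg a t - z)),
      ccont a b (fun t => g (hseg d t) / (hseg d t - z)) &
      ccont a b (fun t => g (hseg c t) / (hseg c t - z))].
Proof.
move=> Hg; split; apply: quot_ccont => [t ht||t ht].
- exact: vseg_neq. - exact: vseg_ccont. - by apply: Hg; apply: hin_v => //; right.
- exact: vseg_neq. - exact: vseg_ccont. - by apply: Hg; apply: hin_v => //; left.
- exact: hseg_neq. - exact: hseg_ccont. - by apply: Hg; apply: hin_h => //; right.
- exact: hseg_neq. - exact: hseg_ccont. - by apply: Hg; apply: hin_h => //; left.
Qed.

Let scale_holo s : 0 < s -> s <= 1 -> forall w, cabs w < 1 ->
  exists l, cderiv (fun w => f (scale s w)) w l.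
Proof.
move=> s0 s1 w w1.
have [l Hl] : exists l, cderiv f (scale s w) l.
  apply: Hf; rewrite /scale -[_ + _]mul1r; apply: (@cabs_segment _ z (w - z) 1 s) => //.
  - by rewrite ler01 lexx.
  - by rewrite s1 ltW.
  - by rewrite addrC subrK.
eexists; apply: (cderiv_comp _ Hl).
apply: cderivD; first exact: cderiv_cst.
apply: cderivM; first exact: cderiv_cst.
exact: (cderivD (@cderiv_id _ _) (cderiv_cst _ _)).
Qed.

(** Let s tend to 0 in [side_const]: f on the dilated contour tends to f z. The winding integral is
    kept as a factor and is only bounded below afterwards. *)
Lemma rect_cauchy : rect_sum a b c d (fun w => f w / (w - z)) =
  f z * rect_sum a b c d (fun w => 1 / (w - z)).
Proof.
have [qc1 qc2 qc3 qc4] := quot_all (@holo_cst R 1).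
have [k1 k2 k3 k4] := quot_all (@holo_cst R (f z)).
have -> : f z * rect_sum a b c d (fun w => 1 / (w - z)) =
    rect_sum a b c d (fun w => f z / (w - z)).
  rewrite -rect_sumZ // /rect_sum.
  have e w : f z * (1 / (w - z)) = f z / (w - z) by rewrite mulrA mulr1.
  by congr (_ - _ - _ + _); apply: cint_ext => t _; rewrite e.
apply/eqP; rewrite -subr_eq0 -cabs_eq0; apply/negPn/negP => n0.
set D := cabs _ in n0; have D0 : 0 < D by rewrite lt_def n0 cabs_ge0.
pose P := (b - a) + (d - c).
have P0 : 0 < P by rewrite addr_gt0 // subr_gt0.
have e0 : 0 < D / (8 * P) * eta by rewrite mulr_gt0 // divr_gt0 // mulr_gt0.
have [r r0 Hr] := holo_cont Hf z_in e0.
pose s := Num.min 1 (r / (2 * P)).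
have s0 : 0 < s by rewrite lt_min ltr01 divr_gt0 // mulr_gt0.
have s1 : s <= 1 by rewrite ge_min lexx.
have [h1 h2 h3 h4] := quot_all (scale_holo s0 s1).
have : D <= 4 * (D / (8 * P)) * P.
  rewrite {1}/D (side_const s0 s1) -rect_sumB //.
  apply: (@rect_sum_le (fun w => f (scale s w) / (w - z) - f z / (w - z))); try exact: ccontB.
  move=> x y hx hy hxy; rewrite -mulrBl cabsM cabsV.
  have dst := side_dist hxy; have dst0 : 0 < cabs (x +i* y - z) by exact: lt_le_trans dst.
  rewrite ler_pdivrMr //; apply: (@le_trans _ _ (D / (8 * P) * eta)); last first.
    by apply: ler_wpM2l => //; rewrite divr_ge0 ?ltW // mulr_gt0.
  apply: Hr; rewrite /scale [z + _]addrC addrK cabsM cabsR ger0_norm ?(ltW s0) //.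
  have : cabs (x +i* y - z) <= P.
    move: (az) (zb) (cz) (zd) hx hy => ? ? ? ? /andP[? ?] /andP[? ?].
    apply: (le_trans (cabs_le_ReIm _)); rewrite cReD cReN cImD cImN /= /P.
    by apply: lerD; rewrite ler_norml; apply/andP; split; lra.
  move=> hP; apply: (@le_lt_trans _ _ (r / (2 * P) * P)).
    by apply: ler_pM; rewrite ?cabs_ge0 ?(ltW s0) // ge_min lexx orbT.
  rewrite (_ : _ * P = r / 2); first lra.
  by field; rewrite lt0r_neq0.
rewrite (_ : _ * P = D / 2); last by field; rewrite lt0r_neq0.
by move: D0; lra.
Qed.

Hypotheses (az_eta2 : Re z - 2 * eta <= a) (zb_eta2 : b <= Re z + 2 * eta)
  (cz_eta2 : Im z - 2 * eta <= c) (zd_eta2 : d <= Im z + 2 * eta).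

Let Im_inv (p q : R) : Im (1 / (p +i* q) : C) = - (q / (p ^+ 2 + q ^+ 2)).
Proof. by rewrite mul1r. Qed.
Let Re_inv (p q : R) : Re (1 / (p +i* q) : C) = p / (p ^+ 2 + q ^+ 2).
Proof. by rewrite mul1r. Qed.

(** A crude bound on the imaginary part is enough. All four sides contribute with the same sign, and
    on the right side the integrand is at least 1 / (8 * eta) over a length of at least 2 * eta. *)
Lemma rect_winding_ge : 4^-1 <= cabs (rect_sum a b c d (fun w => 1 / (w - z))).
Proof.
have [qc1 qc2 qc3 qc4] := quot_all (@holo_cst R 1).
apply: le_trans (Im_le _); apply: le_trans (ler_norm _).
move: (eta_gt0) (az_eta) (zb_eta) (cz_eta) (zd_eta) (az_eta2) (zb_eta2) (cz_eta2) (zd_eta2)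
  => e0 A1 B1 C1 D1 A2 B2 C2 D2.
have subE x y : (x +i* y : C) - z = (x - Re z) +i* (y - Im z).
  by apply: complex_ext; rewrite ?cReD ?cImD ?cReN ?cImN.
rewrite /rect_sum !cImD !cImN /cint /=.
have p1 : 4^-1 <= \int[mu]_(t in `[c, d]) Im (ii * (1 / (vseg b t - z))).
  have cb : ccont c d (fun t => ii * (1 / (vseg b t - z))).
    by apply: ccontM => //; exact: ccont_cst.
  apply: (@le_trans _ _ (\int[mu]_(t in `[c, d]) (8 * eta)^-1)).
    rewrite rint_cst; last exact: ltW.
    rewrite ler_pdivlMl; last by rewrite mulr_gt0.
    by lra.
  apply: le_Rintegral => //.
  - by apply: within_integrable; apply: continuous_subspaceT => ?; exact: cvg_cst.
  - by case: (ccont_integrable cb).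
  - move=> t; rewrite /= in_itv /= => /andP[t1 t2].
    rewrite cImM /= mul0r add0r mul1r subE Re_inv.
    have q0 : 0 < (b - Re z) ^+ 2 + (t - Im z) ^+ 2.
      by apply: ltr_pwDl; [apply: exprn_gt0; lra|exact: sqr_ge0].
    rewrite ler_pdivlMr // ler_pdivrMl; last by rewrite mulr_gt0.
    have k1 : (b - Re z) ^+ 2 <= 4 * eta ^+ 2.
      rewrite (_ : 4 * eta ^+ 2 = (2 * eta) ^+ 2); last by ring.
      by apply: lerXn2r; rewrite ?nnegrE; lra.
    have k2 : (t - Im z) ^+ 2 <= 4 * eta ^+ 2.
      rewrite (_ : 4 * eta ^+ 2 = (2 * eta) ^+ 2); last by ring.
      rewrite -(real_normK (num_real (t - Im z))); apply: lerXn2r; rewrite ?nnegrE //; first lra.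
      by rewrite ler_norml; apply/andP; split; lra.
    have k3 : eta ^+ 2 <= eta * (b - Re z) by rewrite expr2 ler_pM2l //; lra.
    lra.
have p2 : \int[mu]_(t in `[c, d]) Im (ii * (1 / (vseg a t - z))) <= 0.
  rewrite -oppr_ge0 -mulN1r -RintegralZl //; last first.
    by case: (ccont_integrable (ccontM (@ccont_cst R c d ii) qc2)).
  apply: Rintegral_ge0 => t; rewrite /= in_itv /= => ht.
  rewrite cImM /= mul0r add0r mul1r subE Re_inv mulN1r -mulNr.
  by apply: divr_ge0; [lra|rewrite addr_ge0 ?sqr_ge0].
have p3 : \int[mu]_(t in `[a, b]) Im (1 / (hseg d t - z)) <= 0.
  rewrite -oppr_ge0 -mulN1r -RintegralZl //; last by case: (ccont_integrable qc3).
  apply: Rintegral_ge0 => t; rewrite /= in_itv /= => ht.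
  rewrite subE Im_inv mulrN mulN1r opprK.
  by apply: divr_ge0; [lra|rewrite addr_ge0 ?sqr_ge0].
have p4 : 0 <= \int[mu]_(t in `[a, b]) Im (1 / (hseg c t - z)).
  apply: Rintegral_ge0 => t; rewrite /= in_itv /= => ht.
  by rewrite subE Im_inv -mulNr; apply: divr_ge0; [lra|rewrite addr_ge0 ?sqr_ge0].
have fin (w x y v : R) : 4^-1 <= w -> x <= 0 -> y <= 0 -> 0 <= v -> 4^-1 <= w - x - y + v.
  by move=> *; lra.
exact: fin p1 p2 p3 p4.
Qed.

(** Divide [rect_cauchy] by the winding integral, using that the boundary stays at distance at least
    eta from z. *)
Lemma rect_mean_le : cabs (f z) <= 8 / eta *
  (\int[mu]_(t in `[c, d]) cabs (f (vseg b t)) + \int[mu]_(t in `[c, d]) cabs (f (vseg a t))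
  + \int[mu]_(t in `[a, b]) cabs (f (hseg d t)) + \int[mu]_(t in `[a, b]) cabs (f (hseg c t))).
Proof.
have [qc1 qc2 qc3 qc4] := quot_all Hf.
have intf u v (seg : R -> C) (F : C -> C) : u <= v -> ccont u v (fun t => f (seg t)) ->
  ccont u v (fun t => F (seg t)) ->
  (forall t, u <= t <= v -> cabs (F (seg t)) <= eta^-1 * cabs (f (seg t))) ->
  cabs (cint u v (fun t => F (seg t))) <= 2 / eta * \int[mu]_(t in `[u, v]) cabs (f (seg t)).
  move=> uv cf cF HF.
  have ci : mu.-integrable `[u, v] (EFin \o (fun t => cabs (f (seg t)))).
    apply: within_integrable; apply/subspace_continuousP => x /=; rewrite in_itv /= => xab.
    apply/cvgrPdist_le => e e0; have [r r0 Hr] := cf x xab e e0.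
    exists r => //= y; rewrite /ball_ /= distrC => yd; rewrite in_itv /= => yab.
    have /= h := Hr y yab yd; rewrite /from_subspace ler_norml; apply/andP; split.
      by have := cabs_subl (f (seg y)) (f (seg x)); lra.
    have := cabs_subl (f (seg x)) (f (seg y)); rewrite cabs_distC; lra.
  have ci' : mu.-integrable `[u, v] (EFin \o (fun t => eta^-1 * cabs (f (seg t)))).
    have mD : measurable (`[u, v]%classic : set (measurableTypeR R)) by [].
    exact: (integrableZl mD eta^-1 ci).
  have [i1 i2] := ccont_integrable cF.
  have half (g : R -> R) : mu.-integrable `[u, v] (EFin \o g) ->
     (forall t, u <= t <= v -> `|g t| <= eta^-1 * cabs (f (seg t))) ->
     `|\int[mu]_(t in `[u, v]) g t| <= eta^-1 * \int[mu]_(t in `[u, v]) cabs (f (seg t)).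
    move=> ig Hg; apply: (le_trans (le_normr_Rintegral _ ig)) => //.
    rewrite -RintegralZl //; apply: le_Rintegral => //.
    exact: (integrable_norm ig).
  apply: (le_trans (cabs_le_ReIm _)); rewrite /cint /= -mulrA mulr2n mulrDl mul1r.
  by apply: lerD; apply: half => // t ht; apply: le_trans (HF _ ht); [exact: Re_le|exact: Im_le].
have quot x y : (x = a \/ x = b) \/ (y = c \/ y = d) ->
    cabs (f (x +i* y) / (x +i* y - z)) <= eta^-1 * cabs (f (x +i* y)).
  move=> h; have dst := side_dist h.
  rewrite cabsM cabsV mulrC; apply: ler_wpM2r; first exact: cabs_ge0.
  by rewrite lef_pV2 ?posrE //; exact: lt_le_trans dst.
have fv x : (x = a \/ x = b) -> ccont c d (fun t => f (vseg x t)).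
  move=> hx; apply: ccont_comp; last exact: vseg_ccont.
  by move=> t ht; apply: Hf; exact: hin_v.
have fh y : (y = c \/ y = d) -> ccont a b (fun t => f (hseg y t)).
  move=> hy; apply: ccont_comp; last exact: hseg_ccont.
  by move=> t ht; apply: Hf; exact: hin_h.
have ab' := ltW ab; have cd' := ltW cd.
have i1 u v g : ccont u v g -> cabs (cint u v (fun t => ii * g t)) = cabs (cint u v g).
  by move=> cg; rewrite cintZ // cabsM cabs_ii mul1r.
have b1 := intf _ _ (vseg b) (fun w => f w / (w - z)) cd' (fv _ (or_intror erefl)) qc1
  (fun t _ => quot _ _ (or_introl (or_intror erefl))).
have b2 := intf _ _ (vseg a) (fun w => f w / (w - z)) cd' (fv _ (or_introl erefl)) qc2
  (fun t _ => quot _ _ (or_introl (or_introl erefl))).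
have b3 := intf _ _ (hseg d) (fun w => f w / (w - z)) ab' (fh _ (or_intror erefl)) qc3
  (fun t _ => quot _ _ (or_intror (or_intror erefl))).
have b4 := intf _ _ (hseg c) (fun w => f w / (w - z)) ab' (fh _ (or_introl erefl)) qc4
  (fun t _ => quot _ _ (or_intror (or_introl erefl))).
have tri (z1 z2 z3 z4 : C) :
  cabs (z1 - z2 - z3 + z4) <= cabs z1 + cabs z2 + cabs z3 + cabs z4.
  by do 3![apply: (le_trans (cabsD _ _)); rewrite ?cabsN; apply: lerD => //].
have T : cabs (f z) * 4^-1 <= cabs (rect_sum a b c d (fun w => f w / (w - z))).
  by rewrite rect_cauchy cabsM; apply: ler_wpM2l; [exact: cabs_ge0|exact: rect_winding_ge].
have := le_trans T (tri _ _ _ _); rewrite !i1 // => {}T.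
have := le_trans T (lerD (lerD (lerD b1 b2) b3) b4).
rewrite -!mulrDr ler_pdivrMr //; set S := (_ + _ : R).
by rewrite (_ : 2 / eta * S * 4 = 8 / eta * S) //; ring.
Qed.

End Rectangle.

(** * Comparison of integrals without measurability *)

Section LowerIntegral.
Context d (T : measurableType d) (R : realType) (mu : {measure set T -> \bar R}).
Local Open Scope ereal_scope.
Import HBNNSimple.

(* No measurability is assumed: the library integral of a nonnegative function is a supremum over
   simple functions below it. *)
Lemma integral_mono (D E : set T) (f g : T -> \bar R) : D `<=` E ->
  (forall x, E x -> 0 <= g x) -> (forall x, D x -> 0 <= f x) ->
  (forall x, D x -> f x <= g x) -> \int[mu]_(x in D) f x <= \int[mu]_(x in E) g x.
Proof.
move=> DE g0 f0 fg; rewrite !ge0_integralE //; apply: le_ereal_sup => _ [h /= hf <-].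
exists h => //= x; apply: (le_trans (hf x)); rewrite /patch.
case: ifPn => [/set_mem Dx|_]; first by rewrite mem_set ?fg //; exact: DE.
by case: ifPn => // /set_mem /g0.
Qed.

(** Adding k on A to a simple function below f on B gives a simple function below f on E. This
    superadditivity replaces additivity for the restriction of a weight to a radius, which comes
    with no measurability. *)
Lemma integral_split_ge (E A B : set T) (f : T -> \bar R) (k : R) :
  A `<=` E -> B `<=` E -> (forall x, A x -> ~ B x) -> measurable A -> mu A < +oo ->
  (0 <= k)%R -> (forall x, E x -> 0 <= f x) -> (forall x, A x -> k%:E <= f x) ->
  k%:E * mu A + \int[mu]_(x in B) f x <= \int[mu]_(x in E) f x.
Proof.
move=> AE BE AB mA Aoo k0 f0 fA.
have kA : sintegral mu (scale_nnsfun (indic_nnsfun R mA) k0) = k%:E * mu A.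
  transitivity (sintegral mu (cst k \* indic_nnsfun R mA)%R) => //.
  by rewrite sintegralrM sintegral_indic.
have kfin : k%:E * mu A \is a fin_num by rewrite fin_numM // ge0_fin_numE.
rewrite addeC -leeBrDr //; rewrite (ge0_integralE mu (D := B)); last by move=> x /BE /f0.
apply: ge_ereal_sup => _ [h /= hf <-].
rewrite leeBrDr // -kA -sintegralD.
rewrite ge0_integralE //; apply: ereal_sup_ubound.
exists (add_nnsfun h (scale_nnsfun (indic_nnsfun R mA) k0)) => // x.
have := hf x; rewrite /= /patch mindicE.
have [Ax|Ax] := boolP (x \in A).
  rewrite (_ : (x \in B) = false); last by apply/negP => /set_mem; apply: AB; exact: set_mem.
  rewrite mem_set; last by apply: AE; exact: set_mem.
  move=> h0; rewrite mulr1 EFinD; apply: (@le_trans _ _ (0 + k%:E)); first exact: leeD2r.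
  by rewrite add0e fA //; exact: set_mem.
rewrite mulr0 addr0; case: ifPn => [/set_mem Bx|_]; first by rewrite mem_set //; exact: BE.
by move=> /le_trans; apply; case: ifPn => // /set_mem /f0.
Qed.

End LowerIntegral.

(** * Measurability in the disc and area mean value inequalities *)

Section Planar.
Context {R : realType}.
Local Notation C := (Cplx R).
Local Notation mu := (@lebesgue_measure R).
Local Notation mu2 := (@lebesgue_measure R \x @lebesgue_measure R)%E.

Definition box (u : R * R) (d : R) : set (R * R) :=
  [set v | `|v.1 - u.1| < d /\ `|v.2 - u.2| < d].

Lemma box_measurable u d : measurable (box u d : set (measurableTypeR R * measurableTypeR R)).
Proof.
rewrite (_ : box u d = `]u.1 - d, u.1 + d[%classic `*` `]u.2 - d, u.2 + d[%classic).
  by apply: measurableX.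
apply/seteqP; split => v; rewrite /box /= !in_itv /=.
  by move=> [h1 h2]; rewrite -!ltr_distl.
by rewrite -!ltr_distl => -[].
Qed.

(** Such a set is the countable union of the rational boxes that it contains. *)
Lemma box_open_measurable (U : set (R * R)) :
  (forall u, U u -> exists2 d : R, 0 < d & box u d `<=` U) ->
  measurable (U : set (measurableTypeR R * measurableTypeR R)).
Proof.
move=> HU.
pose F (q1 q2 : rat) (n : nat) : set (measurableTypeR R * measurableTypeR R) :=
  if `[< box (ratr q1, ratr q2) n.+1%:R^-1 `<=` U >] then box (ratr q1, ratr q2) n.+1%:R^-1
  else set0.
rewrite (_ : U = \bigcup_q1 \bigcup_q2 \bigcup_n F q1 q2 n).
  apply: bigcupT_measurable_rat => q1; apply: bigcupT_measurable_rat => q2.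
  apply: bigcupT_measurable => n; rewrite /F; case: ifP => _; last exact: measurable0.
  exact: box_measurable.
apply/seteqP; split => [u Uu|u [q1 _ [q2 _ [n _]]]]; last first.
  by rewrite /F; case: ifPn => // /asboolP; apply.
have [d d0 Hd] := HU u Uu.
have [n Hn] : exists n : nat, (n.+1%:R^-1 : R) < d / 2.
  exists (Num.bound (2 / d)); rewrite -[ltRHS]invrK ltf_pV2 ?posrE ?invr_gt0 ?divr_gt0 //.
  rewrite invf_div; apply: (lt_trans (archi_boundP _)); first by rewrite divr_ge0 // ltW.
  by rewrite ltr_nat.
have n0 : 0 < n.+1%:R^-1 :> R by rewrite invr_gt0.
have rat_near (a x : R) : 0 < a -> exists q : rat, `|x - ratr q| < a.
  move=> a0; have lt : x - a < x + a by lra.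
  have [q] := rat_in_itvoo lt.
  by rewrite in_itv /= => /andP[k1 k2]; exists q; rewrite ltr_norml; apply/andP; split; lra.
have [q1 h1] := rat_near _ u.1 n0; have [q2 h2] := rat_near _ u.2 n0.
exists q1 => //; exists q2 => //; exists n => //; rewrite /F asboolT //.
move=> v; rewrite /box /=; move: h1 h2 Hn; generalize (n.+1%:R^-1 : R) => a h1 h2 Hn [v1 v2].
apply: Hd; split => /=.
  rewrite (_ : v.1 - u.1 = (v.1 - ratr q1) + - (u.1 - ratr q1)); last by ring.
  by apply: (le_lt_trans (ler_normD _ _)); rewrite normrN; lra.
rewrite (_ : v.2 - u.2 = (v.2 - ratr q2) + - (u.2 - ratr q2)); last by ring.
by apply: (le_lt_trans (ler_normD _ _)); rewrite normrN; lra.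
Qed.

Lemma box_continuous_measurable (D : set (R * R)) (g : R * R -> R) :
  (forall u, D u -> exists2 d : R, 0 < d & box u d `<=` D) ->
  (forall u, D u -> forall e : R, 0 < e -> exists2 d : R, 0 < d &
     forall v, box u d v -> `|g v - g u| < e) ->
  measurable_fun (D : set (measurableTypeR R * measurableTypeR R)) g.
Proof.
move=> HD Hg mD; apply: (measurability _ (RGenOInfty.measurableE R)) => //.
move=> _ [_ [a ->] <-]; apply: box_open_measurable => u [Du].
rewrite /= in_itv /= andbT => au.
have [d d0 Hd] := HD u Du.
have [r r0 Hr] := Hg u Du (g u - a) ltac:(by rewrite subr_gt0).
exists (Num.min d r); first by rewrite lt_min d0.
move=> v [v1 v2]; move: v1 v2; rewrite !lt_min => /andP[v1 v1'] /andP[v2 v2']; split.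
  exact: Hd.
have /Hr : box u r v by split.
by rewrite /= in_itv /= andbT ltr_norml => /andP[]; lra.
Qed.

Lemma box_cabs (u v : R * R) d : box u d v -> cabs ((v.1 +i* v.2) - (u.1 +i* u.2) : C) < 2 * d.
Proof.
move=> [h1 h2]; apply: (le_lt_trans (cabs_le_ReIm _)).
by rewrite cReD cReN cImD cImN /=; lra.
Qed.

Lemma planar_discE u : @planar_disc R u <-> cabs (u.1 +i* u.2 : C) < 1.
Proof. by rewrite /planar_disc /=; exact: unit_discE. Qed.

Lemma planar_disc_box u : @planar_disc R u -> exists2 d : R, 0 < d & box u d `<=` @planar_disc R.
Proof.
move=> /planar_discE h; exists ((1 - cabs (u.1 +i* u.2 : C)) / 2).
  by rewrite divr_gt0 // subr_gt0.
move=> v /box_cabs hv; apply/planar_discE.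
rewrite -(subrK (u.1 +i* u.2 : C) (v.1 +i* v.2)).
by apply: (le_lt_trans (cabsD _ _)); lra.
Qed.

Lemma planar_disc_measurable :
  measurable (@planar_disc R : set (measurableTypeR R * measurableTypeR R)).
Proof. exact: box_open_measurable planar_disc_box. Qed.

Lemma disc_measurable_fun (g : C -> R) :
  (forall z, cabs z < 1 -> forall e : R, 0 < e -> exists2 d : R, 0 < d &
     forall w, cabs (w - z) < d -> `|g w - g z| < e) ->
  measurable_fun (@planar_disc R : set (measurableTypeR R * measurableTypeR R))
    (fun u => g (u.1 +i* u.2)).
Proof.
move=> Hg; apply: box_continuous_measurable; first exact: planar_disc_box.
move=> u /planar_discE hu e e0; have [d d0 Hd] := Hg _ hu e e0.
exists (d / 2); first by rewrite divr_gt0.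
by move=> v /box_cabs hv; apply: Hd; move: hv; rewrite mulrCA divff // mulr1.
Qed.

Lemma holo_cabs_measurable (f : C -> C) : holo f ->
  measurable_fun (@planar_disc R : set (measurableTypeR R * measurableTypeR R))
    (fun u => cabs (f (u.1 +i* u.2))).
Proof.
move=> Hf; apply: (@disc_measurable_fun (fun z => cabs (f z))) => z z1 e e0.
have e2 : 0 < e / 2 by rewrite divr_gt0.
have [d d0 Hd] := holo_cont Hf z1 e2; exists d => // w /Hd h.
apply: (@le_lt_trans _ _ (cabs (f w - f z))); last by lra.
rewrite ler_norml; apply/andP; split; last exact: cabs_subl.
by have := cabs_subl (f z) (f w); rewrite cabs_distC; lra.
Qed.

(** A nonnegative function cannot exceed its mean by a fixed amount everywhere on [u, v]. *)
Lemma exists_le_mean (phi : R -> \bar R) (u v I e : R) : u < v -> 0 < e ->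
  (forall x, (0 <= phi x)%E) -> (\int[mu]_x phi x <= I%:E)%E ->
  exists2 x, u <= x <= v & (phi x <= ((I + e) / (v - u))%:E)%E.
Proof.
move=> uv e0 phi0 hI; apply: contrapT => H.
have uv0 : 0 < v - u by rewrite subr_gt0.
have I0 : 0 <= I by rewrite -lee_fin; apply: le_trans hI; apply: integral_ge0.
have Hx x : u <= x <= v -> (((I + e) / (v - u))%:E <= phi x)%E.
  move=> hx; rewrite leNgt; apply/negP => h; apply: H; exists x => //; exact: ltW.
have : (\int[mu]_(x in `[u, v]) ((I + e) / (v - u))%:E <= \int[mu]_x phi x)%E.
  by apply: integral_mono => // x _; rewrite lee_fin divr_ge0 // ?ltW // ltr_wpDl.
rewrite integral_cst //= lebesgue_measure_itv /= lte_fin uv -EFinB -EFinM.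
move=> /le_trans /(_ hI); rewrite lee_fin divfK ?lt0r_neq0 //; lra.
Qed.


Definition square (z : C) (r : R) : set (R * R) :=
  `[Re z - r, Re z + r]%classic `*` `[Im z - r, Im z + r]%classic.

Lemma square_measurable z r :
  measurable (square z r : set (measurableTypeR R * measurableTypeR R)).
Proof. by apply: measurableX. Qed.

Lemma square_area z r : 0 < r -> mu2 (square z r) = ((2 * r) ^+ 2)%:E.
Proof.
move=> r0; rewrite /square.
pose X : set R := `[Re z - r, Re z + r]%classic; pose Y : set R := `[Im z - r, Im z + r]%classic.
have -> : mu2 (X `*` Y) = (mu X * mu Y)%E by apply: product_measure1E; exact: measurable_itv.
rewrite /X /Y.
have lt x : x - r < x + r by lra.
rewrite !lebesgue_measure_itv /= !lte_fin !lt.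
by rewrite -!EFinB -EFinM; congr EFin; ring.
Qed.

Lemma square_in_disc (z : C) r : 0 <= r -> cabs z + 2 * r < 1 ->
  square z r `<=` @planar_disc R.
Proof.
move=> r0 h [x y] /=; rewrite /square /= !in_itv /= => -[/andP[h1 h2] /andP[h3 h4]].
apply/planar_discE; rewrite -(subrK z (x +i* y : C)).
apply: (le_lt_trans (cabsD _ _)).
have : cabs ((x +i* y : C) - z) <= 2 * r.
  apply: (le_trans (cabs_le_ReIm _)); rewrite cReD cReN cImD cImN /= mulr2n mulrDl mul1r.
  by apply: lerD; rewrite ler_norml; apply/andP; split; lra.
by lra.
Qed.

(** By Fubini each of the four strips of width eta around z contains a line on which the integral of
    |f| is at most (i + e) / eta. These lines bound a rectangle to which [rect_mean_le] applies. *)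
Lemma area_mean (f : C -> C) (z : C) (eta : R) : holo f -> 0 < eta ->
  cabs z + 2 * (2 * eta) < 1 ->
  ((cabs (f z))%:E <= (32 / eta ^+ 2)%:E *
    \int[mu2]_(u in square z (2 * eta)) (cabs (f (u.1 +i* u.2)))%:E)%E.
Proof.
move=> Hf e0 hz; set Q := square z _.
have r0 : 0 <= 2 * eta by rewrite mulr_ge0 // ltW.
have QD : Q `<=` @planar_disc R by exact: square_in_disc.
have mQ := @square_measurable z (2 * eta).
pose F : R * R -> R := fun u => cabs (f (u.1 +i* u.2)).
have mF : measurable_fun (Q : set (measurableTypeR R * measurableTypeR R)) F.
  exact: measurable_funS planar_disc_measurable QD (holo_cabs_measurable Hf).
pose G : R * R -> \bar R := (EFin \o F) \_ Q.
have mG : measurable_fun (setT : set (measurableTypeR R * measurableTypeR R)) G.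
  by apply/(measurable_restrictT _ mQ); exact/measurable_EFinP.
have G0 u : (0 <= G u)%E by rewrite /G /patch; case: ifP => // _; rewrite lee_fin cabs_ge0.
set I := (\int[mu2]_(u in Q) _)%E.
have IE1 : I = (\int[mu]_x \int[mu]_y G (x, y))%E.
  by rewrite /I integral_mkcond; exact: (@fubini_tonelli1 _ _ (measurableTypeR R) (measurableTypeR R) R mu mu G mG G0).
have IE2 : I = (\int[mu]_y \int[mu]_x G (x, y))%E.
  by rewrite /I integral_mkcond; exact: (@fubini_tonelli2 _ _ (measurableTypeR R) (measurableTypeR R) R mu mu G mG G0).
have I0 : (0 <= I)%E by apply: integral_ge0 => u _; rewrite lee_fin cabs_ge0.
case: (I) I0 IE1 IE2 => [i|_ _ _|//]; last first.
  by rewrite gt0_muley ?leey // lte_fin divr_gt0 // exprn_gt0.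
rewrite lee_fin => i0 IE1 IE2; rewrite -EFinM lee_fin.
apply/ler_addgt0Pr => e' e'0.
(* Makes the final error 32 * e / eta ^+ 2 equal to e'. *)
pose e := e' * eta ^+ 2 / 32.
have e_gt0 : 0 < e by rewrite divr_gt0 // mulr_gt0 // exprn_gt0.
have phi1 x : (0 <= \int[mu]_y G (x, y))%E by exact: integral_ge0.
have phi2 y : (0 <= \int[mu]_x G (x, y))%E by exact: integral_ge0.
have l1 (x : R) : x + eta < x + 2 * eta by lra.
have l2 (x : R) : x - 2 * eta < x - eta by lra.
have d1 (x : R) : x + 2 * eta - (x + eta) = eta by ring.
have d2 (x : R) : x - eta - (x - 2 * eta) = eta by ring.
have hi1 : (\int[mu]_x \int[mu]_y G (x, y) <= i%:E)%E by rewrite IE1.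
have hi2 : (\int[mu]_y \int[mu]_x G (x, y) <= i%:E)%E by rewrite IE2.
have [b /andP[b1 b2]] := exists_le_mean (l1 (Re z)) e_gt0 phi1 hi1; rewrite d1 => Hb.
have [a /andP[a1 a2]] := exists_le_mean (l2 (Re z)) e_gt0 phi1 hi1; rewrite d2 => Ha.
have [d /andP[d1' d2']] := exists_le_mean (l1 (Im z)) e_gt0 phi2 hi2; rewrite d1 => Hd.
have [c /andP[c1 c2]] := exists_le_mean (l2 (Im z)) e_gt0 phi2 hi2; rewrite d2 => Hc.
have memQ x y : Re z - 2 * eta <= x <= Re z + 2 * eta ->
    Im z - 2 * eta <= y <= Im z + 2 * eta -> Q (x, y).
  by move=> hx hy; rewrite /Q /square; split => /=; rewrite in_itv.
have vle x : Re z - 2 * eta <= x <= Re z + 2 * eta ->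
    (\int[mu]_y G (x, y) <= ((i + e) / eta)%:E)%E ->
    \int[mu]_(t in `[c, d]) cabs (f (vseg x t)) <= (i + e) / eta.
  move=> hx hG; rewrite /Rintegral.
  have le : (\int[mu]_(t in `[c, d]) (cabs (f (vseg x t)))%:E <= ((i + e) / eta)%:E)%E.
    apply: le_trans hG; apply: integral_mono => // t; first by rewrite lee_fin cabs_ge0.
    rewrite /= in_itv /= => /andP[t1 t2]; rewrite /G /patch mem_set //.
    by apply: memQ => //; apply/andP; split; lra.
  rewrite -lee_fin fineK // ge0_fin_numE; first exact: le_lt_trans le (ltry _).
  by apply: integral_ge0 => t _; rewrite lee_fin cabs_ge0.
have hle y : Im z - 2 * eta <= y <= Im z + 2 * eta ->
    (\int[mu]_x G (x, y) <= ((i + e) / eta)%:E)%E ->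
    \int[mu]_(t in `[a, b]) cabs (f (hseg y t)) <= (i + e) / eta.
  move=> hy hG; rewrite /Rintegral.
  have le : (\int[mu]_(t in `[a, b]) (cabs (f (hseg y t)))%:E <= ((i + e) / eta)%:E)%E.
    apply: le_trans hG; apply: integral_mono => // t; first by rewrite lee_fin cabs_ge0.
    rewrite /= in_itv /= => /andP[t1 t2]; rewrite /G /patch mem_set //.
    by apply: memQ => //; apply/andP; split; lra.
  rewrite -lee_fin fineK // ge0_fin_numE; first exact: le_lt_trans le (ltry _).
  by apply: integral_ge0 => t _; rewrite lee_fin cabs_ge0.
have inD x y : a <= x <= b -> c <= y <= d -> cabs (x +i* y : C) < 1.
  move=> /andP[x1 x2] /andP[y1 y2]; have /QD/planar_discE : Q (x, y).
    by apply: memQ; apply/andP; split; lra.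
  exact.
have az : a < Re z by lra.
have zb : Re z < b by lra.
have cz : c < Im z by lra.
have zd : Im z < d by lra.
have a2' : a <= Re z + 2 * eta by lra.
have b1' : Re z - 2 * eta <= b by lra.
have c2' : c <= Im z + 2 * eta by lra.
have d1'' : Im z - 2 * eta <= d by lra.
have H := rect_mean_le az zb cz zd Hf inD e0 a2 b1 c2 d1' a1 b2 c1 d2'.
have hb := vle b _ Hb; have ha := vle a _ Ha; have hd := hle d _ Hd; have hc := hle c _ Hc.
 apply: (@le_trans _ _ (8 / eta * (4 * ((i + e) / eta)))).
  apply: (le_trans H).
  apply: ler_wpM2l; first by rewrite divr_ge0 // ltW.
  rewrite (_ : 4 * _ = (i + e) / eta + (i + e) / eta + (i + e) / eta + (i + e) / eta); last by ring.
  apply: lerD; [apply: lerD; [apply: lerD|]|].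
  - by apply: hb; apply/andP.
  - by apply: ha; apply/andP.
  - by apply: hd; apply/andP.
  - by apply: hc; apply/andP.
rewrite le_eqVlt; apply/orP; left; apply/eqP; rewrite /e; field; exact: lt0r_neq0.
Qed.

(** Follows from exponent 1 by x <= l + l^(1-p) x^p. With l a small multiple of |f z|, the constant
    term is half of |f z| and is absorbed on the left. *)
Lemma area_mean_pow (p : R) : 1 <= p -> exists2 K : R, 0 < K &
  forall (f : C -> C) (z : C) (eta : R), holo f -> 0 < eta -> cabs z + 2 * (2 * eta) < 1 ->
  ((cabs (f z) `^ p)%:E <= (K / eta ^+ 2)%:E *
    \int[mu2]_(u in square z (2 * eta)) (cabs (f (u.1 +i* u.2)) `^ p)%:E)%E.
Proof.
move=> p1.
(* Here l = |f z| / k; 32 is the constant of [area_mean] and 16 * eta ^+ 2 is the area of the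
   square. *)
have [k k0 kE] : exists2 k : R, 0 < k & 32 * 16 / k = 2^-1.
  exists (2 * (32 * 16)); first by rewrite !mulr_gt0 // ltr0n.
  by field.
have kp0 : 0 < k `^ (p - 1) by rewrite powR_gt0.
exists (2 * 32 * k `^ (p - 1)) => [|f z eta Hf e0 hz]; first by rewrite !mulr_gt0 // ltr0n.
set Q := square z _.
have r0 : 0 < 2 * eta by rewrite mulr_gt0.
have QD : Q `<=` @planar_disc R by apply: square_in_disc => //; exact: ltW.
have mQ := @square_measurable z (2 * eta).
set J := (\int[mu2]_(u in Q) _)%E.
have J0 : (0 <= J)%E by apply: integral_ge0 => u _; rewrite lee_fin powR_ge0.
have eta2 : 0 < eta ^+ 2 by rewrite exprn_gt0.
have K0 : 0 < 2 * 32 * k `^ (p - 1) / eta ^+ 2.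
  by rewrite divr_gt0 // !mulr_gt0 // ltr0n.
have p0 : p != 0 by rewrite lt0r_neq0 // (lt_le_trans ltr01).
have [fz0|fz0] := eqVneq (cabs (f z)) 0.
  by rewrite fz0 powR0 // mule_ge0 // lee_fin ltW.
have fzp : 0 < cabs (f z) by rewrite lt_def fz0 cabs_ge0.
set c := cabs (f z) in fz0 fzp *.
pose l := c / k; have l0 : 0 < l by rewrite divr_gt0.
have mF : measurable_fun (Q : set (measurableTypeR R * measurableTypeR R))
    (fun u : R * R => cabs (f (u.1 +i* u.2))).
  exact: measurable_funS planar_disc_measurable QD (holo_cabs_measurable Hf).
have mFp : measurable_fun (Q : set (measurableTypeR R * measurableTypeR R))
    (fun u : R * R => (cabs (f (u.1 +i* u.2)) `^ p)).
  exact: measurableT_comp (measurable_powR p) mF.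
have powS (x : R) : 0 < x -> x `^ p = x * x `^ (p - 1).
  move=> x0; rewrite -{2}(powRr1 (ltW x0)) -powRD; first by congr (_ `^ _); ring.
  by rewrite (gt_eqF x0) implybT.
have negE : 1 - p = - (p - 1) by ring.
have lp0 : 0 < l `^ (p - 1) by rewrite powR_gt0.
have pt (x : R) : 0 <= x -> x <= l + l `^ (1 - p) * x `^ p.
  move=> x0; have [xl|lx] := leP x l; first by rewrite (le_trans xl) // lerDl mulr_ge0 // powR_ge0.
  have x_gt0 : 0 < x by exact: lt_trans lx.
  rewrite powS // mulrCA negE powRN.
  have : 1 <= (l `^ (p - 1))^-1 * x `^ (p - 1).
    rewrite ler_pdivlMl // mulr1; apply: ge0_ler_powR; rewrite ?nnegrE ?subr_ge0 //; exact: ltW.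
  move=> h; apply: (@le_trans _ _ (x * ((l `^ (p - 1))^-1 * x `^ (p - 1)))).
    by rewrite ler_peMr.
  by rewrite lerDr ltW.
have H := area_mean Hf e0 hz; rewrite -/c -/Q in H.
have le : (\int[mu2]_(u in Q) (cabs (f (u.1 +i* u.2)))%:E <=
    (l * (2 * (2 * eta)) ^+ 2)%:E + (l `^ (1 - p))%:E * J)%E.
  apply: (@le_trans _ _ (\int[mu2]_(u in Q) (l%:E + (l `^ (1 - p))%:E * (cabs (f (u.1 +i* u.2)) `^ p)%:E))%E).
    apply: integral_mono => // u _.
    - by rewrite adde_ge0 ?mule_ge0 ?lee_fin ?powR_ge0 // ltW.
    - by rewrite lee_fin cabs_ge0.
    - by rewrite -EFinM -EFinD lee_fin; apply: pt; exact: cabs_ge0.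
  rewrite ge0_integralD //.
  - rewrite leeD //; last first.
      by rewrite ge0_integralZl // ?lee_fin ?powR_ge0 //; [exact/measurable_EFinP|move=> u _; rewrite lee_fin powR_ge0].
    rewrite integral_cst //.
    have <- : (l%:E * mu2 Q = (l * (2 * (2 * eta)) ^+ 2)%:E)%E by rewrite /Q square_area // -EFinM.
    exact: lexx.
  - by move=> u _; rewrite lee_fin ltW.
  - by move=> u _; rewrite mule_ge0 // lee_fin powR_ge0.
  - by apply: emeasurable_funM; [exact: measurable_cst|exact/measurable_EFinP].
case: (J) J0 le => [j|_ _|//]; last by rewrite gt0_muley ?leey // lte_fin.
rewrite lee_fin => j0 le.
have q0 : (0 <= (32 / eta ^+ 2)%:E)%E by rewrite lee_fin divr_ge0 // ltW.
have {le} : (c%:E <= (32 / eta ^+ 2 * (l * (2 * (2 * eta)) ^+ 2 + l `^ (1 - p) * j))%:E)%E.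
  exact: le_trans H (lee_wpmul2l q0 le).
rewrite -EFinM !lee_fin.
have -> : 32 / eta ^+ 2 * (l * (2 * (2 * eta)) ^+ 2 + l `^ (1 - p) * j) =
    c / 2 + 32 / eta ^+ 2 * (l `^ (1 - p) * j).
  by rewrite -kE mulrDr; congr (_ + _); rewrite /l; field; rewrite !lt0r_neq0.
rewrite {1}(splitr c) lerD2l negE powRN.
rewrite (_ : 32 / eta ^+ 2 * ((l `^ (p - 1))^-1 * j) = (32 / eta ^+ 2 * j) / l `^ (p - 1)); last by ring.
rewrite ler_pdivlMr //.
have cE : c `^ p = c * (l `^ (p - 1) * k `^ (p - 1)).
  by rewrite powS // -powRM ?(ltW l0) ?(ltW k0) // /l divfK // lt0r_neq0.
move=> hc; rewrite cE.
have : c / 2 * l `^ (p - 1) * (2 * k `^ (p - 1)) <= 32 / eta ^+ 2 * j * (2 * k `^ (p - 1)).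
  by apply: ler_wpM2r => //; rewrite mulr_ge0 // ltW.
rewrite (_ : c / 2 * _ * _ = c * (l `^ (p - 1) * k `^ (p - 1))); last by field.
by move=> /le_trans; apply; rewrite le_eqVlt; apply/orP; left; apply/eqP; ring.
Qed.

End Planar.

(** * Dyadic annuli and their areas *)

Section Annuli.
Context {R : realType}.
Local Notation C := (Cplx R).
Local Notation mu := (@lebesgue_measure R).
Local Notation mu2 := (@lebesgue_measure R \x @lebesgue_measure R)%E.
Local Notation M2 := (measurableTypeR R * measurableTypeR R)%type.

Let section_le (X : set R) (d : R) : 0 <= d ->
  (forall x x', X x -> X x' -> `|x - x'| <= d) ->
  (\int[mu]_x (\1_X x)%:E <= (2 * d)%:E)%E.
Proof.
move=> d0 HX; have [/eqP ->|/set0P[x0 Xx0]] := boolP (X == set0).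
  by rewrite indic0 integral0_eq // lee_fin mulr_ge0.
apply: (@le_trans _ _ (\int[mu]_(x in `[(x0 - d)%R, (x0 + d)%R]) 1%:E)%E).
  rewrite [leRHS]integral_mkcond; apply: integral_mono => // x _.
    by rewrite /patch; case: ifP.
  rewrite /patch indicE; have [xX|_] := boolP (x \in X); last by case: ifP.
  rewrite mem_set //= in_itv /=; have := HX _ _ (set_mem xX) Xx0.
  by rewrite ler_distl => /andP[h1 h2]; apply/andP; split; lra.
have mI : measurable (`[x0 - d, x0 + d]%classic : set (measurableTypeR R)) by exact: measurable_itv.
rewrite integral_cst //= mul1e lebesgue_measure_itv /= lte_fin.
case: ifP => _; last by rewrite lee_fin mulr_ge0.
by rewrite -EFinB lee_fin; lra.
Qed.

Let strip_le (phi : R -> \bar R) (x0 l d : R) : 0 <= l -> 0 <= d ->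
  (forall x, (0 <= phi x)%E) -> (forall x, (phi x <= (2 * d)%:E)%E) ->
  (forall x, l < `|x - x0| -> phi x = 0%E) ->
  (\int[mu]_x phi x <= (4 * l * d)%:E)%E.
Proof.
move=> l0 d0 phi0 phid phi_out.
apply: (@le_trans _ _ (\int[mu]_(x in `[(x0 - l)%R, (x0 + l)%R]) (2 * d)%:E)%E).
  rewrite [leRHS]integral_mkcond; apply: integral_mono => // x _.
    by rewrite /patch; case: ifP => // _; rewrite lee_fin mulr_ge0.
  rewrite /patch; case: ifPn => [_|/negP xN]; first exact: phid.
  rewrite phi_out // ltNge; apply/negP; rewrite ler_distl => /andP[h1 h2].
  by apply: xN; rewrite inE /= in_itv /=; apply/andP; split; lra.
have mI : measurable (`[x0 - l, x0 + l]%classic : set (measurableTypeR R)) by exact: measurable_itv.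
rewrite integral_cst //= lebesgue_measure_itv /= lte_fin.
case: ifP => _; last by rewrite mule0 lee_fin !mulr_ge0.
rewrite -EFinB -EFinM lee_fin; rewrite le_eqVlt; apply/orP; left; apply/eqP; ring.
Qed.

(** Fubini with thin sections. A section of diameter d is placed in an interval of length 2 * d,
    whence the constant 4. *)
Lemma slab1 (S : set (R * R)) (x0 l d : R) : 0 <= l -> 0 <= d ->
  measurable (S : set M2) -> (forall u, S u -> `|u.1 - x0| <= l) ->
  (forall x y y', S (x, y) -> S (x, y') -> `|y - y'| <= d) ->
  (mu2 S <= (4 * l * d)%:E)%E.
Proof.
move=> l0 d0 mS S1 S2.
pose G : R * R -> \bar R := EFin \o \1_S.
have mG : measurable_fun (setT : set M2) G by exact/measurable_EFinP.
have G0 u : (0 <= G u)%E by rewrite lee_fin.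
have <- : (\int[mu2]_u G u = mu2 S)%E by rewrite /G integral_indic ?setIT.
rewrite (@fubini_tonelli1 _ _ (measurableTypeR R) (measurableTypeR R) R mu mu G mG G0).
apply: (@strip_le _ x0) => // x.
- exact: integral_ge0.
- exact: (@section_le [set y | S (x, y)] d d0 (S2 x)).
- move=> hx; apply: integral0_eq => y _; rewrite /G /= indicE memNset // => /S1 /=.
  by rewrite leNgt hx.
Qed.

Lemma slab2 (S : set (R * R)) (y0 l d : R) : 0 <= l -> 0 <= d ->
  measurable (S : set M2) -> (forall u, S u -> `|u.2 - y0| <= l) ->
  (forall x x' y, S (x, y) -> S (x', y) -> `|x - x'| <= d) ->
  (mu2 S <= (4 * l * d)%:E)%E.
Proof.
move=> l0 d0 mS S1 S2.
pose G : R * R -> \bar R := EFin \o \1_S.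
have mG : measurable_fun (setT : set M2) G by exact/measurable_EFinP.
have G0 u : (0 <= G u)%E by rewrite lee_fin.
have <- : (\int[mu2]_u G u = mu2 S)%E by rewrite /G integral_indic ?setIT.
rewrite (@fubini_tonelli2 _ _ (measurableTypeR R) (measurableTypeR R) R mu mu G mG G0).
apply: (@strip_le _ y0) => // y.
- exact: integral_ge0.
- by apply: (@section_le [set x | S (x, y)] d d0) => x x'; exact: S2.
- move=> hy; apply: integral0_eq => x _; rewrite /G /= indicE memNset // => /S1 /=.
  by rewrite leNgt hy.
Qed.

(** Chosen so that r -> (1 + r) / 2, the map of the doubling condition, sends each radius to the
    next. *)
Definition rad (m : nat) : R := 1 - 2 ^- m.

Lemma pow2_gt0 m : 0 < 2 ^- m :> R.
Proof. by rewrite invr_gt0 exprn_gt0. Qed.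

Lemma pow2S m : 2 ^- m = 2 * 2 ^- m.+1 :> R.
Proof. by rewrite exprS invfM mulrA divff ?mul1r. Qed.

Lemma pow2_le m n : (m <= n)%N -> 2 ^- n <= 2 ^- m :> R.
Proof.
move=> mn; rewrite lef_pV2 ?posrE ?exprn_gt0 //.
by rewrite ler_eXn2l // ltr1n.
Qed.

Lemma rad_lt1 m : rad m < 1.
Proof. by rewrite /rad gtrBl pow2_gt0. Qed.

Lemma rad_ge0 m : 0 <= rad m.
Proof. by rewrite /rad subr_ge0 -[leRHS](expr0n R 0) // invf_le1 ?exprn_gt0 // exprn_ege1 // ler1n. Qed.

Lemma rad_le m n : (m <= n)%N -> rad m <= rad n.
Proof. by move=> mn; rewrite /rad lerD2l lerN2 pow2_le. Qed.

Lemma rad0 : rad 0 = 0.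
Proof. by rewrite /rad expr0 invr1 subrr. Qed.

Lemma rad1 : rad 1 = 2^-1.
Proof. by rewrite /rad expr1; field. Qed.

Lemma radS m : (1 + rad m) / 2 = rad m.+1.
Proof. by rewrite /rad (pow2S m); field. Qed.

Definition disc_at (r : R) : set (R * R) := [set u | cabs (u.1 +i* u.2 : C) < r].
Definition annulus (m : nat) : set (R * R) :=
  [set u | rad m <= cabs (u.1 +i* u.2 : C) < rad m.+1].

Lemma ball_measurable (c : C) (r : R) :
  measurable ([set u | cabs ((u.1 +i* u.2 : C) - c) < r] : set M2).
Proof.
apply: box_open_measurable => u /= hu.
exists ((r - cabs ((u.1 +i* u.2 : C) - c)) / 2); first by rewrite divr_gt0 // subr_gt0.
move=> v /box_cabs hv /=.
rewrite (_ : _ - c = (v.1 +i* v.2 - (u.1 +i* u.2)) + (u.1 +i* u.2 - c)); last by ring.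
by apply: (le_lt_trans (cabsD _ _)); lra.
Qed.

Lemma disc_at_measurable r : measurable (disc_at r : set M2).
Proof.
rewrite (_ : disc_at r = [set u | cabs ((u.1 +i* u.2 : C) - 0) < r]); first exact: ball_measurable.
by apply/seteqP; split => u /=; rewrite subr0.
Qed.

Lemma annulus_measurable m : measurable (annulus m : set M2).
Proof.
rewrite (_ : annulus m = disc_at (rad m.+1) `\` disc_at (rad m)).
  by apply: measurableD; exact: disc_at_measurable.
apply/seteqP; split => u /=; rewrite /annulus /disc_at /=.
  by move=> /andP[h1 h2]; split => //; apply/negP; rewrite -leNgt.
by move=> [h1 /negP]; rewrite -leNgt h1 => ->.
Qed.

Lemma annulus_disc m u : annulus m u -> @planar_disc R u.
Proof. by move=> /andP[_ h]; apply/planar_discE; exact: lt_trans h (rad_lt1 _). Qed.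

Lemma annulus_cover u : @planar_disc R u -> exists m, annulus m u.
Proof.
move=> /planar_discE h; set r := cabs _ in h.
have [n Hn] : exists n, r < rad n.
  exists (Num.bound (1 - r)^-1); rewrite /rad ltrBrDr addrC -ltrBrDr.
  rewrite -[ltRHS]invrK ltf_pV2 ?posrE ?exprn_gt0 ?invr_gt0 ?subr_gt0 //.
  apply: (lt_trans (archi_boundP _)); first by rewrite invr_ge0 subr_ge0 ltW.
  by rewrite -natrX ltr_nat ltn_expl.
elim: n Hn => [|n IH]; first by rewrite rad0 ltNge cabs_ge0.
have [rn _|rn hn] := ltP r (rad n); first exact: IH.
by exists n; rewrite /annulus /= rn.
Qed.

Lemma rad_sqr_diff m (s s' : R) : rad m <= s < rad m.+1 -> rad m <= s' < rad m.+1 ->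
  `|s ^+ 2 - s' ^+ 2| <= 2 ^- m.
Proof.
move=> /andP[s1 s2] /andP[s1' s2'].
have r0 := rad_ge0 m; have r1 := rad_lt1 m.+1.
have dr : rad m.+1 - rad m = 2 ^- m.+1 by rewrite /rad (pow2S m); ring.
have := pow2S m; set e := 2 ^- m.+1 in dr *; move=> ->.
rewrite (_ : s ^+ 2 - s' ^+ 2 = (s - s') * (s + s')); last by ring.
rewrite normrM mulrC; apply: ler_pM => //; rewrite ler_norml; apply/andP; split; lra.
Qed.

(** When one coordinate is fixed, the square of the other varies by at most 2^-m. If the latter
    keeps its sign and stays beyond 1/3, dividing by the sum of the two values, at least 2/3 in
    modulus, bounds their distance. *)
Lemma annulus_sec m (u u' : R * R) (sg : R) : annulus m u -> annulus m u' ->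
  (sg = 1 \/ sg = -1) ->
  (u.1 = u'.1 /\ 3^-1 <= sg * u.2 /\ 3^-1 <= sg * u'.2 -> `|u.2 - u'.2| <= 3 / 2 * 2 ^- m) /\
  (u.2 = u'.2 /\ 3^-1 <= sg * u.1 /\ 3^-1 <= sg * u'.1 -> `|u.1 - u'.1| <= 3 / 2 * 2 ^- m).
Proof.
move=> hu hu' hsg; have := rad_sqr_diff hu hu'; rewrite !cabs_sqr /=.
have e0 := pow2_gt0 m; set e := 2 ^- m in e0 *.
have core (s t : R) : 3^-1 <= sg * s -> 3^-1 <= sg * t -> `|s ^+ 2 - t ^+ 2| <= e ->
    `|s - t| <= 3 / 2 * e.
  move=> h1 h2; rewrite (_ : s ^+ 2 - t ^+ 2 = (s - t) * (s + t)); last by ring.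
  rewrite normrM => h3.
  have : 2 / 3 <= `|s + t|.
    apply: (@le_trans _ _ (sg * (s + t))); first by rewrite mulrDr; lra.
    apply: (le_trans (ler_norm _)); rewrite normrM.
    by case: hsg => ->; rewrite ?normrN normr1 mul1r.
  move=> h4; have : `|s - t| * (2 / 3) <= e.
    by apply: le_trans h3; apply: ler_wpM2l.
  by lra.
move=> hd; split=> -[E [h1 h2]]; apply: core => //.
  by move: hd; rewrite E (_ : _ - _ = u.2 ^+ 2 - u'.2 ^+ 2) //; ring.
by move: hd; rewrite E (_ : _ - _ = u.1 ^+ 2 - u'.1 ^+ 2) //; ring.
Qed.

Let half1 (sg : R) : set (R * R) := [set u | 3^-1 <= sg * u.1].
Let half2 (sg : R) : set (R * R) := [set u | 3^-1 <= sg * u.2].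

Let half1_measurable sg : measurable (half1 sg : set M2).
Proof.
rewrite (_ : half1 sg = (fun u : M2 => sg * u.1) @^-1` `[3^-1, +oo[); last first.
  by apply/seteqP; split => u /=; rewrite in_itv /= andbT.
rewrite -[X in measurable X]setTI; apply: (_ : measurable_fun setT _) => //.
by apply: measurable_funM => //; exact: measurable_fst.
Qed.

Let half2_measurable sg : measurable (half2 sg : set M2).
Proof.
rewrite (_ : half2 sg = (fun u : M2 => sg * u.2) @^-1` `[3^-1, +oo[); last first.
  by apply/seteqP; split => u /=; rewrite in_itv /= andbT.
rewrite -[X in measurable X]setTI; apply: (_ : measurable_fun setT _) => //.
by apply: measurable_funM => //; exact: measurable_snd.
Qed.

Lemma annulus_piece1 (m : nat) (sg y0 l : R) (S : set (R * R)) : 0 <= l ->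
  (sg = 1 \/ sg = -1) -> measurable (S : set M2) -> S `<=` annulus m ->
  (forall u, S u -> 3^-1 <= sg * u.1 /\ `|u.2 - y0| <= l) ->
  (mu2 S <= (6 * l * 2 ^- m)%:E)%E.
Proof.
move=> l0 hsg mS SA HS.
rewrite (_ : 6 * l * 2 ^- m = 4 * l * (3 / 2 * 2 ^- m)); last by field; rewrite expf_neq0.
apply: (@slab2 _ y0) => //.
  by move=> u /HS[].
move=> x x' y h h'; have [_ H] := annulus_sec (SA _ h) (SA _ h') hsg.
by apply: H; split => //=; have [] := HS _ h; have [] := HS _ h'.
Qed.

Lemma annulus_piece2 (m : nat) (sg x0 l : R) (S : set (R * R)) : 0 <= l ->
  (sg = 1 \/ sg = -1) -> measurable (S : set M2) -> S `<=` annulus m ->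
  (forall u, S u -> 3^-1 <= sg * u.2 /\ `|u.1 - x0| <= l) ->
  (mu2 S <= (6 * l * 2 ^- m)%:E)%E.
Proof.
move=> l0 hsg mS SA HS.
rewrite (_ : 6 * l * 2 ^- m = 4 * l * (3 / 2 * 2 ^- m)); last by field; rewrite expf_neq0.
apply: (@slab1 _ x0) => //.
  by move=> u /HS[].
move=> x y y' h h'; have [H _] := annulus_sec (SA _ h) (SA _ h') hsg.
by apply: H; split => //=; have [] := HS _ h; have [] := HS _ h'.
Qed.

(** For m >= 1 the modulus is at least 1/2, so one coordinate is at least 1/3 in modulus, and four
    pieces with thin sections cover the annulus. For m = 0 a bounding slab is enough. *)
Lemma annulus_area m : (mu2 (annulus m) <= (24 * 2 ^- m)%:E)%E.
Proof.
have coord u : annulus m u -> `|u.1 - 0| <= 1 /\ `|u.2 - 0| <= 1.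
  move=> /annulus_disc/planar_discE h; rewrite !subr0.
  split; apply: le_trans (ltW h); [exact: (Re_le (u.1 +i* u.2))|exact: (Im_le (u.1 +i* u.2))].
case: m coord => [|m] coord.
  apply: (@le_trans _ _ (4 * 1 * 2)%:E).
    apply: (@slab1 _ 0) => //; first exact: annulus_measurable.
      by move=> u /coord[].
    move=> x y y' /coord[_ h1] /coord[_ h2]; rewrite /= !subr0 in h1 h2.
    by apply: (le_trans (ler_normB _ _)); lra.
  by rewrite lee_fin expr0 invr1; lra.
pose S1 sg := annulus m.+1 `&` half1 sg; pose S2 sg := annulus m.+1 `&` half2 sg.
have mS1 sg : measurable (S1 sg : set M2).
  by apply: measurableI; [exact: annulus_measurable|exact: half1_measurable].
have mS2 sg : measurable (S2 sg : set M2).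
  by apply: measurableI; [exact: annulus_measurable|exact: half2_measurable].
have b1 sg : sg = 1 \/ sg = -1 -> (mu2 (S1 sg) <= (6 * 1 * 2 ^- m.+1)%:E)%E.
  move=> hsg; apply: (@annulus_piece1 m.+1 sg 0) => // u [hA hh] //.
  by split => //; have [] := coord _ hA.
have b2 sg : sg = 1 \/ sg = -1 -> (mu2 (S2 sg) <= (6 * 1 * 2 ^- m.+1)%:E)%E.
  move=> hsg; apply: (@annulus_piece2 m.+1 sg 0) => // u [hA hh] //.
  by split => //; have [] := coord _ hA.
have cov : annulus m.+1 `<=` (S1 1 `|` S1 (-1)) `|` (S2 1 `|` S2 (-1)).
  move=> u hA; have /andP[h1 _] := hA.
  have h2 : 2^-1 <= cabs (u.1 +i* u.2 : C) by apply: le_trans h1; rewrite -rad1 rad_le.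
  have h3 : 4^-1 <= u.1 ^+ 2 + u.2 ^+ 2.
    rewrite -[leRHS](cabs_sqr (u.1 +i* u.2 : C)) (_ : 4^-1 = 2^-1 ^+ 2); last by rewrite exprVn -natrX.
    by apply: lerXn2r; rewrite ?nnegrE ?cabs_ge0 ?invr_ge0.
  have sq (t : R) : `|t| < 3^-1 -> t ^+ 2 < 9^-1.
    move=> ht; rewrite -(real_normK (num_real t)) (_ : 9^-1 = 3^-1 ^+ 2); last by rewrite exprVn -natrX.
    by apply: ltrXn2r; rewrite ?nnegrE ?invr_ge0.
  have sgn (t : R) : 3^-1 <= `|t| -> 3^-1 <= 1 * t \/ 3^-1 <= -1 * t.
    by rewrite mul1r mulN1r ler_normr => /orP[]; [left|right].
  have [ht|/sq ht] := leP (3^-1) `|u.1|.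
    by left; case: (sgn _ ht) => ?; [left|right].
  have [hs|/sq hs] := leP (3^-1) `|u.2|; first by right; case: (sgn _ hs) => ?; [left|right].
  by exfalso; lra.
have e1 : 1 = 1 :> R \/ 1 = -1 :> R by left.
have e2 : -1 = 1 :> R \/ -1 = -1 :> R by right.
have mA := annulus_measurable m.+1.
apply: (@le_trans _ _ (mu2 ((S1 1 `|` S1 (-1)) `|` (S2 1 `|` S2 (-1))))).
  by apply: le_measure => //; rewrite inE //; do 3?apply: measurableU => //.
have mU1 : measurable (S1 1 `|` S1 (-1) : set M2) by exact: measurableU.
have mU2 : measurable (S2 1 `|` S2 (-1) : set M2) by exact: measurableU.
apply: (le_trans (measureU2 mu2 mU1 mU2)).
have := leeD (le_trans (measureU2 mu2 (mS1 1) (mS1 (-1))) (leeD (b1 _ e1) (b1 _ e2)))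
  (le_trans (measureU2 mu2 (mS2 1) (mS2 (-1))) (leeD (b2 _ e1) (b2 _ e2))).
move=> /le_trans; apply; rewrite -!EFinD lee_fin; lra.
Qed.

Definition near_cis (t r : R) : set (R * R) := [set u | cabs ((u.1 +i* u.2 : C) - cis t) < r].

Lemma near_cis_measurable t r : measurable (near_cis t r : set M2).
Proof. exact: ball_measurable. Qed.

(** Either |cos t| or |sin t| is at least 7/12, and 2^-j <= 1/4, so on the ball that coordinate
    keeps its sign and stays beyond 1/3, while the other moves by at most 2^-j from its value at the
    centre. *)
Lemma annulus_ball_area m j (t : R) : (1 < j)%N ->
  (mu2 (annulus m `&` near_cis t (2 ^- j)%R)
    <= (6 * 2 ^- j * 2 ^- m)%:E)%E.
Proof.
move=> j1; set S := _ `&` _.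
have mS : measurable (S : set M2) by apply: measurableI; [exact: annulus_measurable|exact: near_cis_measurable].
have j4 : 2 ^- j <= 4^-1 :> R.
  by rewrite (_ : 4^-1 = 2 ^- 2); [exact: pow2_le|rewrite -natrX].
have e0 := pow2_gt0 j; set e := 2 ^- j in e0 j4 *.
have SA : S `<=` annulus m by move=> u [].
have near u : S u -> `|u.1 - cos t| <= e /\ `|u.2 - sin t| <= e.
  move=> [_ /= h]; have h1 := Re_le ((u.1 +i* u.2 : C) - cis t).
  have h2 := Im_le ((u.1 +i* u.2 : C) - cis t).
  move: h1 h2; rewrite cReD cReN cImD cImN /= => h1 h2.
  by split; [apply: (le_trans h1)|apply: (le_trans h2)]; exact: ltW.
have big (a b : R) : a ^+ 2 + b ^+ 2 = 1 -> b ^+ 2 <= a ^+ 2 ->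
    7 / 12 <= 1 * a \/ 7 / 12 <= -1 * a.
  move=> h1 h2; rewrite mul1r mulN1r; have [a0|a0] := leP 0 a; [left|right]; nra.
have near_sg (sg a x : R) : sg = 1 \/ sg = -1 -> 7 / 12 <= sg * a -> `|x - a| <= e ->
    3^-1 <= sg * x.
  by move=> [->|->]; rewrite ler_distl => h /andP[h1 h2]; lra.
have cs := cos2Dsin2 t.
have [h|h] := leP (sin t ^+ 2) (cos t ^+ 2).
  have [sg hsg hc] : exists2 sg : R, sg = 1 \/ sg = -1 & 7 / 12 <= sg * cos t.
    by case: (big _ _ cs h) => ?; [exists 1|exists (-1)] => //; [left|right].
  apply: (@annulus_piece1 m sg (sin t) e) => // [|u Su]; first exact: ltW.
  by have [n1 n2] := near _ Su; split => //; apply: near_sg hsg hc n1.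
have cs' : sin t ^+ 2 + cos t ^+ 2 = 1 by rewrite addrC.
have [sg hsg hc] : exists2 sg : R, sg = 1 \/ sg = -1 & 7 / 12 <= sg * sin t.
  by case: (big _ _ cs' (ltW h)) => ?; [exists 1|exists (-1)] => //; [left|right].
apply: (@annulus_piece2 m sg (cos t) e) => // [|u Su]; first exact: ltW.
by have [n1 n2] := near _ Su; split => //; apply: near_sg hsg hc n2.
Qed.

End Annuli.

(** * Dyadic sequences, and weighted mass near a boundary point *)

Section TestFunctions.
Context {R : realType}.
Local Notation C := (Cplx R).
Local Notation mu := (@lebesgue_measure R).
Local Notation mu2 := (@lebesgue_measure R \x @lebesgue_measure R)%E.
Local Notation M2 := (measurableTypeR R * measurableTypeR R)%type.

Lemma nneseries_le (a : nat -> \bar R) (B : \bar R) : (forall m, (0 <= a m)%E) ->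
  (forall n, (\sum_(0 <= m < n) a m <= B)%E) -> (\sum_(0 <= m <oo) a m <= B)%E.
Proof. by move=> a0 H; apply: lime_le; [exact: is_cvg_nneseries|exact: nearW]. Qed.

Variables (p K lam c : R) (Wd : nat -> R) (w : C -> R).
Hypotheses (p1 : 1 < p) (K1 : 1 <= K) (lam1 : 1 < lam) (c0 : 0 < c).
Hypothesis Wd_gt0 : forall m, 0 < Wd m.
Hypothesis Wd_K : forall m, Wd m <= K * Wd m.+1.
Hypothesis Wd_lam : forall m, lam * Wd m.+1 <= Wd m.

Definition bseq (m : nat) : R := Wd m `^ (- (p - 1)^-1).
Definition Sseq (n : nat) : R := \sum_(0 <= k < n) bseq k * 2 ^- k.

Let p10 : 0 < p - 1. Proof. by rewrite subr_gt0. Qed.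
Let q0 : 0 < (p - 1)^-1. Proof. by rewrite invr_gt0. Qed.
Let p0 : 0 < p. Proof. exact: lt_trans p1. Qed.

Lemma bseq_gt0 m : 0 < bseq m.
Proof. by rewrite powR_gt0. Qed.

(** The identity behind the exponent 1/(p-1): it turns the norm of the test functions into
    [Sseq]. *)
Lemma bseq_powE m : bseq m `^ p * Wd m = bseq m.
Proof.
rewrite /bseq -powRrM -{2}(powRr1 (ltW (Wd_gt0 m))) -powRD.
  by congr (_ `^ _); field; rewrite gt_eqF.
by rewrite (gt_eqF (Wd_gt0 m)) implybT.
Qed.

Let beta := K `^ (p - 1)^-1.
Let Lam := lam `^ (p - 1)^-1.

Let beta_ge1 : 1 <= beta.
Proof. by rewrite -(@powRr0 _ K) ler_powR // ltW. Qed.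

Let Lam_gt1 : 1 < Lam.
Proof.
have -> : 1 = 1 `^ (p - 1)^-1 :> R by rewrite powR1.
by apply: gt0_ltr_powR; rewrite ?nnegrE // ltW // (lt_trans ltr01).
Qed.

Lemma bseq_beta m : bseq m.+1 <= beta * bseq m.
Proof.
rewrite /bseq /beta !powRN -[leLHS]mul1r ler_pdivrMr ?powR_gt0 // mulrAC ler_pdivlMr ?powR_gt0 //.
rewrite mul1r -powRM ?(ltW (Wd_gt0 _)) //; last exact: le_trans ler01 K1.
apply: ge0_ler_powR => //; rewrite ?nnegrE ?mulr_ge0 ?ltW //.
exact: lt_le_trans ltr01 K1.
Qed.

Lemma bseq_Lam m : Lam * bseq m <= bseq m.+1.
Proof.
rewrite /bseq /Lam !powRN ler_pdivrMr ?powR_gt0 // mulrC ler_pdivlMr ?powR_gt0 //.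
have l0 : 0 < lam by exact: lt_trans lam1.
rewrite -powRM ?(ltW (Wd_gt0 _)) ?(ltW l0) //.
by apply: ge0_ler_powR => //; rewrite ?nnegrE ?mulr_ge0 ?ltW.
Qed.

(** Telescoping, since Wd m is at most lam / (lam - 1) * (Wd m - Wd m.+1). *)
Lemma Wd_sum j n : (j <= n)%N -> \sum_(j <= m < n) Wd m <= lam / (lam - 1) * Wd j.
Proof.
move=> jn; have l0 : 0 < lam - 1 by rewrite subr_gt0.
apply: (@le_trans _ _ (lam / (lam - 1) * (Wd j - Wd n))); last first.
  by apply: ler_wpM2l; [rewrite divr_ge0 ?ltW // (lt_trans ltr01)|rewrite lerBlDr lerDl ltW].
rewrite mulrAC ler_pdivlMr //.
elim: n jn => [|n IH]; first by rewrite leqn0 => /eqP ->; rewrite big_geq // subrr mulr0 mul0r.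
rewrite leq_eqVlt => /predU1P[->|]; first by rewrite big_geq // subrr mulr0 mul0r.
rewrite ltnS => jn; rewrite big_nat_recr //= mulrDl.
by have := IH jn; have := Wd_lam n; lra.
Qed.

Lemma bseq_sum j : \sum_(0 <= k < j) bseq k <= (Lam - 1)^-1 * bseq j.
Proof.
have l0 : 0 < Lam - 1 by rewrite subr_gt0.
rewrite mulrC ler_pdivlMr //.
elim: j => [|j IH]; first by rewrite big_geq // mul0r ltW // bseq_gt0.
by rewrite big_nat_recr //= mulrDl; have := bseq_Lam j; lra.
Qed.

Lemma Sseq_ge0 n : 0 <= Sseq n.
Proof. by apply: sumr_ge0 => k _; rewrite mulr_ge0 ?ltW ?bseq_gt0 ?pow2_gt0. Qed.

Lemma SseqS n : Sseq n.+2 <= (1 + beta) * Sseq n.+1.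
Proof.
have b0 : 0 <= beta by exact: le_trans ler01 beta_ge1.
rewrite /Sseq big_nat_recr //= mulrDl mul1r lerD2l big_nat_recr //= mulrDr.
apply: (@le_trans _ _ (beta * (bseq n * 2 ^- n))).
  rewrite mulrA; apply: ler_pM; [exact/ltW/bseq_gt0|exact/ltW/pow2_gt0|exact: bseq_beta|].
  exact: pow2_le.
by rewrite lerDr mulr_ge0 // sumr_ge0 // => k _; rewrite mulr_ge0 ?ltW ?bseq_gt0 ?pow2_gt0.
Qed.

(* [geo E] dominates the weight on [E] by a function that is constant on each dyadic annulus. *)
Definition geo (E : set (R * R)) (u : R * R) : \bar R :=
  (\sum_(0 <= m <oo) (c * Wd m * 2 ^+ m * \1_(@annulus R m `&` E) u)%:E)%E.

Let coef_ge0 m : 0 <= c * Wd m * 2 ^+ m.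
Proof. by rewrite !mulr_ge0 ?exprn_ge0 ?ltW. Qed.

Let term_ge0 E m u : (0 <= (c * Wd m * 2 ^+ m * \1_(@annulus R m `&` E) u)%:E)%E.
Proof. by rewrite lee_fin mulr_ge0. Qed.

Lemma geo_ge0 E u : (0 <= geo E u)%E.
Proof. by apply: nneseries_ge0 => m _ _; exact: term_ge0. Qed.

Let term_measurable (E : set (R * R)) (mE : measurable (E : set M2)) m (D : set M2) :
  measurable_fun D (fun u : M2 => (c * Wd m * 2 ^+ m * \1_(@annulus R m `&` E) u)%:E).
Proof.
apply/measurable_EFinP; apply: measurable_funM => //.
by apply: measurable_indic; apply: measurableI => //; exact: annulus_measurable.
Qed.

Lemma geo_measurable (E : set (R * R)) (D : set M2) : measurable (E : set M2) ->
  measurable_fun D (geo E : M2 -> \bar R).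
Proof.
move=> mE; apply: ge0_emeasurable_sum => [m u _ _|m _]; first exact: term_ge0.
exact: term_measurable.
Qed.

Lemma geo_int (E : set (R * R)) : measurable (E : set M2) ->
  (\int[mu2]_(u in @planar_disc R) geo E u <=
   \sum_(0 <= m <oo) ((c * Wd m * 2 ^+ m)%:E * mu2 (@annulus R m `&` E)))%E.
Proof.
move=> mE; rewrite /geo integral_nneseries //; last 2 first.
- exact: planar_disc_measurable.
- by move=> m; exact: term_measurable.
apply: lee_nneseries => m *; first by apply: integral_ge0 => u _; exact: term_ge0.
have mAE : measurable (@annulus R m `&` E : set M2).
  by apply: measurableI => //; exact: annulus_measurable.
under eq_integral do rewrite EFinM.
rewrite ge0_integralZl //; last 3 first.
- exact: planar_disc_measurable.
- by apply/measurable_EFinP; exact: measurable_indic.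
- by rewrite lee_fin.
rewrite integral_indic //; last exact: planar_disc_measurable.
apply: lee_wpmul2l; first by rewrite lee_fin.
apply: le_measure; rewrite ?inE //.
by apply: measurableI => //; exact: planar_disc_measurable.
Qed.

Hypothesis w_le : forall m u, annulus m u ->
  0 <= w (u.1 +i* u.2) <= c * Wd m * 2 ^+ m.

Lemma geo_ge E u : @planar_disc R u -> E u -> ((w (u.1 +i* u.2))%:E <= geo E u)%E.
Proof.
move=> /annulus_cover[m hm] Eu; have /andP[_ h] := w_le hm.
apply: (@le_trans _ _ (c * Wd m * 2 ^+ m * \1_(@annulus R m `&` E) u)%:E).
  by rewrite lee_fin indicE mem_set //= mulr1.
apply: le_trans (nneseries_lim_ge m.+1 _); last by move=> k _ _; exact: term_ge0.
rewrite big_nat_recr //= leeDr // sume_ge0 // => k _; exact: term_ge0.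
Qed.

(** Scale 0 imposes no restriction, so that points far from e^(it) are covered too. *)
Definition dyad_nbhd (t : R) (j : nat) : set (R * R) :=
  if j is 0 then setT else near_cis t (2 ^- j).

Let C1 := 48 * c * K * (lam / (lam - 1)).

Let C1_gt0 : 0 < C1.
Proof.
rewrite !mulr_gt0 // ?invr_gt0 ?subr_gt0 //; first exact: lt_le_trans K1.
exact: lt_trans lam1.
Qed.

Lemma dyad_nbhd_measurable t j : measurable (dyad_nbhd t j : set M2).
Proof. by case: j => [|j]; [exact: measurableT|exact: near_cis_measurable]. Qed.

(** Only the annuli with m >= j meet the ball of radius 2^-j about e^(it). On each of them the
    height 2^m W_m times the area 2^-j 2^-m leaves W_m 2^-j, and the W_m sum geometrically. For j <=
    1 the mass of the whole disc is used, at the cost of K. *)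
Lemma geo_int_dyad t j : (\int[mu2]_(u in @planar_disc R) geo (dyad_nbhd t j) u <=
  (C1 * (Wd j * 2 ^- j))%:E)%E.
Proof.
apply: (le_trans (geo_int (dyad_nbhd_measurable t j))).
have l0 : 0 < lam - 1 by rewrite subr_gt0.
have lp : 0 < lam by exact: lt_trans lam1.
have K0 : 0 < K by exact: lt_le_trans K1.
have q1 : 0 <= lam / (lam - 1) by rewrite divr_ge0 // ltW.
have crude m : ((c * Wd m * 2 ^+ m)%:E * mu2 (@annulus R m `&` dyad_nbhd t j) <=
    (24 * c * Wd m)%:E)%E.
  apply: (@le_trans _ _ ((c * Wd m * 2 ^+ m)%:E * (24 * 2 ^- m)%:E)%E).
    apply: lee_wpmul2l; first by rewrite lee_fin.
    apply: le_trans (annulus_area m); apply: le_measure; rewrite ?inE //.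
    - by apply: measurableI; [exact: annulus_measurable|exact: dyad_nbhd_measurable].
    - exact: annulus_measurable.
  by rewrite -EFinM lee_fin le_eqVlt; apply/orP; left; apply/eqP; field; rewrite expf_neq0.
have nn m : (0 <= (c * Wd m * 2 ^+ m)%:E * mu2 (@annulus R m `&` dyad_nbhd t j))%E.
  by apply: mule_ge0; rewrite ?lee_fin.
apply: nneseries_le => // n.
have all_le : (\sum_(0 <= m < n) ((c * Wd m * 2 ^+ m)%:E * mu2 (@annulus R m `&` dyad_nbhd t j))
    <= (24 * c * (lam / (lam - 1) * Wd 0%N))%:E)%E.
  apply: (@le_trans _ _ (\sum_(0 <= m < n) (24 * c * Wd m)%:E)%E).
    by apply: lee_sum => m _; exact: crude.
  rewrite sumEFin lee_fin -mulr_sumr; apply: ler_wpM2l; first by rewrite mulr_ge0 // ltW.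
  exact: Wd_sum.
have c24 : 0 <= 24 * c * (lam / (lam - 1)) by apply: mulr_ge0 => //; rewrite mulr_ge0 // ltW.
case: (ltnP 1 j) => hj; last first.
  apply: (le_trans all_le); rewrite lee_fin /C1.
  rewrite (_ : 24 * c * _ = 24 * c * (lam / (lam - 1)) * Wd 0%N); last by ring.
  rewrite (_ : 48 * c * _ * _ * _ = 24 * c * (lam / (lam - 1)) * (K * (2 * 2 ^- j) * Wd j)); last by ring.
  apply: ler_wpM2l => //; case: j hj {crude nn all_le} => [|[|//]] _.
    rewrite expr0 invr1 mulr1 -[leLHS]mul1r; apply: ler_pM => //; first exact: ltW.
    by move: (K1); lra.
  by rewrite expr1 mulfV // mulr1; exact: Wd_K.
have fine m : ((c * Wd m * 2 ^+ m)%:E * mu2 (@annulus R m `&` dyad_nbhd t j) <=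
    (6 * c * 2 ^- j * Wd m)%:E)%E.
  apply: (@le_trans _ _ ((c * Wd m * 2 ^+ m)%:E * (6 * 2 ^- j * 2 ^- m)%:E)%E).
    apply: lee_wpmul2l; first by rewrite lee_fin.
    by case: j hj {crude nn all_le} => // j hj; exact: annulus_ball_area.
  by rewrite -EFinM lee_fin le_eqVlt; apply/orP; left; apply/eqP; field; rewrite !expf_neq0.
have low m : (m < j)%N -> ((c * Wd m * 2 ^+ m)%:E * mu2 (@annulus R m `&` dyad_nbhd t j) = 0)%E.
  move=> mj; rewrite (_ : _ `&` _ = set0) ?measure0 ?mule0 //.
  apply/seteqP; split => // u [/andP[_ h]]; case: j mj {hj crude nn all_le fine} => // j mj.
  rewrite /dyad_nbhd /near_cis /= => h2.
  have : rad j.+1 < cabs (u.1 +i* u.2 : C).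
    have := cabs_subl (cis t) (u.1 +i* u.2 : C); rewrite cabs_cis cabs_distC /rad; lra.
  move=> h3; have := lt_trans h3 h; rewrite ltNge => /negP; apply.
  exact: rad_le.
apply: (@le_trans _ _ (6 * c * 2 ^- j * (lam / (lam - 1) * Wd j))%:E); last first.
  rewrite lee_fin /C1.
  rewrite (_ : 6 * c * _ * _ = 6 * (c * (lam / (lam - 1)) * (Wd j * 2 ^- j))); last by ring.
  rewrite (_ : 48 * c * _ * _ * _ = 48 * K * (c * (lam / (lam - 1)) * (Wd j * 2 ^- j))); last by ring.
  apply: ler_wpM2r; last by move: (K1); lra.
  by rewrite !mulr_ge0 ?invr_ge0 ?exprn_ge0 // ltW.
have [nj|jn] := leqP n j.
  rewrite big_nat big1 => [|m /andP[_ mn]]; last by apply: low; exact: leq_trans nj.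
  by rewrite lee_fin !mulr_ge0 ?invr_ge0 ?exprn_ge0 // ltW.
rewrite (@big_cat_nat _ _ _ j) //=; last exact: ltnW.
rewrite big_nat big1 ?add0e => [|m /andP[_ mn]]; last exact: low.
apply: (@le_trans _ _ (\sum_(j <= m < n) (6 * c * 2 ^- j * Wd m)%:E)%E).
  by apply: lee_sum => m _; exact: fine.
rewrite sumEFin lee_fin -mulr_sumr; apply: ler_wpM2l; last by apply: Wd_sum; exact: ltnW.
by rewrite !mulr_ge0 ?invr_ge0 ?exprn_ge0 // ltW.
Qed.

End TestFunctions.

(** * Exchange of complex integrals over a rectangle *)

Section FubiniRectangle.
Context {R : realType}.
Local Notation C := (Cplx R).
Local Notation mu := (@lebesgue_measure R).
Local Notation mu2 := (@lebesgue_measure R \x @lebesgue_measure R)%E.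
Local Notation M2 := (measurableTypeR R * measurableTypeR R)%type.

Definition rect (a b c d : R) : set (R * R) := `[a, b]%classic `*` `[c, d]%classic.

Lemma rect_measurable a b c d : measurable (rect a b c d : set M2).
Proof. by apply: measurableX; exact: measurable_itv. Qed.

Lemma Rfubini (H : R * R -> R) (a b c d M : R) :
  measurable_fun (rect a b c d : set M2) H ->
  (forall u, rect a b c d u -> `|H u| <= M) ->
  mu.-integrable `[a, b] (EFin \o (fun t => \int[mu]_(s in `[c, d]) H (t, s))) /\
  \int[mu]_(t in `[a, b]) \int[mu]_(s in `[c, d]) H (t, s) =
  \int[mu]_(s in `[c, d]) \int[mu]_(t in `[a, b]) H (t, s).
Proof.
move=> mH HM; set Q := rect a b c d.
have mQ : measurable (Q : set M2) by exact: rect_measurable.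
have fin_itv (x y : R) : (mu `[x, y]%classic < +oo)%E.
  by rewrite /= lebesgue_measure_itv /=; case: ifP => _; rewrite -?EFinB ltry.
have Qfin : (mu2 Q < +oo)%E.
  pose X : set R := `[a, b]%classic; pose Y : set R := `[c, d]%classic.
  have -> : mu2 Q = (mu X * mu Y)%E by apply: product_measure1E; exact: measurable_itv.
  apply: lte_mul_pinfty; [exact: measure_ge0| |exact: fin_itv].
  by rewrite ge0_fin_numE ?measure_ge0 //; exact: fin_itv.
pose f : M2 -> \bar R := (EFin \o H) \_ Q.
have intf : mu2.-integrable setT f.
  apply/(integrable_mkcond _ mQ).
  apply: measurable_bounded_integrable => //.
  exists M; split; first exact: num_real.
  by move=> x Mx u Qu; apply: (le_trans (HM u Qu)); exact: ltW.
have mI (x y : R) : measurable (`[x, y]%classic : set (measurableTypeR R)) by exact: measurable_itv.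
have innerS t : fubini_F mu f t =
    (if t \in `[a, b]%classic then (\int[mu]_(s in `[c, d]) H (t, s))%:E else 0)%E.
  rewrite /fubini_F /f; case: ifPn => [tab|/negP tab]; last first.
    by apply: integral0_eq => s _; rewrite /patch memNset // => -[ht _]; apply: tab; rewrite inE.
  rewrite /Rintegral fineK.
    rewrite [RHS]integral_mkcond; apply: eq_integral => s _; rewrite /patch.
    congr (if _ then _ else _); apply/idP/idP; rewrite !inE; first by case.
    by move=> hs; split => //; rewrite inE in tab.
  apply: integrable_fin_num => //; apply: measurable_bounded_integrable => //.
  - exact: fin_itv.
  - apply: (@measurable_comp _ _ _ _ _ _ (Q : set M2) H _ (pair t)) => //.
    + by move=> _ [s hs <-]; split => //=; rewrite inE in tab.
    + by apply: measurable_funS (measurable_pair1 t).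
  - exists M; split; first exact: num_real.
    move=> x Mx s hs /=; apply: (le_trans (HM _ _)); last exact: ltW.
    by split => //=; rewrite inE in tab.
have innerT s : fubini_G mu f s =
    (if s \in `[c, d]%classic then (\int[mu]_(t in `[a, b]) H (t, s))%:E else 0)%E.
  rewrite /fubini_G /f; case: ifPn => [scd|/negP scd]; last first.
    by apply: integral0_eq => t _; rewrite /patch memNset // => -[_ hs]; apply: scd; rewrite inE.
  rewrite /Rintegral fineK.
    rewrite [RHS]integral_mkcond; apply: eq_integral => t _; rewrite /patch.
    congr (if _ then _ else _); apply/idP/idP; rewrite !inE; first by case.
    by move=> ht; split => //; rewrite inE in scd.
  apply: integrable_fin_num => //; apply: measurable_bounded_integrable => //.
  - exact: fin_itv.
  - apply: (@measurable_comp _ _ _ _ _ _ (Q : set M2) H _ (fun t => (t, s))) => //.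
    + by move=> _ [t ht <-]; split => //=; rewrite inE in scd.
    + by apply: measurable_funS (measurable_pair2 s).
  - exists M; split; first exact: num_real.
    move=> x Mx t ht /=; apply: (le_trans (HM _ _)); last exact: ltW.
    by split => //=; rewrite inE in scd.
have FE : fubini_F mu f = (EFin \o (fun t => \int[mu]_(s in `[c, d]) H (t, s))) \_ `[a, b].
  by apply/funext => t; rewrite innerS /patch.
have GE : fubini_G mu f = (EFin \o (fun s => \int[mu]_(t in `[a, b]) H (t, s))) \_ `[c, d].
  by apply/funext => s; rewrite innerT /patch.
split.
  apply/(integrable_mkcond _ (mI a b)); rewrite -FE.
  exact: (@integrable_fubini_F _ _ (measurableTypeR R) (measurableTypeR R) R mu mu f intf).
have h1 := @integral12_prod_meas1 _ _ (measurableTypeR R) (measurableTypeR R) R mu mu f intf.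
have h2 := @integral21_prod_meas1 _ _ (measurableTypeR R) (measurableTypeR R) R mu mu f intf.
rewrite /Rintegral; congr fine.
transitivity (\int[mu]_t fubini_F mu f t)%E; first by rewrite FE -integral_mkcond.
by rewrite h1 -h2 GE -integral_mkcond.
Qed.

(* Joint continuity of a complex function of two real variables, in epsilon-delta form. *)
Definition ccont2 (Psi : R * R -> C) (u : R * R) := forall e : R, 0 < e ->
  exists2 d : R, 0 < d & forall v, box u d v -> cabs (Psi v - Psi u) < e.

Lemma ccont2M (F G : R * R -> C) u : ccont2 F u -> ccont2 G u ->
  ccont2 (fun v => F v * G v) u.
Proof.
move=> HF HG e e0.
pose A := cabs (F u) + cabs (G u) + 1.
have A0 : 0 < A by rewrite ltr_wpDl // addr_ge0 // cabs_ge0.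
have eA : 0 < Num.min 1 (e / (2 * A)) by rewrite lt_min ltr01 /= divr_gt0 ?mulr_gt0.
have [d d0 Hd] := HF _ eA; have [r r0 Hr] := HG _ eA.
exists (Num.min d r); first by rewrite lt_min d0.
move=> v [v1 v2]; move: v1 v2; rewrite !lt_min => /andP[v1 v1'] /andP[v2 v2'].
have h1 := Hd v (conj v1 v2); have h2 := Hr v (conj v1' v2').
move: h1 h2; rewrite !lt_min => /andP[h1 h1'] /andP[h2 h2'].
rewrite (_ : _ - _ = (F v - F u) * (G v - G u) + (F v - F u) * G u + F u * (G v - G u)); last by ring.
apply: (le_lt_trans (cabsD _ _)); rewrite (cabsM (F u)).
apply: (le_lt_trans (lerD (cabsD _ _) (lexx _))); rewrite !cabsM.
set x := cabs (F v - F u) in h1 h1' *; set y := cabs (G v - G u) in h2 h2' *.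
have x0 : 0 <= x by exact: cabs_ge0.
have y0 : 0 <= y by exact: cabs_ge0.
have f0 := cabs_ge0 (F u); have g0 := cabs_ge0 (G u).
apply: (@le_lt_trans _ _ (e / (2 * A) * A)).
  apply: (@le_trans _ _ (e / (2 * A) * 1 + e / (2 * A) * cabs (G u) + cabs (F u) * (e / (2 * A)))).
    apply: lerD; [apply: lerD|]; [apply: ler_pM|apply: ler_wpM2r|apply: ler_wpM2l] => //; exact: ltW.
  by rewrite le_eqVlt; apply/orP; left; apply/eqP; rewrite /A; ring.
rewrite (_ : _ * A = e / 2); first lra.
by field; rewrite lt0r_neq0.
Qed.

Lemma ccont2_holo (h : C -> C) (F : R * R -> C) u l :
  ccont2 F u -> cderiv h (F u) l -> ccont2 (fun v => h (F v)) u.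
Proof.
move=> HF /cderiv_cont Hh e e0.
have e2 : 0 < e / 2 by rewrite divr_gt0.
have [d d0 Hd] := Hh _ e2; have [r r0 Hr] := HF _ d0.
by exists r => // v /Hr/Hd h1; lra.
Qed.

Lemma ccont2_fst (F : R -> C) u : (forall a b, ccont a b F) -> ccont2 (fun v => F v.1) u.
Proof.
move=> HF e e0; have e2 : 0 < e / 2 by rewrite divr_gt0.
have hu : u.1 - 1 <= u.1 <= u.1 + 1 by apply/andP; split; lra.
have [d d0 Hd] := HF _ _ _ hu _ e2.
exists (Num.min 1 d); first by rewrite lt_min ltr01.
move=> v [+ _]; rewrite lt_min => /andP[h1 h2].
have hv : u.1 - 1 <= v.1 <= u.1 + 1.
  by move: h1; rewrite ltr_distl => /andP[? ?]; apply/andP; split; lra.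
by have := Hd _ hv h2; lra.
Qed.

Lemma ccont2_snd (F : R -> C) u : (forall a b, ccont a b F) -> ccont2 (fun v => F v.2) u.
Proof.
move=> HF e e0; have e2 : 0 < e / 2 by rewrite divr_gt0.
have hu : u.2 - 1 <= u.2 <= u.2 + 1 by apply/andP; split; lra.
have [d d0 Hd] := HF _ _ _ hu _ e2.
exists (Num.min 1 d); first by rewrite lt_min ltr01.
move=> v [_ ]; rewrite lt_min => /andP[h1 h2].
have hv : u.2 - 1 <= v.2 <= u.2 + 1.
  by move: h1; rewrite ltr_distl => /andP[? ?]; apply/andP; split; lra.
by have := Hd _ hv h2; lra.
Qed.

(** Continuity on the open set D gives measurability. The second conclusion estimates the outer
    integral from a bound on the inner one, whose integrability in t comes from Fubini rather than
    from continuity. *)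
Lemma cfubini (Psi : R * R -> C) (D : set (R * R)) (a b c d M : R) :
  rect a b c d `<=` D ->
  (forall u, D u -> exists2 r : R, 0 < r & box u r `<=` D) ->
  (forall u, D u -> ccont2 Psi u) ->
  (forall u, rect a b c d u -> cabs (Psi u) <= M) ->
  cint a b (fun t => cint c d (fun s => Psi (t, s))) =
    cint c d (fun s => cint a b (fun t => Psi (t, s))) /\
  (forall B, a <= b -> 0 <= B ->
    (forall t, a <= t <= b -> cabs (cint c d (fun s => Psi (t, s))) <= B) ->
    cabs (cint a b (fun t => cint c d (fun s => Psi (t, s)))) <= 2 * B * (b - a)).
Proof.
move=> QD HD HPsi HM.
have mRe : measurable_fun (rect a b c d : set M2) (fun u => Re (Psi u)).
  apply: (@measurable_funS _ _ _ _ (D : set M2)) => //; first exact: box_open_measurable.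
  apply: box_continuous_measurable => // u Du e e0; have [r r0 Hr] := HPsi u Du e e0.
  by exists r => // v /Hr h; rewrite -cReN -cReD; exact: le_lt_trans (Re_le _) h.
have mIm : measurable_fun (rect a b c d : set M2) (fun u => Im (Psi u)).
  apply: (@measurable_funS _ _ _ _ (D : set M2)) => //; first exact: box_open_measurable.
  apply: box_continuous_measurable => // u Du e e0; have [r r0 Hr] := HPsi u Du e e0.
  by exists r => // v /Hr h; rewrite -cImN -cImD; exact: le_lt_trans (Im_le _) h.
have [iRe fRe] := Rfubini mRe (fun u hu => le_trans (Re_le _) (HM u hu)).
have [iIm fIm] := Rfubini mIm (fun u hu => le_trans (Im_le _) (HM u hu)).
split; first by rewrite /cint /= fRe fIm.
move=> B ab B0 HB.
have half (g : R -> R) : mu.-integrable `[a, b] (EFin \o g) ->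
    (forall t, a <= t <= b -> `|g t| <= B) -> `|\int[mu]_(t in `[a, b]) g t| <= B * (b - a).
  move=> ig Hg; apply: (le_trans (le_normr_Rintegral _ ig)) => //.
  rewrite -rint_cst //; apply: le_Rintegral => //.
  - exact: (integrable_norm ig).
  - by apply: within_integrable; apply: continuous_subspaceT => ?; exact: cvg_cst.
apply: (le_trans (cabs_le_ReIm _)); rewrite /cint /= -mulrA mulr2n mulrDl mul1r.
by apply: lerD; apply: half => // t ht; apply: le_trans (HB _ ht);
  [exact: (Re_le (cint c d (fun s => Psi (t, s))))|exact: (Im_le (cint c d (fun s => Psi (t, s))))].
Qed.

(** Cauchy's formula on a larger circle, where the kernel is at most rho / (rho - r); this takes the
    place of compactness. *)
Lemma holo_bounded (f : C -> C) (r : R) : holo f -> 0 <= r -> r < 1 ->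
  exists2 M : R, 0 <= M & forall z, cabs z <= r -> cabs (f z) <= M.
Proof.
move=> Hf r0 r1; pose rho := (1 + r) / 2.
have rr : r < rho by rewrite /rho ltr_pdivlMr //; lra.
have rho1 : rho < 1 by rewrite /rho ltr_pdivrMr //; lra.
have rho0 : 0 < rho by exact: le_lt_trans rr.
have cf : ccont 0 (2 * pi) (fun t => f (rho%:C * cis t)).
  by apply: holo_circle_ccont => //; exact: ltW.
have [M M0 HM] := ccont_bounded twopi_ge0 cf.
pose B := 2 * (M * (rho / (rho - r))).
have B0 : 0 <= B.
  by rewrite /B; do 2![apply: mulr_ge0 => //]; apply: divr_ge0; [exact: ltW|rewrite subr_ge0 ltW].
exists B => // z hz; have zr : cabs z < rho by exact: le_lt_trans rr.
have H := cauchy_formula Hf zr rho1.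
have p0 := @twopi_gt0 R.
have : cabs ((2 * pi)%:C * f z) <= B * (2 * pi - 0).
  rewrite -H /B; apply: cint_le; first exact: twopi_ge0.
    by apply: ccontM => //; exact: ker_ccont.
  move=> t ht; rewrite cabsM; apply: ler_pM; rewrite ?cabs_ge0 ?HM //.
  rewrite cabsM cabsV cabsM cabs_cis cabsR mulr1 ger0_norm ?(ltW rho0) //.
  apply: ler_wpM2l; first exact: ltW.
  rewrite lef_pV2 ?posrE ?subr_gt0 //; last by rewrite cabs_gt0 circle_sub_neq0.
  by apply: le_trans (cabs_circle_sub t zr); rewrite lerD2l lerN2.
rewrite cabsM cabsR ger0_norm ?twopi_ge0 // subr0 mulrC.
by rewrite ler_pM2r.
Qed.

End FubiniRectangle.

(** * Size and norm of the test functions *)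

Section TestNorm.
Context {R : realType}.
Local Notation C := (Cplx R).
Local Notation mu := (@lebesgue_measure R).
Local Notation mu2 := (@lebesgue_measure R \x @lebesgue_measure R)%E.
Local Notation M2 := (measurableTypeR R * measurableTypeR R)%type.

(** For k >= 1 the zero 2^k / (2^k - 1) lies about 2^-k beyond the point 1, so on the disc the
    modulus is at least 1 and at least 2^(k-1) |1 - z|. *)
Definition den (k : nat) (z : C) : C := (2 ^+ k)%:C - (2 ^+ k - 1)%:C * z.

Let pow2_ge1 k : 1 <= 2 ^+ k :> R.
Proof. by rewrite exprn_ege1 // ler1n. Qed.

Lemma den_ge1 k z : cabs z <= 1 -> 1 <= cabs (den k z).
Proof.
move=> z1; apply: le_trans (cabs_subl _ _); rewrite cabsM !cabsR.
have h := pow2_ge1 k; rewrite (ger0_norm (le_trans ler01 h)) ger0_norm ?subr_ge0 //.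
have : (2 ^+ k - 1) * cabs z <= 2 ^+ k - 1 by rewrite ler_piMr // subr_ge0.
by lra.
Qed.

Lemma den_ge k z : cabs z <= 1 -> 2 ^+ k * cabs (1 - z) <= 2 * cabs (den k z).
Proof.
move=> z1; have h1 := den_ge1 k z1.
have E : (2 ^+ k)%:C * (1 - z) = den k z - z by rewrite /den rmorphB rmorph1; ring.
have : cabs ((2 ^+ k)%:C * (1 - z)) <= cabs (den k z) + cabs z by rewrite E cabsB.
by rewrite cabsM cabsR ger0_norm ?exprn_ge0 //; lra.
Qed.

Lemma den_neq0 k z : cabs z <= 1 -> den k z != 0.
Proof. by move=> /(den_ge1 k) h; rewrite -cabs_gt0; exact: lt_le_trans h. Qed.

(** Bumps of height b k and width 2^-k at the boundary point where z * a = 1; the rotation a is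
    later e^(-it). *)
Definition ftest (b : nat -> R) (N n : nat) (a z : C) : C :=
  \sum_(0 <= k < n) (b k)%:C * (den k (z * a))^-1 ^+ N.

Lemma ftest_holo b N n a : cabs a = 1 -> holo (ftest b N n a).
Proof.
move=> a1 z z1; rewrite /ftest; elim: n => [|n [l IH]].
  by exists 0; under eq_fun do rewrite big_geq //; exact: cderiv_cst.
have za : cabs (z * a) <= 1 by rewrite cabsM a1 mulr1 ltW.
have dn : den n (z * a) != 0 by exact: den_neq0.
have [m Hm] : exists m, cderiv (fun w => (b n)%:C * (den n (w * a))^-1 ^+ N) z m.
  have d1 : cderiv (fun w => den n (w * a)) z (0 + (-1) * ((2 ^+ n - 1)%:C * (1 * a + z * 0) + 0)).
    apply: cderivD; first exact: cderiv_cst.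
    have dd : cderiv (fun w => (-1 : C) * ((2 ^+ n - 1)%:C * (w * a))) z
        (0 * ((2 ^+ n - 1)%:C * (z * a)) + (-1) * (0 * (z * a) + (2 ^+ n - 1)%:C * (1 * a + z * 0))).
      apply: cderivM; first exact: cderiv_cst.
      apply: cderivM; first exact: cderiv_cst.
      by apply: cderivM; [exact: cderiv_id|exact: cderiv_cst].
    rewrite (_ : -1 * _ = 0 * ((2 ^+ n - 1)%:C * (z * a)) + (-1) * (0 * (z * a) + (2 ^+ n - 1)%:C * (1 * a + z * 0))); last by ring.
    by apply: cderiv_ext ltr01 _ dd => w _; ring.
  have [m Hm] := cderivX N (cderiv_comp d1 (cderivV dn)).
  by eexists; apply: cderivM Hm; exact: cderiv_cst.
exists (l + m); under eq_fun do rewrite big_nat_recr //=; have := cderivD IH Hm.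
exact.
Qed.

Variables (p K lam c : R) (Wd : nat -> R) (w : C -> R).
Hypotheses (p1 : 1 < p) (K1 : 1 <= K) (lam1 : 1 < lam) (c0 : 0 < c).
Hypothesis Wd_gt0 : forall m, 0 < Wd m.
Hypothesis Wd_K : forall m, Wd m <= K * Wd m.+1.
Hypothesis Wd_lam : forall m, lam * Wd m.+1 <= Wd m.
Hypothesis w_le : forall m u, annulus m u ->
  0 <= w (u.1 +i* u.2) <= c * Wd m * 2 ^+ m.

Let b := bseq p Wd.
Let b_gt0 m : 0 < b m. Proof. exact: bseq_gt0. Qed.
Let beta := K `^ (p - 1)^-1.
Let Lam := lam `^ (p - 1)^-1.
Let b_beta m : b m.+1 <= beta * b m. Proof. exact: bseq_beta. Qed.
Let b_sum j : \sum_(0 <= k < j) b k <= (Lam - 1)^-1 * b j.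
Proof. exact: bseq_sum. Qed.
Let beta_ge0 : 0 <= beta. Proof. exact: powR_ge0. Qed.

Let Lam_gt1 : 1 < Lam.
Proof.
have -> : 1 = 1 `^ (p - 1)^-1 :> R by rewrite powR1.
apply: gt0_ltr_powR; rewrite ?nnegrE ?invr_gt0 ?subr_gt0 // ltW // (lt_trans ltr01) //.
Qed.

Variable N : nat.
Hypothesis HN : beta <= 2 ^+ N / 2.

(** Each step multiplies b by at most beta and the power by 2^-N, and beta * 2^-N <= 1/2 by the
    choice of N. *)
Let tail_term j k : (j <= k)%N -> b k * (2 ^+ j / 2 ^+ k) ^+ N <= b j * (2 ^+ j / 2 ^+ k).
Proof.
elim: k => [|k IH]; first by rewrite leqn0 => /eqP ->; rewrite expr0 divr1 expr1n.
rewrite leq_eqVlt => /predU1P[->|]; first by rewrite divff ?expf_neq0 // expr1n.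
rewrite ltnS => /IH {}IH; rewrite exprS invfM (mulrCA (2 ^+ j)) exprMn.
set t := 2 ^+ j / 2 ^+ k in IH *.
have t0 : 0 <= t by rewrite divr_ge0 ?exprn_ge0.
have tN : 0 <= t ^+ N by rewrite exprn_ge0.
have q0 : 0 <= 2^-1 ^+ N :> R by rewrite exprn_ge0 ?invr_ge0.
apply: (@le_trans _ _ (beta * b k * (2^-1 ^+ N * t ^+ N))).
  by apply: ler_wpM2r; [exact: mulr_ge0|exact: b_beta].
rewrite (_ : beta * b k * _ = (beta * 2^-1 ^+ N) * (b k * t ^+ N)); last by ring.
rewrite (_ : b j * _ = 2^-1 * (b j * t)); last by ring.
apply: ler_pM => //; first exact: mulr_ge0.
  by rewrite mulr_ge0 // ltW.
by rewrite exprVn ler_pdivrMr ?exprn_gt0 // mulrC.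
Qed.

Let C2 := (Lam - 1)^-1 + 4 ^+ N * 2.

Let C2_gt0 : 0 < C2.
Proof. by rewrite addr_gt0 ?invr_gt0 ?subr_gt0 // mulr_gt0 // exprn_gt0. Qed.

Let half_sum j n : (j <= n)%N -> \sum_(j <= k < n) (2 ^+ j / 2 ^+ k) <= 2 :> R.
Proof.
move=> jn; suff : \sum_(j <= k < n) (2 ^+ j / 2 ^+ k) <= 2 - 2 * (2 ^+ j / 2 ^+ n) :> R.
  by move=> h; apply: (le_trans h); rewrite lerBlDr lerDl mulr_ge0 // divr_ge0 ?exprn_ge0.
elim: n jn => [|n IH]; first by rewrite leqn0 => /eqP ->; rewrite big_geq // expr0 divr1 mulr1 subrr.
rewrite leq_eqVlt => /predU1P[->|].
  by rewrite big_geq // divff ?expf_neq0 // mulr1 subrr.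
rewrite ltnS => jn; rewrite big_nat_recr //=.
have -> : 2 ^+ j / 2 ^+ n.+1 = 2^-1 * (2 ^+ j / 2 ^+ n) :> R by rewrite exprS invfM mulrCA.
by have := IH jn; lra.
Qed.

(** Here j is the dyadic scale of |1 - z a|, cut off at n. The bumps with k < j sum geometrically to
    a multiple of b j; those with k >= j are seen from beyond their width and are controlled by
    [tail_term]. *)
Lemma ftest_pointwise n (a z : C) : cabs a = 1 -> cabs z < 1 -> exists2 j : nat, (j <= n)%N &
  cabs (ftest b N n a z) <= C2 * b j /\ (j = 0%N \/ cabs (1 - z * a) < 2 ^- j).
Proof.
move=> a1 z1; set zt := z * a; set dl := cabs (1 - zt).
have zt1 : cabs zt < 1 by rewrite cabsM a1 mulr1.
have dl0 : 0 < dl.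
  rewrite cabs_gt0 subr_eq0; apply/eqP => E; move: zt1; rewrite -E cabs1 ltxx //.
have term k : cabs ((b k)%:C * (den k zt)^-1 ^+ N) = b k * (cabs (den k zt))^-1 ^+ N.
  by rewrite cabsM cabsX cabsV cabsR ger0_norm // ltW.
have bound m : cabs (ftest b N m a z) <= \sum_(0 <= k < m) b k * (cabs (den k zt))^-1 ^+ N.
  rewrite /ftest; elim: m => [|m IH]; first by rewrite !big_geq // cabs0.
  rewrite !big_nat_recr //=; apply: (le_trans (cabsD _ _)).
  by rewrite term; apply: lerD.
have kap1 k : (cabs (den k zt))^-1 ^+ N <= 1.
  apply: exprn_ile1; rewrite ?invr_ge0 ?cabs_ge0 // invf_le1.
    by apply: den_ge1; exact: ltW.
  by rewrite (lt_le_trans ltr01) // den_ge1 // ltW.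
have head m : \sum_(0 <= k < m) b k * (cabs (den k zt))^-1 ^+ N <= (Lam - 1)^-1 * b m.
  apply: le_trans (b_sum m); apply: ler_sum => k _.
  by rewrite ler_piMr // ltW.
have ex : exists j, 2 ^- j.+1 <= dl.
  exists (Num.bound dl^-1).
  rewrite -[leRHS]invrK lef_pV2 ?posrE ?exprn_gt0 ?invr_gt0 //.
  apply: ltW; apply: (lt_trans (archi_boundP _)); first by rewrite invr_ge0 ltW.
  by rewrite -natrX ltr_nat (leq_trans (ltn_expl _ (ltnSn 1))) // leq_exp2l.
(* The least j with 2^-(j+1) <= |1 - z a|; minimality gives |1 - z a| < 2^-j unless j = 0. *)
case: (ex_minnP ex) => j hj jmin.
have dj : j = 0%N \/ dl < 2 ^- j.
  case: j jmin {hj} => [|j] jmin; [by left|right].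
  by rewrite ltNge; apply/negP => /jmin; rewrite ltnn.
have [nj|jn] := leqP n j.
  exists n => //; split.
    apply: (le_trans (bound n)); apply: (le_trans (head n)).
    by apply: ler_wpM2r; [exact: ltW|rewrite /C2 lerDl mulr_ge0 // exprn_ge0].
  case: n nj => [|n] nj; [by left|right].
  case: dj => [E|]; first by rewrite E in nj.
  by move=> /lt_le_trans; apply; exact: pow2_le.
exists j; first exact: ltnW.
split => //; apply: (le_trans (bound n)).
rewrite (@big_cat_nat _ _ _ j) //=; last exact: ltnW.
rewrite /C2 mulrDl; apply: lerD => //.
apply: (@le_trans _ _ (\sum_(j <= k < n) 4 ^+ N * b j * (2 ^+ j / 2 ^+ k))); last first.
  rewrite -mulr_sumr (_ : 4 ^+ N * 2 * b j = 4 ^+ N * b j * 2); last by ring.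
  by apply: ler_wpM2l; [rewrite mulr_ge0 ?exprn_ge0 // ltW|apply: half_sum; exact: ltnW].
rewrite big_nat_cond [leRHS]big_nat_cond; apply: ler_sum => k /andP[/andP[jk _] _].
have dk0 : 0 < cabs (den k zt) by rewrite (lt_le_trans ltr01) // den_ge1 // ltW.
have inv_le : (cabs (den k zt))^-1 <= 4 * (2 ^+ j / 2 ^+ k).
  have h := den_ge k (ltW zt1); rewrite -/dl in h.
  rewrite -[leLHS]mul1r ler_pdivrMr //.
  have e1 : 1 <= 2 ^+ j.+1 * dl by move: hj; rewrite -[leLHS]mul1r ler_pdivrMr ?exprn_gt0 // mulrC.
  have e2 : 0 < 2 ^+ k :> R by rewrite exprn_gt0.
  have e3 : 0 < 2 ^+ j :> R by rewrite exprn_gt0.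
  rewrite (_ : 4 * _ * _ = 2 ^+ j.+1 * ((2 * cabs (den k zt)) / 2 ^+ k)); last by rewrite exprS; ring.
  apply: (le_trans e1); apply: ler_wpM2l; first by rewrite exprn_ge0.
  by rewrite ler_pdivlMr // mulrC.
apply: (@le_trans _ _ (b k * (4 * (2 ^+ j / 2 ^+ k)) ^+ N)).
  apply: ler_wpM2l; first exact: ltW.
  apply: lerXn2r => //; rewrite nnegrE ?invr_ge0 ?cabs_ge0 //.
rewrite exprMn mulrCA -mulrA; apply: ler_wpM2l; first by rewrite exprn_ge0.
exact: tail_term.
Qed.

Let C1 := 48 * c * K * (lam / (lam - 1)).

(** The disc is covered by sets where |f| <= C2 * b j, of weighted mass at most C1 * Wd j * 2^-j
    inside the j-th neighbourhood of e^(it). By [bseq_powE] the sum over j <= n is a multiple of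
    [Sseq] at n.+1, and [SseqS] brings it back to n. *)
Lemma ftest_norm n t : (0 < n)%N ->
  (bergman_integral p w (ftest b N n (cis t)^-1) <=
   (pi^-1 * (C2 `^ p * C1 * ((1 + beta) * Sseq p Wd n)))%:E)%E.
Proof.
move=> n0; have p0 : 0 <= p by rewrite ltW // (lt_trans ltr01).
have a1 : cabs (cis t)^-1 = 1 by rewrite cabsV cabs_cis invr1.
have lp : 0 < lam by exact: lt_trans lam1.
have C1_ge0 : 0 <= C1.
  rewrite /C1; apply: mulr_ge0; last by rewrite divr_ge0 ?subr_ge0 // ltW.
  by rewrite !mulr_ge0 // ?(ltW c0) // (le_trans ler01).
rewrite /bergman_integral /area_integral EFinM; apply: lee_wpmul2l.
  by rewrite lee_fin invr_ge0 pi_ge0.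
pose E j := dyad_nbhd t j.
pose g j u := ((C2 `^ p * b j `^ p)%:E * geo c Wd (E j) u)%E.
have g0 j u : (0 <= g j u)%E.
  by rewrite mule_ge0 // ?lee_fin ?mulr_ge0 ?powR_ge0 //; exact: geo_ge0.
have mg j : measurable_fun (@planar_disc R : set M2) (g j : M2 -> \bar R).
  apply: emeasurable_funM; first exact: measurable_cst.
  by apply: geo_measurable => //; exact: dyad_nbhd_measurable.
apply: (@le_trans _ _ (\int[mu2]_(u in @planar_disc R) \sum_(j <- index_iota 0 n.+1) g j u)%E).
  apply: integral_mono => //.
  - by move=> u _; apply: sume_ge0 => j _.
  - move=> u Du; have [m hm] := annulus_cover Du; have /andP[wu _] := w_le hm.
    by rewrite lee_fin mulr_ge0 // powR_ge0.
  move=> u Du; have u1 : cabs (u.1 +i* u.2 : C) < 1 by apply/planar_discE.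
  have [m hm] := annulus_cover Du; have /andP[wu _] := w_le hm.
  have [j jn [fj dj]] := ftest_pointwise n a1 u1.
  have Eu : E j u.
    case: j dj {jn fj} => [//|j] [//|]; rewrite /E /dyad_nbhd /near_cis /=.
    have -> : 1 - (u.1 +i* u.2) * (cis t)^-1 = - ((u.1 +i* u.2 : C) - cis t) / cis t :> C.
      by field; rewrite cis_neq0.
    by rewrite cabsM cabsN cabsV cabs_cis invr1 mulr1.
  apply: (@le_trans _ _ (g j u)).
    apply: (@le_trans _ _ ((C2 `^ p * b j `^ p)%:E * (w (u.1 +i* u.2))%:E)%E).
      rewrite -EFinM lee_fin; apply: ler_wpM2r => //.
      rewrite -powRM ?(ltW (b_gt0 j)) ?(ltW C2_gt0) //.
      apply: ge0_ler_powR => //; rewrite nnegrE ?cabs_ge0 //.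
      by rewrite mulr_ge0 // ltW.
    apply: lee_wpmul2l; first by rewrite lee_fin mulr_ge0 // powR_ge0.
    exact: geo_ge.
  have ju : j \in index_iota 0 n.+1 by rewrite mem_index_iota.
  rewrite (bigD1_seq j ju (iota_uniq _ _)) /=.
  by rewrite leeDl // sume_ge0 // => i _; exact: g0.
rewrite (ge0_integral_sum _ planar_disc_measurable mg (fun j u _ => g0 j u)).
apply: (@le_trans _ _ (\sum_(j <- index_iota 0 n.+1) (C2 `^ p * C1 * (b j * 2 ^- j))%:E)%E).
  apply: lee_sum => j _; rewrite /g ge0_integralZl //; last 4 first.
  - exact: planar_disc_measurable.
  - by apply: geo_measurable => //; exact: dyad_nbhd_measurable.
  - by move=> u _; exact: geo_ge0.
  - by rewrite lee_fin mulr_ge0 // powR_ge0.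
  apply: (@le_trans _ _ ((C2 `^ p * b j `^ p)%:E * (C1 * (Wd j * 2 ^- j))%:E)%E).
    apply: lee_wpmul2l; first by rewrite lee_fin mulr_ge0 // powR_ge0.
    exact: geo_int_dyad.
  rewrite -EFinM lee_fin.
  have E1 : b j `^ p * Wd j = b j by exact: bseq_powE.
  have -> : C2 `^ p * b j `^ p * (C1 * (Wd j * 2 ^- j)) = C2 `^ p * C1 * ((b j `^ p * Wd j) * 2 ^- j) by ring.
  by rewrite E1.
rewrite sumEFin lee_fin -mulr_sumr; apply: ler_wpM2l; first by rewrite mulr_ge0 // powR_ge0.
by case: n n0 {g0 mg} => // n _; exact: SseqS.
Qed.

End TestNorm.

(** * Averaging over rotations *)

Section Averaging.
Context {R : realType}.
Local Notation C := (Cplx R).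
Local Notation mu := (@lebesgue_measure R).

Lemma cint_cst a b (z : C) : a <= b -> cint a b (fun=> z) = (b - a)%:C * z.
Proof.
move=> ab; apply: complex_ext; rewrite /cint /= rint_cst // ?cReM ?cImM /= mul0r ?subr0 ?addr0 mulrC //.
Qed.

(** Normalizing at radius 1/2 gives a formula that also holds at q = 0. *)
Lemma fcoef_pow (f : C -> C) m q : holo f -> 0 <= q -> q < 1 ->
  fcoef f m q = ((2 * q) ^+ m)%:C * fcoef f m 2^-1.
Proof.
move=> Hf q0 q1.
have h0 : 0 < 2^-1 :> R by rewrite invr_gt0.
have h1 : 2^-1 < 1 :> R by rewrite invf_lt1 // ltr1n.
have h2 : (2 : R)%:C ^+ m * (2^-1)%:C ^+ m = 1 :> C.
  by rewrite -exprMn -rmorphM divff // rmorph1 expr1n.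
move: q0; rewrite le_eqVlt => /predU1P[<-|q0].
  have E0 : fcoef f m 0 = f 0 * cint 0 (2 * pi) (fun t => 1 * (cis t ^+ m)^-1).
    rewrite -cintZ; first by apply: cint_ext => t _; rewrite mul0r mul1r.
    by apply: ccontM; [exact: ccont_cst|exact: cisX_ccont].
  case: m {h2} E0 => [|m] ->; last by rewrite cis_integral mulr0 mulr0 exprS !mul0r.
  have c0 : cabs (0 : C) < 2^-1 by rewrite cabs0.
  rewrite expr0 rmorph1 mul1r /fcoef.
  transitivity (f 0 * (2 * pi)%:C).
    congr (_ * _); transitivity (cint 0 (2 * pi) (fun=> 1 : C)).
      by apply: cint_ext => t _; rewrite expr0 invr1 mulr1.
    by rewrite cint_cst ?twopi_ge0 // subr0 mulr1.
  rewrite mulrC -(cauchy_formula Hf c0 h1); apply: cint_ext => t _.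
  by rewrite subr0 divff ?invr1 // mulf_neq0 ?cis_neq0 // gt_eqF ?ltc0R.
rewrite exprMn rmorphM !rmorphXn -mulrA.
case: (ltgtP q 2^-1) => qh.
- rewrite (fcoef_homog m Hf q0 qh h1) mulrA h2 mul1r //.
- by rewrite -(fcoef_homog m Hf h0 qh q1) mulrA h2 mul1r.
- by rewrite qh mulrA h2 mul1r.
Qed.

(** Multiply the inner integral at angle t by e^(-i(m+1)t) and integrate over t. Phi is taken on the
    real axis and does not depend on t, so after the exchange G contributes only its m-th
    coefficient. *)
Lemma average_le (Phi G : C -> C) m rho B : holo Phi -> holo G -> 0 < rho -> rho < 1 -> 0 <= B ->
  (forall t, cabs (cint 0 1 (fun s => Phi (s * rho)%:C * G ((s * rho)%:C * cis t) * (rho%:C * cis t))) <= B) ->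
  cabs (cint 0 1 (fun s => Phi (s * rho)%:C * (rho * (2 * (s * rho)) ^+ m)%:C)) * cabs (fcoef G m 2^-1)
    <= 4 * pi * B.
Proof.
move=> HP HG r0 r1 B0 HB.
pose Psi (u : R * R) : C :=
  Phi (u.2 * rho)%:C * (G ((u.2 * rho)%:C * cis u.1) * (rho%:C * (cis u.1 ^+ m)^-1)).
have cP : ccont 0 1 (fun s => Phi (s * rho)%:C).
  apply: ccont_comp => [s /andP[s0 s1]|].
    apply: HP; rewrite cabsR ger0_norm; last by rewrite mulr_ge0 // ltW.
    by apply: le_lt_trans r1; rewrite ler_piMl // ltW.
  apply: (@ccont_ext _ _ _ (fun s => rho%:C * s%:C)) => [s _|]; first by rewrite mulrC rmorphM.
  by apply: ccontM; [exact: ccont_cst|exact: ccont_id].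
have [M1 M10 HM1] := holo_bounded HP (ltW r0) r1.
have [M2 M20 HM2] := holo_bounded HG (ltW r0) r1.
have sr s : 0 <= s <= 1 -> `|s * rho| <= rho.
  by move=> /andP[s0 s1]; rewrite ger0_norm ?mulr_ge0 ?ler_piMl // ltW.
(* An open set around the rectangle of integration on which the integrand is jointly continuous. *)
pose D : set (R * R) := [set u | `|u.2 * rho| < 1].
have [||||E1 E2] := @cfubini R Psi D 0 (2 * pi) 0 1 (M1 * (M2 * rho)).
- by move=> u [_ /=]; rewrite in_itv /= => /sr h; exact: le_lt_trans r1.
- move=> u Du; exists (1 - `|u.2 * rho|); first by rewrite subr_gt0.
  move=> v [_ hv]; rewrite /D /=.
  have : `|v.2 * rho - u.2 * rho| <= `|v.2 - u.2|.
    by rewrite -mulrBl normrM ler_piMr // ger0_norm ltW.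
  have := ler_normD (v.2 * rho - u.2 * rho) (u.2 * rho); rewrite subrK.
  by move: hv; lra.
- move=> u Du.
  have cr : ccont2 (fun v : R * R => (v.2 * rho)%:C : C) u.
    apply: (@ccont2_snd _ (fun s => (s * rho)%:C)) => a b.
    apply: (@ccont_ext _ _ _ (fun s => rho%:C * s%:C)) => [s _|]; first by rewrite mulrC rmorphM.
    by apply: ccontM; [exact: ccont_cst|exact: ccont_id].
  have cc : ccont2 (fun v : R * R => cis v.1) u by apply: ccont2_fst => a b; exact: cis_ccont.
  have D1 : cabs ((u.2 * rho)%:C : C) < 1 by rewrite cabsR.
  have D2 : cabs ((u.2 * rho)%:C * cis u.1) < 1 by rewrite cabsM cabs_cis mulr1.
  have [l1 H1] := HP _ D1; have [l2 H2] := HG _ D2.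
  apply: ccont2M; first exact: ccont2_holo cr H1.
  apply: ccont2M; first exact: (ccont2_holo (ccont2M cr cc) H2).
  apply: (@ccont2_fst _ (fun t => rho%:C * (cis t ^+ m)^-1)) => a b.
  by apply: ccontM; [exact: ccont_cst|exact: cisX_ccont].
- move=> u [_ /=]; rewrite in_itv /= => /sr h.
  rewrite /Psi !cabsM cabsV cabsX cabs_cis expr1n invr1 mulr1 cabsR (ger0_norm (ltW r0)).
  apply: ler_pM; rewrite ?cabs_ge0 //; first by rewrite mulr_ge0 ?cabs_ge0 // ltW.
    by apply: HM1; rewrite cabsR.
  apply: ler_wpM2r; first exact: ltW.
  by apply: HM2; rewrite cabsM cabs_cis cabsR mulr1.
have := E2 B (@twopi_ge0 R) B0; rewrite E1 {E1 E2}.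
rewrite (_ : cint 0 1 _ = cint 0 1 (fun s => Phi (s * rho)%:C * (rho * (2 * (s * rho)) ^+ m)%:C) * fcoef G m 2^-1).
  rewrite cabsM subr0 (_ : 2 * B * (2 * pi) = 4 * pi * B); last by ring.
  apply => t ht; apply: le_trans (HB t).
  have -> : cint 0 1 (fun s => Psi (t, s)) = (cis t ^+ m.+1)^-1 *
      cint 0 1 (fun s => Phi (s * rho)%:C * G ((s * rho)%:C * cis t) * (rho%:C * cis t)).
    rewrite -cintZ; first apply: cint_ext => s _.
      rewrite /Psi /= exprS; field; rewrite cis_neq0 expf_neq0 ?cis_neq0 //.
    apply: ccontM; last exact: ccont_cst.
    apply: ccontM; first exact: cP.
    apply: (@ccont_comp _ _ _ G (fun s => (s * rho)%:C * cis t)) => [s hs|].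
      by apply: HG; rewrite cabsM cabs_cis cabsR mulr1; exact: le_lt_trans (sr _ hs) r1.
    apply: (@ccont_ext _ _ _ (fun s => (rho%:C * cis t) * s%:C)) => [s _|].
      by rewrite rmorphM; ring.
    by apply: ccontM; [exact: ccont_cst|exact: ccont_id].
  by rewrite cabsM cabsV cabsX cabs_cis expr1n invr1 mul1r.
rewrite [RHS]mulrC -cintZ; last first.
  apply: ccontM; first exact: cP.
  apply: (@ccont_ext _ _ _ (fun s => rho%:C * ((2 * rho)%:C * s%:C) ^+ m)) => [s _|].
    by rewrite !rmorphM rmorphXn !rmorphM; congr (_ * _ ^+ _); ring.
  apply: ccontM; first exact: ccont_cst.
  by apply: ccontX; apply: ccontM; [exact: ccont_cst|exact: ccont_id].
apply: cint_ext => s hs; have [s0 s1] := andP hs.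
have q0 : 0 <= s * rho := mulr_ge0 s0 (ltW r0).
have q1 : s * rho < 1 by move: (sr _ hs); rewrite (ger0_norm q0) => h; exact: le_lt_trans r1.
transitivity ((Phi (s * rho)%:C * rho%:C) * fcoef G m (s * rho)).
  rewrite -cintZ; first by apply: cint_ext => t _; rewrite /Psi /=; ring.
  by apply: ccontM; [exact: holo_circle_ccont|exact: cisX_ccont].
by rewrite (fcoef_pow m HG q0 q1) rmorphM; ring.
Qed.

End Averaging.

(** * Lower bounds for the test functions on a radius *)

Section Unbounded.
Context {R : realType}.
Local Notation C := (Cplx R).
Local Notation mu := (@lebesgue_measure R).

Lemma sup_norm_ge (f : C -> C) z : Hinfty f -> cabs z < 1 -> cabs (f z) <= sup_norm f.
Proof.
move=> [_ [M HM]] z1; apply: ub_le_sup; last by exists z => //; exact/unit_discE.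
by exists M => _ [u hu <-]; exact: HM.
Qed.

(** Write x = x^(1/p) * x^((p-1)/p). The first threshold makes the second factor at least 2|A| + 1,
    and the other one takes care of b0. *)
Lemma powR_sublinear (p A b0 : R) : 1 < p ->
  exists X : R, forall x, X <= x -> A * x `^ p^-1 < x - b0.
Proof.
move=> p1; have p0 : 0 < p by exact: lt_trans p1.
have q0 : 0 < p - 1 by rewrite subr_gt0.
pose a := 2 * `|A| + 1; have a0 : 0 < a by rewrite ltr_wpDl // mulr_ge0.
exists (Num.max (a `^ (p / (p - 1))) (2 * `|b0| + 1)) => x.
rewrite ge_max => /andP[h1 h2].
have x0 : 0 < x by apply: lt_le_trans h2; rewrite ltr_wpDl // mulr_ge0.
have hx : x = x `^ p^-1 * x `^ ((p - 1) / p).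
  rewrite -powRD; last by rewrite (gt_eqF x0) implybT.
  rewrite (_ : p^-1 + (p - 1) / p = 1) ?powRr1 ?(ltW x0) //.
  by field; rewrite gt_eqF.
have ha : a <= x `^ ((p - 1) / p).
  have E : (a `^ (p / (p - 1))) `^ ((p - 1) / p) = a.
    rewrite -powRrM (_ : p / (p - 1) * ((p - 1) / p) = 1) ?powRr1 ?(ltW a0) //.
    by field; rewrite !gt_eqF.
  rewrite -[leLHS]E; apply: ge0_ler_powR => //; rewrite ?nnegrE ?powR_ge0 ?(ltW x0) //.
  by rewrite divr_ge0 // ltW.
set y := x `^ p^-1 in hx *; have y0 : 0 <= y by exact: powR_ge0.
have h3 : y * a <= x by rewrite [leRHS]hx; apply: ler_wpM2l.
have h4 : A * y <= `|A| * y by apply: ler_wpM2r => //; exact: ler_norm.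
have h5 : y * a = 2 * (`|A| * y) + y by rewrite /a; ring.
have h6 := ler_norm b0.
by move: h2 h3 h4 h5 h6 y0; lra.
Qed.

Variables (p K lam c : R) (Wd : nat -> R) (w : C -> R).
Hypotheses (p1 : 1 < p) (K1 : 1 <= K) (lam1 : 1 < lam) (c0 : 0 < c).
Hypothesis Wd_gt0 : forall m, 0 < Wd m.
Hypothesis Wd_K : forall m, Wd m <= K * Wd m.+1.
Hypothesis Wd_lam : forall m, lam * Wd m.+1 <= Wd m.
Hypothesis w_le : forall m u, annulus m u ->
  0 <= w (u.1 +i* u.2) <= c * Wd m * 2 ^+ m.

Let b := bseq p Wd.
Let b_gt0 m : 0 < b m. Proof. exact: bseq_gt0. Qed.

Definition ftest_radial (N n : nat) (q : R) : R :=
  \sum_(0 <= k < n) b k * (2 ^+ k - (2 ^+ k - 1) * q)^-1 ^+ N.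

Lemma ftest_radialE N n q : ftest b N n 1 q%:C = (ftest_radial N n q)%:C.
Proof.
rewrite /ftest /ftest_radial rmorph_sum; apply: eq_bigr => k _.
rewrite [RHS]rmorphM [X in _ = _ * X]rmorphXn (fmorphV (real_complex R)).
by rewrite mulr1 /den [in RHS]rmorphB [in RHS]rmorphM.
Qed.

(** For q >= r_k the denominator of the k-th term is at most 2, and the other terms are
    nonnegative. *)
Lemma ftest_radial_ge N n k q : (k < n)%N -> rad k <= q -> q < 1 ->
  b k / 2 ^+ N <= ftest_radial N n q.
Proof.
move=> kn qk q1.
have P j : 1 <= 2 ^+ j - (2 ^+ j - 1) * q.
  have h : 1 <= 2 ^+ j :> R by rewrite exprn_ege1 // ler1n.
  have : (2 ^+ j - 1) * q <= (2 ^+ j - 1) * 1 by rewrite ler_wpM2l ?subr_ge0 // ltW.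
  by rewrite mulr1; lra.
have T j : 0 <= b j * (2 ^+ j - (2 ^+ j - 1) * q)^-1 ^+ N.
  rewrite mulr_ge0 ?(ltW (b_gt0 j)) // exprn_ge0 // invr_ge0.
  exact: le_trans ler01 (P j).
have kin : k \in index_iota 0 n by rewrite mem_index_iota.
rewrite /ftest_radial (bigD1_seq k kin (iota_uniq _ _)) /=.
apply: (@le_trans _ _ (b k * (2 ^+ k - (2 ^+ k - 1) * q)^-1 ^+ N)); last by rewrite lerDl sumr_ge0.
apply: ler_wpM2l; first exact: ltW.
rewrite -exprVn; apply: lerXn2r; rewrite ?nnegrE ?invr_ge0 //.
  exact: le_trans ler01 (P k).
rewrite lef_pV2 ?posrE //; last exact: lt_le_trans ltr01 (P k).
have h2 : (2 ^+ k) * rad k = 2 ^+ k - 1 :> R by rewrite /rad mulrBr mulr1 divff // expf_neq0.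
have : (2 ^+ k - 1) * rad k <= (2 ^+ k - 1) * q.
  by rewrite ler_wpM2l // subr_ge0 exprn_ege1 // ler1n.
by rewrite mulrBl h2 mul1r; have := rad_ge0 k; have := rad_lt1 k; lra.
Qed.

(** In the variable s * rho the k-th dyadic interval has length 2^-(k+1), and the test function is
    at least b k / 2 ^+ N there. The interval k = 0 is dropped, because 2 * (s * rho) >= 1 is
    available only from r_1 = 1/2 on; hence the subtracted b 0. *)
Lemma ftest_integral_ge N n m : (1 < n)%N ->
  (Sseq p Wd n - b 0) / (2 * 2 ^+ N) <=
  cabs (cint 0 1 (fun s => ftest b N n 1 (s * rad n)%:C * (rad n * (2 * (s * rad n)) ^+ m)%:C)).
Proof.
move=> n1; set rho := rad n.
have r12 : 2^-1 <= rho by rewrite -rad1 /rho rad_le // ltnW.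
have r0 : 0 < rho by apply: lt_le_trans r12; rewrite invr_gt0.
have r1 : rho < 1 by exact: rad_lt1.
pose h s := ftest_radial N n (s * rho) * (rho * (2 * (s * rho)) ^+ m).
apply: (@le_trans _ _ (\int[mu]_(s in `[0, 1]) h s)); last first.
  apply: le_trans (ler_norm _) _.
  apply: le_trans (Re_le (cint 0 1 _)); rewrite /cint /=.
  rewrite le_eqVlt; apply/orP; left; apply/eqP; congr (`|_|); apply: eq_Rintegral => s _.
  by rewrite ftest_radialE -rmorphM.
have cP : ccont 0 1 (fun s => (h s)%:C).
  apply: (@ccont_ext _ _ _ (fun s => ftest b N n 1 (s * rho)%:C * (rho%:C * ((2 * rho)%:C * s%:C) ^+ m))).
    move=> s _; rewrite ftest_radialE /h !rmorphM rmorphXn !rmorphM; congr (_ * (_ * _ ^+ _)); ring.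
  apply: ccontM.
    apply: (@ccont_comp _ _ _ (ftest b N n 1) (fun s => (s * rho)%:C)) => [s /andP[s0 s1]|].
      apply: ftest_holo; first exact: cabs1.
      by rewrite cabsR ger0_norm ?mulr_ge0 ?(ltW r0) //; apply: le_lt_trans r1; rewrite ler_piMl // ltW.
    apply: (@ccont_ext _ _ _ (fun s => rho%:C * s%:C)) => [s _|]; first by rewrite mulrC rmorphM.
    by apply: ccontM; [exact: ccont_cst|exact: ccont_id].
  apply: ccontM; first exact: ccont_cst.
  by apply: ccontX; apply: ccontM; [exact: ccont_cst|exact: ccont_id].
have [ch _] := ccont_within cP; rewrite /= in ch.
have h0 s : 0 <= s <= 1 -> 0 <= h s.
  move=> /andP[s0 s1]; have q0 : 0 <= s * rho by rewrite mulr_ge0 // ltW.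
  have q1 : s * rho < 1 by apply: le_lt_trans r1; rewrite ler_piMl // ltW.
  rewrite /h; apply: mulr_ge0; last by rewrite mulr_ge0 ?(ltW r0) // exprn_ge0 // mulr_ge0.
  have n0 : (0 < n)%N by exact: ltnW.
  apply: le_trans (ftest_radial_ge N n0 _ q1); last by rewrite rad0.
  by rewrite divr_ge0 ?exprn_ge0 // ltW.
suff H k : (0 < k)%N -> (k <= n)%N ->
    (Sseq p Wd k - b 0) / (2 * 2 ^+ N) <= \int[mu]_(s in `[0, rad k / rho]) h s.
  have := H n (ltnW n1) (leqnn n); rewrite (_ : rad n / rho = 1) //.
  by rewrite divff // gt_eqF.
elim: k => [//|k IH _ kn].
have sk1 : rad k.+1 / rho <= 1 by rewrite ler_pdivrMr // mul1r rad_le.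
have sk0 : 0 <= rad k / rho by rewrite divr_ge0 ?rad_ge0 // ltW.
have skk : rad k / rho <= rad k.+1 / rho by rewrite ler_pM2r ?invr_gt0 // rad_le.
have ck a d : 0 <= a -> d <= 1 -> {within `[a, d], continuous h}.
  move=> a0 d1; have := ccont_within (ccontW a0 d1 cP); by case.
have ge_cst a d (kk : R) : 0 <= a -> a <= d -> d <= 1 -> (forall s, a <= s <= d -> kk <= h s) ->
    kk * (d - a) <= \int[mu]_(s in `[a, d]) h s.
  move=> a0 ad d1 Hk; rewrite -rint_cst //; apply: le_Rintegral => //.
  - by apply: within_integrable; apply: continuous_subspaceT => ?; exact: cvg_cst.
  - by apply: within_integrable; exact: ck.
case: k IH kn sk1 sk0 skk => [|k] IH kn sk1 sk0 skk.
  have -> : Sseq p Wd 1 - b 0 = 0 by rewrite /Sseq big_nat1 expr0 invr1 mulr1 subrr.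
  rewrite mul0r; have := @ge_cst 0 (rad 1 / rho) 0; rewrite mul0r; apply => //.
    by rewrite divr_ge0 ?rad_ge0 // ltW.
  by move=> s /andP[s0 s1]; apply: h0; rewrite s0 /=; exact: le_trans sk1.
rewrite (rint_split sk0 skk); last exact: ck.
have -> : Sseq p Wd k.+2 = Sseq p Wd k.+1 + b k.+1 * 2 ^- k.+1 by rewrite /Sseq big_nat_recr.
have E : (Sseq p Wd k.+1 + b k.+1 * 2 ^- k.+1 - b 0) / (2 * 2 ^+ N) =
    (Sseq p Wd k.+1 - b 0) / (2 * 2 ^+ N) + (b k.+1 / 2 ^+ N * rho) * (rad k.+2 / rho - rad k.+1 / rho).
  rewrite /rad (pow2S k.+1); field.
  by rewrite expf_neq0 // !gt_eqF.
rewrite E; apply: lerD; first exact: (IH isT (ltnW kn)).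
apply: ge_cst; [exact: divr_ge0 (rad_ge0 _) (ltW r0)|exact: skk|exact: sk1|move=> s /andP[hs1 hs2]].
have q1 : rad k.+1 <= s * rho by rewrite -ler_pdivrMr.
have q2 : s * rho < 1.
  by apply: le_lt_trans r1; rewrite ler_piMl ?(ltW r0) //; exact: le_trans sk1.
have q12 : 2^-1 <= s * rho by apply: le_trans q1; rewrite -rad1 rad_le.
rewrite /h; apply: ler_pM; last 1 first.
- rewrite -[leLHS]mulr1; apply: ler_wpM2l; first exact: ltW.
  by apply: exprn_ege1; move: q12; lra.
- by rewrite divr_ge0 ?exprn_ge0 // ltW.
- exact: ltW.
- exact: ftest_radial_ge.
Qed.

End Unbounded.

(** * Bounded operators have constant symbols when [Sseq] is unbounded *)

Section ConstantSymbol.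
Context {R : realType}.
Local Notation C := (Cplx R).
Local Notation mu := (@lebesgue_measure R).

(** Bisection along the segment from 0 to z. The second dimension is a dummy, and the factor v makes
    the increment of g subadditive over quarters. *)
Lemma deriv0_constant (g : C -> C) : (forall z, cabs z < 1 -> cderiv g z 0) -> constant_on_disc g.
Proof.
move=> Hg; exists (g 0) => z /unit_discE z1; apply/eqP; rewrite -subr_eq0 -cabs_eq0 eq_le cabs_ge0 andbT.
pose e (x y u v : R) := v * cabs (g ((x + u)%:C * z) - g (x%:C * z)).
suff : e 0 0 1 1 <= 0 by rewrite /e mul1r add0r !mul1r mul0r.
apply: (@bisection_le0 R e 0 0 1 1) => //.
  move=> x y u v u0 v0 _; rewrite /e addrA.
  set a := g ((x + u + u)%:C * z); set b := g ((x + u)%:C * z); set d := g (x%:C * z).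
  have h : cabs (a - d) <= cabs (a - b) + cabs (b - d).
    by rewrite (_ : a - d = (a - b) + (b - d)) ?cabsD // addrA subrK.
  rewrite (_ : _ + (_ + _) = (v + v) * (cabs (a - b) + cabs (b - d))); last by ring.
  by apply: ler_wpM2l => //; rewrite addr_ge0.
move=> x1 y1; rewrite add0r => /andP[x10 x11] _ eps eps0.
have w1 : cabs (x1%:C * z) < 1.
  by rewrite cabsM cabsR ger0_norm //; apply: le_lt_trans z1; rewrite ler_piMl ?cabs_ge0.
have [d d0 Hd] := Hg _ w1 eps eps0.
exists d => // x y u v [h1 h2 h3 h4] /andP[hx1 hx2] /andP[hy1 hy2] ud vd.
have v0 : 0 <= v by move: hy1 hy2; lra.
have near q : x <= q <= x + u -> cabs (g (q%:C * z) - g (x1%:C * z)) <= eps * `|q - x1|.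
  move=> /andP[q1 q2].
  have E : q%:C * z = x1%:C * z + (q - x1)%:C * z by rewrite -mulrDl -rmorphD addrC subrK.
  have z1' := ltW z1.
  have h : cabs ((q - x1)%:C * z) <= `|q - x1| by rewrite cabsM cabsR ler_piMr.
  have qd : cabs ((q - x1)%:C * z) < d.
    apply: (le_lt_trans h); apply: le_lt_trans ud; rewrite ler_norml; apply/andP; split; lra.
  have := Hd _ qd; rewrite mul0r subr0 -E => /le_trans; apply.
  by apply: ler_wpM2l => //; exact: ltW.
rewrite /e; apply: (@le_trans _ _ (v * (2 * eps * u))).
  apply: ler_wpM2l => //.
  have nx : x <= x <= x + u by apply/andP; split; lra.
  have nu : x <= x + u <= x + u by apply/andP; split; lra.
  have := near _ nx; have := near _ nu.
  rewrite (ger0_norm (_ : 0 <= x + u - x1)) ?(ler0_norm (_ : x - x1 <= 0)); try by lra.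
  move=> k1 k2.
  set A := g _ - _; rewrite (_ : A = (g ((x + u)%:C * z) - g (x1%:C * z)) - (g (x%:C * z) - g (x1%:C * z))).
    apply: (le_trans (cabsB _ _)); apply: (le_trans (lerD k1 k2)).
    rewrite -mulrDr (_ : x + u - x1 - (x - x1) = u); last by ring.
    have u0 : 0 <= u by move: hx1 hx2; lra.
    by have := mulr_ge0 (ltW eps0) u0; rewrite -mulrA; lra.
  by rewrite /A; ring.
rewrite (_ : v * _ = eps * (2 * (u * v))); last by ring.
apply: ler_wpM2l; first exact: ltW.
by rewrite sqrrD addrAC mulr_natl lerDr addr_ge0 ?sqr_ge0.
Qed.

Lemma bergman_integral_ge0 p (w : C -> R) f : (forall z, cabs z < 1 -> 0 <= w z) ->
  (0 <= bergman_integral p w f)%E.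
Proof.
move=> w0; apply: mule_ge0; first by rewrite lee_fin invr_ge0 pi_ge0.
apply: integral_ge0 => u /planar_discE hu; rewrite lee_fin mulr_ge0 ?powR_ge0 //.
exact: w0.
Qed.

Lemma bergman_norm_le p (w : C -> R) f Q : 0 < p -> (forall z, cabs z < 1 -> 0 <= w z) ->
  (bergman_integral p w f <= Q%:E)%E -> bergman_norm p w f <= Q `^ p^-1.
Proof.
move=> p0 w0 h; have h0 := bergman_integral_ge0 p f w0.
rewrite /bergman_norm; case: (bergman_integral p w f) h h0 => [r||] //=.
rewrite !lee_fin => h h0; apply: ge0_ler_powR => //; rewrite ?nnegrE ?invr_ge0 ?(ltW p0) //.
exact: le_trans h.
Qed.

Variables (p K lam c : R) (Wd : nat -> R) (w : C -> R).
Hypotheses (p1 : 1 < p) (K1 : 1 <= K) (lam1 : 1 < lam) (c0 : 0 < c).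
Hypothesis Wd_gt0 : forall m, 0 < Wd m.
Hypothesis Wd_K : forall m, Wd m <= K * Wd m.+1.
Hypothesis Wd_lam : forall m, lam * Wd m.+1 <= Wd m.
Hypothesis w_le : forall m u, annulus m u ->
  0 <= w (u.1 +i* u.2) <= c * Wd m * 2 ^+ m.

(** For each m the test functions give (S_n - b_0) * |a_m| <= const * S_n^(1/p), where a_m is the
    m-th coefficient of g' at radius 1/2. As S_n is unbounded and p > 1, a_m = 0; hence g' = 0. *)
Lemma bounded_constant g : (forall B, exists n, B <= Sseq p Wd n) ->
  analytic g -> T_bounded_to_Hinfty p w g -> constant_on_disc g.
Proof.
move=> Sinf ag [TH [M HM]].
pose G := derive1 (g : C -> C^o).
have dG z : cabs z < 1 -> cderiv g z (G z).
  by move=> z1; apply: derive1_cderiv; apply: ag; exact/unit_discE.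
have hG : holo G by exact: holo_deriv dG.
suff G0 z : cabs z < 1 -> G z = 0.
  by apply: deriv0_constant => z z1; rewrite -(G0 z z1); exact: dG.
move=> z1; apply: (fcoef_eq0 hG) => // m s s0 s1 {z z1}.
rewrite (fcoef_pow m hG (ltW s0) s1); apply/eqP; rewrite mulf_eq0; apply/orP; right.
rewrite -cabs_eq0; apply/negPn/negP => a_neq0.
set al := cabs _ in a_neq0.
have al0 : 0 < al by rewrite lt_neqAle eq_sym a_neq0 cabs_ge0.
have p0 : 0 < p by exact: lt_trans p1.
have w0 z : cabs z < 1 -> 0 <= w z.
  case: z => x y z1; have Du : @planar_disc R (x, y) by apply/planar_discE.
  by have [k hk] := annulus_cover Du; have /andP[] := w_le hk.
have [N HN] : exists N, K `^ (p - 1)^-1 <= 2 ^+ N / 2.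
  exists (Num.bound (K `^ (p - 1)^-1)).+1; rewrite exprSr mulfK //.
  apply: ltW; apply: (lt_trans (archi_boundP (powR_ge0 _ _))).
  by rewrite -natrX ltr_nat ltn_expl.
pose Kc := pi^-1 * (((lam `^ (p - 1)^-1 - 1)^-1 + 4 ^+ N * 2) `^ p *
   (48 * c * K * (lam / (lam - 1))) * (1 + K `^ (p - 1)^-1)).
have key n : (1 < n)%N -> (Sseq p Wd n - bseq p Wd 0) / (2 * 2 ^+ N) * al <=
    4 * pi * (`|M| * (Kc * Sseq p Wd n) `^ p^-1).
  move=> n1; have n0 : (0 < n)%N by exact: ltnW.
  have r12 : 2^-1 <= rad n :> R by rewrite -rad1 rad_le.
  have r0 : 0 < rad n :> R by apply: lt_le_trans r12; rewrite invr_gt0.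
  have r1 : rad n < 1 :> R by exact: rad_lt1.
  apply: le_trans (_ : cabs (cint 0 1 (fun s => ftest (bseq p Wd) N n 1 (s * rad n)%:C * (rad n * (2 * (s * rad n)) ^+ m)%:C)) * al <= _).
    by apply: ler_wpM2r; [exact: ltW|exact: ftest_integral_ge].
  apply: average_le => //.
  - by apply: ftest_holo; exact: cabs1.
  - by rewrite mulr_ge0 // powR_ge0.
  move=> t; pose f := ftest (bseq p Wd) N n (cis t)^-1.
  have a1 : cabs (cis t)^-1 = 1 by rewrite cabsV cabs_cis invr1.
  have nf : (bergman_integral p w f <= (Kc * Sseq p Wd n)%:E)%E.
    apply: le_trans (ftest_norm p1 K1 lam1 c0 Wd_gt0 Wd_K Wd_lam w_le HN t n0) _.
    by rewrite lee_fin /Kc !mulrA.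
  (* On the ray through e^(it) the rotated test function takes the same values for every t, as
     averaging over t requires. *)
  have Ef q : f (q%:C * cis t) = ftest (bseq p Wd) N n 1 q%:C.
    have Ec : q%:C * cis t * (cis t)^-1 = q%:C * 1.
      by rewrite [RHS]mulr1; apply: mulfK; exact: cis_neq0.
    by rewrite /f /ftest; apply: eq_bigr => k _; rewrite Ec.
  have Bf : bergman_space p w f.
    split; first by apply/analyticP; exact: ftest_holo.
    by apply: le_lt_trans nf _; rewrite ltry.
  have z1 : cabs ((rad n)%:C * cis t) < 1 by rewrite cabsM cabs_cis cabsR mulr1 ger0_norm // ltW.
  have := sup_norm_ge (TH f Bf) z1 => h.
  have -> : cint 0 1 (fun s => ftest (bseq p Wd) N n 1 (s * rad n)%:C *
      G ((s * rad n)%:C * cis t) * ((rad n)%:C * cis t)) = volterra g f ((rad n)%:C * cis t).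
    change (volterra g f ((rad n)%:C * cis t)) with (cint 0 1 (fun x => f (x%:C * ((rad n)%:C * cis t)) *
      G (x%:C * ((rad n)%:C * cis t)) * ((rad n)%:C * cis t))).
    by apply: cint_ext => x _; rewrite mulrA -rmorphM Ef.
  apply: le_trans h _; apply: le_trans (HM f Bf) _.
  apply: le_trans (_ : `|M| * bergman_norm p w f <= _).
    by apply: ler_wpM2r; [exact: powR_ge0|exact: ler_norm].
  by apply: ler_wpM2l => //; exact: bergman_norm_le.
have D0 : 0 < 2 * 2 ^+ N :> R by rewrite mulr_gt0 // exprn_gt0.
have [X HX] := powR_sublinear (2 * 2 ^+ N / al * (4 * pi * `|M| * Kc `^ p^-1)) (bseq p Wd 0) p1.
(* The second bound forces n > 1, since [Sseq] at 1 equals [bseq] at 0. *)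
have [n Hn] := Sinf (Num.max X (2 * bseq p Wd 0)).
move: Hn; rewrite ge_max => /andP[n1 n2].
have b0 := bseq_gt0 p Wd_gt0 0.
have n3 : (1 < n)%N.
  case: n n1 n2 => [|[|n]] // _; last by rewrite /Sseq big_nat1 expr0 invr1 mulr1; lra.
  by rewrite /Sseq big_geq //; lra.
have lam0 : 0 < lam by exact: lt_trans lam1.
have Kc0 : 0 <= Kc.
  rewrite /Kc; apply: mulr_ge0; first by rewrite invr_ge0 pi_ge0.
  apply: mulr_ge0; last by rewrite addr_ge0 // powR_ge0.
  apply: mulr_ge0; first exact: powR_ge0.
  apply: mulr_ge0; last by rewrite divr_ge0 ?subr_ge0 // ltW.
  by apply: mulr_ge0; [apply: mulr_ge0 => //; exact: ltW|exact: le_trans ler01 K1].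
have := HX _ n1; have := key n n3.
rewrite powRM //; last exact: Sseq_ge0.
set S := Sseq p Wd n; set y := S `^ p^-1; set k := Kc `^ p^-1.
move=> h1; rewrite ltNge => /negP; apply.
rewrite -(ler_pM2r al0) -(ler_pM2r (_ : 0 < (2 * 2 ^+ N)^-1)) ?invr_gt0 //.
rewrite mulrAC; apply: le_trans h1 _.
rewrite le_eqVlt; apply/orP; left; apply/eqP; field.
by rewrite expf_neq0 // gt_eqF.
Qed.

End ConstantSymbol.

(** * Standard weights with alpha >= p - 2 *)

Section StandardWeight.
Context {R : realType}.
Local Notation C := (Cplx R).
Variables (p alpha : R).
Hypotheses (p1 : 1 < p) (pa : p - 2 <= alpha).

Let beta := 2 `^ (alpha + 1).

Let beta_gt1 : 1 < beta.
Proof.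
have -> : 1 = 1 `^ (alpha + 1) :> R by rewrite powR1.
by apply: gt0_ltr_powR; rewrite ?nnegrE ?ltr1n //; move: (p1) (pa); lra.
Qed.

Let beta_gt0 : 0 < beta. Proof. exact: lt_trans beta_gt1. Qed.

Definition standard_dyadic (m : nat) : R := beta ^- m.

Lemma standard_dyadic_gt0 m : 0 < standard_dyadic m.
Proof. by rewrite invr_gt0 exprn_gt0. Qed.

Lemma standard_dyadicS m : beta * standard_dyadic m.+1 = standard_dyadic m.
Proof. by rewrite /standard_dyadic exprS invfM mulrA divff ?mul1r // gt_eqF. Qed.

(** The k-th term is (beta^(1/(p-1)) / 2)^k, which is at least 1 because (alpha + 1) / (p - 1) >=
    1. *)
Lemma standard_Sseq n : n%:R <= Sseq p standard_dyadic n.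
Proof.
have p10 : 0 < p - 1 by rewrite subr_gt0.
elim: n => [|n IH]; first by rewrite /Sseq big_geq.
have -> : Sseq p standard_dyadic n.+1 = Sseq p standard_dyadic n + bseq p standard_dyadic n * 2 ^- n.
  by rewrite /Sseq big_nat_recr.
rewrite -natr1; apply: lerD => //.
rewrite ler_pdivlMr ?exprn_gt0 // mul1r /bseq /standard_dyadic.
have -> : (beta ^- n) `^ (- (p - 1)^-1) = (beta `^ (p - 1)^-1) ^+ n.
  by rewrite -!powR_mulrn ?powR_ge0 ?(ltW beta_gt0) // -powRN -!powRrM; congr (_ `^ _); ring.
apply: lerXn2r; rewrite ?nnegrE ?powR_ge0 //.
rewrite -powRrM -[leLHS]powRr1 //; apply: ler_powR; first by rewrite ler1n.
by rewrite ler_pdivlMr //; move: (pa); lra.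
Qed.

Lemma standard_dyadic_pow m : standard_dyadic m * 2 ^+ m = (2 ^- m) `^ alpha.
Proof.
rewrite /standard_dyadic -!powR_mulrn ?(ltW beta_gt0) //.
rewrite -!powRN -!powRrM -powRD; last by rewrite pnatr_eq0 implybT.
by congr (_ `^ _); ring.
Qed.

(** On the annulus 1 - |z|^2 = x * 2^-m with 1/2 <= x <= 2, and 2^|alpha| bounds x^alpha for either
    sign of alpha. *)
Lemma standard_weight_le m (u : R * R) : annulus m u ->
  0 <= standard_weight alpha (u.1 +i* u.2 : C) <= 2 `^ `|alpha| * standard_dyadic m * 2 ^+ m.
Proof.
move=> /andP[]; set r := cabs _ => r1 r2; rewrite /standard_weight -/r powR_ge0 /=.
have r0 : 0 <= r by exact: cabs_ge0.
have e0 := @pow2_gt0 R m; have e1 := @pow2S R m.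
rewrite -mulrA standard_dyadic_pow.
pose x := (1 - r ^+ 2) / 2 ^- m.
have -> : 1 - r ^+ 2 = x * 2 ^- m by rewrite /x mulfVK // gt_eqF.
have E : 1 - r ^+ 2 = (1 - r) * (1 + r) by ring.
move: r1 r2; rewrite /rad => r1 r2.
have x1 : 2^-1 <= x.
  rewrite /x ler_pdivlMr // E; apply: (@le_trans _ _ ((1 - r) * 1)); first by move: r2 e1; lra.
  by apply: ler_wpM2l; move: r2 e1 e0; lra.
have x2 : x <= 2.
  rewrite /x ler_pdivrMr // E mulrC; apply: ler_pM; move: r2 r1 r0 e1 e0; lra.
rewrite powRM ?(ltW e0) //; last by move: x1; lra.
apply: ler_wpM2r; first exact: powR_ge0.
have [a0|a0] := leP 0 alpha.
  by rewrite (ger0_norm a0); apply: ge0_ler_powR => //; rewrite nnegrE //; move: x1; lra.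
rewrite -[x]invrK -powR_inv1; last by rewrite invr_ge0; move: x1; lra.
rewrite (ltr0_norm a0) -powRrM mulN1r; apply: ge0_ler_powR; rewrite ?nnegrE ?invr_ge0 //.
- by rewrite oppr_ge0 ltW.
- by move: x1; lra.
- by rewrite -[leRHS]invrK lef_pV2 ?posrE ?invr_gt0 //; move: x1; lra.
Qed.

(** Stated for every weight below a multiple of the standard profile, so that it also serves the
    identically zero weight. *)
Lemma standard_constant (c : R) (w : C -> R) g : 0 < c ->
  (forall m u, annulus m u -> 0 <= w (u.1 +i* u.2) <= c * standard_dyadic m * 2 ^+ m) ->
  analytic g -> T_bounded_to_Hinfty p w g -> constant_on_disc g.
Proof.
move=> c0 Hw; apply: (@bounded_constant R p beta beta c standard_dyadic w) => //.
- exact: ltW.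
- exact: standard_dyadic_gt0.
- by move=> m; rewrite standard_dyadicS.
- by move=> m; rewrite standard_dyadicS.
move=> B; exists (Num.bound `|B|); apply: le_trans (standard_Sseq _).
exact: le_trans (ler_norm B) (ltW (archi_boundP (normr_ge0 B))).
Qed.

End StandardWeight.

(** * Regular weights at the dyadic radii *)

Section RegularWeight.
Context {R : realType}.
Local Notation C := (Cplx R).
Local Notation mu := (@lebesgue_measure R).

(** What regularity gives when [Wd m] is the tail integral from [rad m]. Its values are only
    nonnegative, because the zero weight is regular. *)
Record dyadic_weight (w : C -> R) (Wd : nat -> R) (K c1 c2 : R) : Prop := DyadicWeight {
  dyadic_K : 1 <= K;
  dyadic_c1 : 0 < c1;
  dyadic_c2 : 0 < c2;
  dyadic_ge0 : forall m, 0 <= Wd m;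
  dyadic_le : forall m, Wd m <= K * Wd m.+1;
  dyadic_ge : forall m, (1 + c1 / 2) * Wd m.+1 <= Wd m;
  dyadic_radial : radial w;
  dyadic_bounds : forall m t, rad m <= t -> t < rad m.+1 ->
    c1 * Wd m.+1 <= (1 - t) * w t%:C <= c2 * Wd m }.

(** The doubling condition gives the ratio bound K. For the opposite bound put s = (1 + r) / 2: on
    [r, s), of length (1 - r) / 2, the weight is at least c1 * W s / (1 - r), which adds c1 / 2 * W
    s to the tail from s. *)
Lemma regular_dyadic (w : C -> R) : regular_weight w ->
  exists Wd K c1 c2, dyadic_weight w Wd K c1 c2.
Proof.
move=> [[w0 _] wr [K K1 HK] [c1 [c2 [c10 c20 Hc]]]].
have w0r t : 0 <= t -> t < 1 -> 0 <= w t%:C.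
  by move=> t0 t1; apply: w0; apply/unit_discE; rewrite cabsR ger0_norm.
have oh0 r : 0 <= r -> (0 <= omega_hat w r)%E.
  move=> r0; apply: integral_ge0 => s /=; rewrite in_itv /= => /andP[rs s1].
  by rewrite lee_fin w0r //; exact: le_trans rs.
pose W r := fine (omega_hat w r).
(* The tail integral is finite because c1 times it lies below the real number w r * (1 - r). *)
have ohE r : 0 <= r -> r < 1 -> omega_hat w r = (W r)%:E.
  move=> r0 r1; have := Hc r; rewrite r0 r1 => /(_ isT) /andP[h _].
  have := oh0 r r0; move: h; rewrite /W; case: (omega_hat w r) => [x||] //=.
  by rewrite gt0_muley ?lte_fin.
have W0 r : 0 <= r -> r < 1 -> 0 <= W r.
  by move=> r0 r1; rewrite -lee_fin -ohE // oh0.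
have Wmono r s : 0 <= r -> r <= s -> s < 1 -> W s <= W r.
  move=> r0 rs s1; have s0 : 0 <= s by exact: le_trans rs.
  have r1 : r < 1 by exact: le_lt_trans s1.
  rewrite -lee_fin -!ohE //; apply: integral_mono => // x /=; rewrite !in_itv /=.
  - by move=> /andP[h ->]; rewrite andbT; exact: le_trans h.
  - by move=> /andP[h h1]; rewrite lee_fin w0r //; exact: le_trans h.
  - by move=> /andP[h h1]; rewrite lee_fin w0r //; exact: le_trans h.
have WK r : 0 <= r -> r < 1 -> W r <= K * W ((1 + r) / 2).
  move=> r0 r1; have h0 : 0 <= (1 + r) / 2 by lra.
  have h1 : (1 + r) / 2 < 1 by lra.
  rewrite -lee_fin EFinM -!ohE //; apply: HK; by rewrite r0.
have Wc r : 0 <= r -> r < 1 -> c1 * W r <= (1 - r) * w r%:C <= c2 * W r.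
  move=> r0 r1; have := Hc r; rewrite r0 r1 => /(_ isT).
  by rewrite ohE // -!EFinM !lee_fin (mulrC (1 - r)).
have Wlam r : 0 <= r -> r < 1 -> (1 + c1 / 2) * W ((1 + r) / 2) <= W r.
  move=> r0 r1; set s := (1 + r) / 2.
  have s1 : s < 1 by rewrite /s; lra.
  have rs : r < s by rewrite /s; lra.
  have s0 : 0 <= s by exact: le_trans (ltW rs).
  have k0 : 0 <= c1 * W s / (1 - r).
    by apply: divr_ge0; [apply: mulr_ge0; [exact: ltW|exact: W0]|rewrite subr_ge0 ltW].
  have mA : mu `[r, s[%classic = (s - r)%:E by rewrite lebesgue_measure_itv /= lte_fin rs -EFinB.
  have : ((c1 * W s / (1 - r))%:E * mu `[r, s[%classic + (W s)%:E <= (W r)%:E)%E; last first.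
    rewrite mA -EFinM -EFinD lee_fin; apply: le_trans.
    rewrite (_ : s - r = (1 - r) / 2); last by rewrite /s; field.
    rewrite le_eqVlt; apply/orP; left; apply/eqP; field.
    by move: r1; rewrite -subr_gt0 => /gt_eqF ->.
  rewrite -(ohE s s0 s1) -(ohE r r0 r1); apply: integral_split_ge.
  - by move=> x /=; rewrite !in_itv /= => /andP[-> h]; exact: lt_trans s1.
  - by move=> x /=; rewrite !in_itv /= => /andP[h ->]; rewrite andbT; exact: le_trans (ltW rs) h.
  - by move=> x /=; rewrite !in_itv /= => /andP[_ h] /andP[h' _]; move: h h'; lra.
  - exact: measurable_itv.
  - by have : (mu `[r, s[%classic < +oo)%E by rewrite mA ltry.
  - exact: k0.
  - by move=> x /=; rewrite in_itv /= => /andP[h h1]; rewrite lee_fin w0r //; exact: le_trans h.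
  - move=> x /=; rewrite in_itv /= => /andP[h h1]; rewrite lee_fin.
    have x0 : 0 <= x by exact: le_trans h.
    have x1 : x < 1 by exact: lt_trans s1.
    have /andP[hc _] := Wc x x0 x1.
    rewrite ler_pdivrMr ?subr_gt0 //.
    apply: (@le_trans _ _ (c1 * W x)).
      by apply: ler_wpM2l; [exact: ltW|apply: Wmono => //; exact: ltW].
    apply: (le_trans hc); rewrite mulrC; apply: ler_wpM2l; first exact: w0r.
    by move: h; lra.
exists (fun m => W (rad m)), K, c1, c2; split => //.
- by move=> m; apply: W0; [exact: rad_ge0|exact: rad_lt1].
- by move=> m; rewrite -radS; apply: WK; [exact: rad_ge0|exact: rad_lt1].
- by move=> m; rewrite -radS; apply: Wlam; [exact: rad_ge0|exact: rad_lt1].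
move=> m t rt tr; have r0 := @rad_ge0 R m; have r1 := @rad_lt1 R m.+1.
have t0 : 0 <= t by exact: le_trans rt.
have t1 : t < 1 by exact: lt_trans r1.
have /andP[h1 h2] := Wc t t0 t1; apply/andP; split.
  apply: le_trans h1; apply: ler_wpM2l; first exact: ltW.
  by apply: Wmono => //; exact: ltW.
apply: (le_trans h2); apply: ler_wpM2l; first exact: ltW.
exact: Wmono.
Qed.

Section Dyadic.
Variables (w : C -> R) (Wd : nat -> R) (K c1 c2 : R).
Hypothesis H : dyadic_weight w Wd K c1 c2.

Lemma dyadic_annulus m u : annulus m u ->
  c1 * Wd m.+1 * 2 ^+ m <= w (u.1 +i* u.2) <= 2 * c2 * Wd m * 2 ^+ m.
Proof.
move=> hm; have /andP[h1 h2] := hm.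
have /planar_discE u1 := annulus_disc hm.
rewrite (dyadic_radial H); last exact/unit_discE.
set t := cabs _ in h1 h2 u1 *.
have /andP[b1 b2] := dyadic_bounds H h1 h2.
have e0 := @pow2_gt0 R m; have eS := @pow2S R m.
have P0 : 0 < 2 ^+ m :> R by rewrite exprn_gt0.
have w0 : 0 <= w t%:C.
  have : 0 <= (1 - t) * w t%:C.
    by apply: le_trans b1; apply: mulr_ge0; [exact: ltW (dyadic_c1 H)|exact: dyadic_ge0 H _].
  by rewrite pmulr_rge0 // subr_gt0.
move: h1 h2; rewrite /rad => h1 h2; apply/andP; split.
  rewrite -ler_pdivlMr //; apply: (le_trans b1); rewrite mulrC; apply: ler_wpM2l => //.
  by move: h1; lra.
rewrite -ler_pdivrMr // -[leRHS]mulrA.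
apply: (@le_trans _ _ (2 * ((1 - t) * w t%:C))); last first.
  by apply: ler_wpM2l.
rewrite mulrC mulrA; apply: ler_wpM2r => //; move: h2 eS; lra.
Qed.

Lemma dyadic_weight_ge0 z : cabs z < 1 -> 0 <= w z.
Proof.
case: z => x y z1; have Du : @planar_disc R (x, y) by apply/planar_discE.
have [k hk] := annulus_cover Du; have /andP[h _] := dyadic_annulus hk.
apply: le_trans h; rewrite !mulr_ge0 ?exprn_ge0 // ?(dyadic_ge0 H) //.
exact: ltW (dyadic_c1 H).
Qed.

(** The two ratio bounds propagate a zero downwards and upwards. *)
Lemma dyadic_zero k : Wd k = 0 -> forall m, Wd m = 0.
Proof.
move=> k0.
have c10 := dyadic_c1 H.
have up n : Wd n = 0 -> Wd n.+1 = 0.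
  move=> n0; apply/eqP; rewrite eq_le (dyadic_ge0 H) andbT.
  by have := dyadic_ge H n; rewrite n0 pmulr_rle0 //; move: c10; lra.
have down n : Wd n.+1 = 0 -> Wd n = 0.
  move=> n0; apply/eqP; rewrite eq_le (dyadic_ge0 H) andbT.
  by have := dyadic_le H n; rewrite n0 mulr0.
have W0 : Wd 0 = 0 by elim: k k0 => // k IH /down /IH.
by elim=> // m /up.
Qed.

Lemma dyadic_zero_weight k : Wd k = 0 -> forall z, cabs z < 1 -> w z = 0.
Proof.
move=> /dyadic_zero Z [x y] z1; have Du : @planar_disc R (x, y) by apply/planar_discE.
have [j hj] := annulus_cover Du; have := dyadic_annulus hj.
by rewrite !Z !mulr0 !mul0r => h; apply/eqP; rewrite eq_le andbC.
Qed.

End Dyadic.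

End RegularWeight.

(** * The integral condition as divergence of [Sseq] *)

Section IntegralCondition.
Context {R : realType}.
Local Notation C := (Cplx R).
Local Notation mu := (@lebesgue_measure R).

Lemma rad_cover (t : R) : 0 <= t -> t < 1 -> exists m, rad m <= t < rad m.+1.
Proof.
move=> t0 t1; have Du : @planar_disc R (t, 0).
  by apply/planar_discE; rewrite (cabsR t) ger0_norm.
have [m] := annulus_cover Du; rewrite /annulus /= (cabsR t) ger0_norm //.
by exists m.
Qed.

Lemma rad_itv_measure m : mu `[rad m, rad m.+1[%classic = (2 ^- m.+1)%:E.
Proof.
have eS := @pow2S R m; have e0 := @pow2_gt0 R m.+1.
rewrite lebesgue_measure_itv /= lte_fin ifT; last by rewrite /rad; lra.
by rewrite -EFinB /rad; congr EFin; move: eS; lra.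
Qed.

Variables (p : R) (w : C -> R) (Wd : nat -> R) (K c1 c2 : R).
Hypothesis p1 : 1 < p.
Hypothesis H : dyadic_weight w Wd K c1 c2.

Let q := (p - 1)^-1.
Let q_gt0 : 0 < q. Proof. by rewrite invr_gt0 subr_gt0. Qed.
(** The inverse is taken in the extended reals, where 1/0 = +oo, so a vanishing weight makes the
    integrand infinite. *)
Let F (t : R) : \bar R := (((((1 - t) * w t%:C) `^ q)%R%:E)^-1)%E.

Let F_ge0 t : (0 <= F t)%E.
Proof. by rewrite inve_ge0 lee_fin powR_ge0. Qed.

Lemma integral_condition_zero k : Wd k = 0 ->
  (\int[mu]_(t in `]0%R, 1%R[) F t = +oo)%E.
Proof.
move=> /(dyadic_zero_weight H) w0.
rewrite (eq_integral (fun=> +oo%E)); last first.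
  move=> t; rewrite inE /= in_itv /= => /andP[t0 t1].
  rewrite /F w0; last by rewrite cabsR ger0_norm // ltW.
  by rewrite mulr0 powR0 ?gt_eqF // inve0.
rewrite integral_cst //= lebesgue_measure_itv /= lte_fin ltr01.
by rewrite -EFinB subr0 gt0_mulye // lte_fin.
Qed.

Hypothesis Wd_gt0 : forall m, 0 < Wd m.

Let c10 : 0 < c1 := dyadic_c1 H.
Let c20 : 0 < c2 := dyadic_c2 H.
Let b := bseq p Wd.
Let b_gt0 m : 0 < b m. Proof. exact: bseq_gt0. Qed.

Let F_bounds m t : rad m <= t -> t < rad m.+1 ->
  ((c2 `^ (- q) * b m)%:E <= F t)%E /\ (F t <= (c1 `^ (- q) * b m.+1)%:E)%E.
Proof.
move=> h1 h2; have /andP[l1 l2] := dyadic_bounds H h1 h2.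
set x := (1 - t) * _ in l1 l2.
have x0 : 0 < x by apply: lt_le_trans l1; rewrite mulr_gt0.
have xq : 0 < x `^ q by exact: powR_gt0.
have E : F t = ((x `^ q)^-1)%:E by rewrite /F inver gt_eqF.
have bE k : b k = (Wd k `^ q)^-1 by rewrite /b /bseq powRN.
rewrite E !bE !powRN -!invfM !lee_fin -!powRM ?(ltW c10) ?(ltW c20) ?(ltW (Wd_gt0 _)) //.
have y1 : 0 < c1 * Wd m.+1 by rewrite mulr_gt0.
have y2 : 0 < c2 * Wd m by rewrite mulr_gt0.
by split; rewrite lef_pV2 ?posrE ?powR_gt0 //; apply: ge0_ler_powR => //; rewrite ?nnegrE; exact: ltW.
Qed.

(** On [r_k, r_{k+1}), of length 2^-(k+1), F is at least c2^(-q) * b k; such pieces are added one at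
    a time by [integral_split_ge]. *)
Lemma integral_condition_infinite : (forall B, exists n, B <= Sseq p Wd n) ->
  (\int[mu]_(t in `]0%R, 1%R[) F t = +oo)%E.
Proof.
move=> Sinf; apply/eqyP => A A0.
pose A' := c2 `^ (- q) / 2.
have A'0 : 0 < A' by rewrite divr_gt0 // powR_gt0.
have step n k : ((A' * \sum_(k <= j < k + n) b j * 2 ^- j)%:E <=
    \int[mu]_(t in `[rad k, 1%R[) F t)%E.
  elim: n k => [|n IH] k.
    rewrite addn0 big_geq // mulr0; exact: integral_ge0.
  rewrite addnS -addSn big_ltn ?mulrDr ?EFinD; last by rewrite addSn ltnS leq_addr.
  have b0 : 0 <= c2 `^ (- q) * b k by rewrite mulr_ge0 ?powR_ge0 // ltW.
  have rk := @rad_le R k k.+1 (leqnSn k); have r1 := @rad_lt1 R k.+1.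
  have : ((c2 `^ (- q) * b k)%:E * mu `[rad k, rad k.+1[%classic +
     \int[mu]_(t in `[rad k.+1, 1%R[) F t <= \int[mu]_(t in `[rad k, 1%R[) F t)%E.
    apply: integral_split_ge => //.
    - by move=> x /=; rewrite !in_itv /= => /andP[-> h]; exact: lt_trans r1.
    - by move=> x /=; rewrite !in_itv /= => /andP[h ->]; rewrite andbT; exact: le_trans rk h.
    - by move=> x /=; rewrite !in_itv /= => /andP[_ h] /andP[h' _]; move: h h'; lra.
    - by have : (mu `[rad k, rad k.+1[%classic < +oo)%E by rewrite rad_itv_measure ltry.
    - by move=> x /=; rewrite in_itv /= => /andP[h h']; have [] := F_bounds h h'.
  apply: le_trans; rewrite rad_itv_measure; apply: leeD; last exact: IH.
  rewrite -EFinM lee_fin /A' (@pow2S R k) le_eqVlt; apply/orP; left; apply/eqP; field.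
  by rewrite expf_neq0.
(* The pieces are used from k = 1 on, which keeps them inside the open interval; b 0 makes up for
   the missing one. *)
have [n Hn] := Sinf (A / A' + b 0).
case: n Hn => [|n] Hn.
  exfalso; move: Hn; rewrite /Sseq big_geq //.
  have b0 := b_gt0 0; have d0 : 0 < A / A' by rewrite divr_gt0.
  by move=> h; move: (lt_le_trans (addr_gt0 d0 b0) h); rewrite ltxx.
apply: (@le_trans _ _ (A' * \sum_(1 <= j < 1 + n) b j * 2 ^- j)%:E).
  rewrite lee_fin mulrC -ler_pdivrMr //; move: Hn.
  by rewrite /Sseq big_ltn // expr0 invr1 mulr1 -/b addrC lerD2l add1n.
apply: (le_trans (step n 1%N)); apply: integral_mono => // x /=; rewrite !in_itv /=.
by rewrite rad1 => /andP[h ->]; rewrite andbT; apply: lt_le_trans h; rewrite invr_gt0.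
Qed.

(** If the sums stayed below B, then F would lie below the step function with value c1^(-q) * b m.+1
    on [r_m, r_{m+1}), whose integral is at most c1^(-q) * B. *)
Lemma integral_condition_unbounded :
  (\int[mu]_(t in `]0%R, 1%R[) F t = +oo)%E -> forall B, exists n, B <= Sseq p Wd n.
Proof.
move=> Fi B; apply: contrapT => /forallNP SB.
have {}SB n : Sseq p Wd n <= B by apply: ltW; rewrite ltNge; apply/negP/SB.
pose A' := c1 `^ (- q).
have A'0 : 0 <= A' by exact: powR_ge0.
pose G (m : nat) (t : R) : \bar R := (A' * b m.+1 * \1_(`[rad m, rad m.+1[%classic) t)%:E.
have G0 m t : (0 <= G m t)%E by rewrite lee_fin mulr_ge0 // mulr_ge0 // ltW.
have mG m : measurable_fun (`[0, 1[%classic : set R) (G m).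
  by apply/measurable_EFinP; apply: measurable_funM => //; apply: measurable_indic; exact: measurable_itv.
suff : (\int[mu]_(t in `]0%R, 1%R[) F t <= (A' * B)%:E)%E by rewrite Fi leye_eq.
apply: (@le_trans _ _ (\int[mu]_(t in `[0%R, 1%R[) (\sum_(0 <= m <oo) G m t))%E).
  apply: integral_mono => // t /=; rewrite ?in_itv /=.
  - by move=> /andP[/ltW -> ->].
  - by move=> _; apply: nneseries_ge0 => m _ _; exact: G0.
  move=> /andP[t0 t1]; have [m hm] := rad_cover (ltW t0) t1.
  have /andP[h1 h2] := hm; have [_ hF] := F_bounds h1 h2.
  apply: (@le_trans _ _ (G m t)).
    by rewrite /G indicE mem_set /= ?in_itv /= ?h1 // mulr1.
  apply: le_trans (nneseries_lim_ge m.+1 _); last by move=> k _ _; exact: G0.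
  by rewrite big_nat_recr //= leeDr // sume_ge0 // => k _; exact: G0.
rewrite integral_nneseries //.
apply: nneseries_le => [m|n]; first by apply: integral_ge0 => t _; exact: G0.
apply: (@le_trans _ _ (\sum_(0 <= m < n) (A' * (b m.+1 * 2 ^- m.+1))%:E)%E).
  apply: lee_sum => m _.
  rewrite /G; under eq_integral do rewrite EFinM.
  rewrite ge0_integralZl //; last 2 first.
  - by apply/measurable_EFinP; apply: measurable_indic; exact: measurable_itv.
  - by rewrite lee_fin mulr_ge0 // ltW.
  rewrite integral_indic //.
  rewrite mulrA [in leRHS]EFinM -rad_itv_measure.
  apply: lee_wpmul2l; first by rewrite lee_fin mulr_ge0 // ltW.
  by apply: le_measure; rewrite ?inE //; apply: measurableI => //; exact: measurable_itv.
rewrite sumEFin lee_fin -mulr_sumr; apply: ler_wpM2l => //.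
apply: le_trans (SB n.+1); rewrite /Sseq big_nat_recl // -/b lerDr.
by rewrite mulr_ge0 // ltW.
Qed.

End IntegralCondition.

(** * Pointwise bounds from weighted mass on nearby annuli *)

Section AnnulusGrowth.
Context {R : realType}.
Local Notation C := (Cplx R).
Local Notation mu2 := (@lebesgue_measure R \x @lebesgue_measure R)%E.
Local Notation M2 := (measurableTypeR R * measurableTypeR R)%type.

Lemma square_near z (r : R) u : square z r u -> cabs ((u.1 +i* u.2 : C) - z) <= 2 * r.
Proof.
case: u => x y; rewrite /square /= !in_itv /= => -[/andP[h1 h2] /andP[h3 h4]].
apply: (le_trans (cabs_le_ReIm _)); rewrite cReD cReN cImD cImN /= mulr2n mulrDl mul1r.
by apply: lerD; rewrite ler_norml; apply/andP; split; lra.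
Qed.

Lemma annulus_inj j k (u : R * R) : annulus j u -> annulus k u -> j = k.
Proof.
move=> /andP[j1 j2] /andP[k1 k2]; apply/eqP; rewrite eqn_leq; apply/andP; split.
  rewrite leqNgt; apply/negP => h; have := @rad_le R _ _ h.
  by move: (lt_le_trans k2 (le_trans (@rad_le R _ _ h) j1)); rewrite ltxx.
rewrite leqNgt; apply/negP => h.
by move: (lt_le_trans j2 (le_trans (@rad_le R _ _ h) k1)); rewrite ltxx.
Qed.

Let near_index j k : (k <= j.+1)%N -> (j <= k.+1)%N -> j = k.-1 \/ j = k \/ j = k.+1.
Proof. lia. Qed.

Let sum3 (a b c x : R) : 0 <= a -> 0 <= b -> 0 <= c ->
  x <= a \/ x <= b \/ x <= c -> x <= a + b + c.
Proof. by move=> a0 b0 c0 [h|[h|h]]; lra. Qed.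

Variables (p : R) (w : C -> R) (Wd : nat -> R) (K c1 c2 : R).
Hypothesis p1 : 1 < p.
Hypothesis H : dyadic_weight w Wd K c1 c2.
Hypothesis Wd_gt0 : forall m, 0 < Wd m.

Let p0 : 0 < p. Proof. exact: lt_trans p1. Qed.
Let c10 : 0 < c1 := dyadic_c1 H.
Let K1 : 1 <= K := dyadic_K H.

(** The lower bound for the weight on annulus j. Using it in place of the weight makes [mass]
    measurable. *)
Let nu (j : nat) : R := c1 * Wd j.+1 * 2 ^+ j.

Let nu_gt0 j : 0 < nu j.
Proof. by rewrite !mulr_gt0 // exprn_gt0. Qed.

Let mass (f : C -> C) (j : nat) (u : R * R) : R :=
  nu j * (cabs (f (u.1 +i* u.2)) `^ p * \1_(@annulus R j) u).

Let mass_ge0 f j u : 0 <= mass f j u.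
Proof. by rewrite mulr_ge0 ?(ltW (nu_gt0 j)) // mulr_ge0 // powR_ge0. Qed.

Let mass_measurable f j : holo f ->
  measurable_fun (@planar_disc R : set M2) (fun u : M2 => (mass f j u)%:E).
Proof.
move=> Hf; apply/measurable_EFinP; apply: measurable_funM => //.
apply: measurable_funM; last by apply: measurable_indic; exact: annulus_measurable.
exact: measurableT_comp (measurable_powR p) (holo_cabs_measurable Hf).
Qed.

Let mass_sum f n u : @planar_disc R u ->
  \sum_(0 <= j < n) mass f j u <= cabs (f (u.1 +i* u.2)) `^ p * w (u.1 +i* u.2).
Proof.
move=> Du; have [m hm] := annulus_cover Du.
have /andP[wm _] := dyadic_annulus H hm.
have zero j : j != m -> mass f j u = 0.
  move=> jm; rewrite /mass indicE memNset ?mulr0 // => hj.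
  by move: jm; rewrite (annulus_inj hj hm) eqxx.
have one : mass f m u <= cabs (f (u.1 +i* u.2)) `^ p * w (u.1 +i* u.2).
  rewrite /mass indicE mem_set // mulr1 mulrC; apply: ler_wpM2l; first exact: powR_ge0.
  exact: wm.
have [nm|mn] := leqP n m.
  rewrite big_nat_cond big1 => [|j /andP[/andP[_ jn] _]].
    exact: le_trans (mass_ge0 f m u) one.
  by apply: zero; rewrite neq_ltn (leq_trans jn nm).
have min : m \in index_iota 0 n by rewrite mem_index_iota.
rewrite (bigD1_seq m min (iota_uniq _ _)) /= big1 ?addr0 //.
Qed.

(** The annuli are disjoint, so the masses add up to at most the integral over the disc; pi undoes
    the normalization of area. *)
Lemma annulus_masses (f : C -> C) (Q : R) : holo f ->
  (bergman_integral p w f <= Q%:E)%E -> exists e : nat -> R,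
  [/\ forall j, 0 <= e j, forall n, \sum_(0 <= j < n) e j <= pi * Q &
      forall j, (\int[mu2]_(u in @planar_disc R) (mass f j u)%:E = (e j)%:E)%E].
Proof.
move=> Hf HQ; pose I j := (\int[mu2]_(u in @planar_disc R) (mass f j u)%:E)%E.
have I0 j : (0 <= I j)%E by apply: integral_ge0 => u _; rewrite lee_fin.
have IQ n : (\sum_(0 <= j < n) I j <= (pi * Q)%:E)%E.
  rewrite /I -(@ge0_integral_sum _ _ _ mu2 _ planar_disc_measurable _ (fun j u => (mass f j u)%:E)
    (fun j => mass_measurable j Hf)); last by move=> j u _; rewrite lee_fin.
  apply: (@le_trans _ _ (\int[mu2]_(u in @planar_disc R)
    (cabs (f (u.1 +i* u.2)) `^ p * w (u.1 +i* u.2))%:E)%E).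
    apply: integral_mono => // u Du.
    - rewrite lee_fin mulr_ge0 ?powR_ge0 //; apply: (dyadic_weight_ge0 H).
      exact/planar_discE.
    - by apply: sume_ge0 => j _; rewrite lee_fin.
    - by rewrite sumEFin lee_fin; exact: mass_sum.
  move: HQ; rewrite /bergman_integral /area_integral; set J := integral _ _ _ => HQ.
  have -> : J = (pi%:E * ((pi^-1)%:E * J))%E.
    by rewrite muleA -EFinM divff ?mul1e // gt_eqF // pi_gt0.
  by rewrite [leRHS]EFinM; apply: lee_wpmul2l => //; rewrite lee_fin pi_ge0.
have Ifin j : I j = (fine (I j))%:E.
  rewrite fineK // ge0_fin_numE //; apply: le_lt_trans (ltry (pi * Q)).
  apply: le_trans (IQ j.+1); rewrite big_nat_recr //= leeDr // sume_ge0 //.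
exists (fun j => fine (I j)); split => //.
- by move=> j; exact: fine_ge0.
- move=> n; rewrite -lee_fin -sumEFin; apply: le_trans (IQ n).
  by rewrite le_eqVlt; apply/orP; left; apply/eqP; apply: eq_bigr => j _; rewrite -Ifin.
Qed.

Let Wd_mono i j : (i <= j)%N -> Wd j <= Wd i.
Proof.
elim: j => [|j IH]; first by rewrite leqn0 => /eqP ->.
rewrite leq_eqVlt => /predU1P[-> //|]; rewrite ltnS => /IH; apply: le_trans.
apply: le_trans (dyadic_ge H j); rewrite ler_peMl ?(ltW (Wd_gt0 _)) //.
by rewrite lerDl divr_ge0 // ltW.
Qed.

(** A square about z of side comparable to 2^-k lies in the annuli k - 1, k and k + 1, where the
    weight is at least of order 2^k W_k. The mean value inequality costs 4^k, so 2^k / W_k remains.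
    For k = 0 the index [k.-1] repeats 0, which only enlarges the bound. *)
Lemma shell_bound : exists2 A : R, 0 < A & forall (f : C -> C) (e : nat -> R) k z, holo f ->
  (forall j, (\int[mu2]_(u in @planar_disc R) (mass f j u)%:E = (e j)%:E)%E) ->
  rad k <= cabs z < rad k.+1 ->
  cabs (f z) `^ p <= A * (2 ^+ k / Wd k) * (e k.-1 + e k + e k.+1).
Proof.
have [K0 K00 HK0] := area_mean_pow (ltW p1).
exists (K0 * 256 * (2 * K ^+ 2 / c1)).
  have KK : 0 < K ^+ 2 by rewrite exprn_gt0 // (lt_le_trans ltr01).
  by apply: mulr_gt0; [apply: mulr_gt0 K00 _; rewrite ltr0n|rewrite divr_gt0 // mulr_gt0].
move=> f e k z Hf He /andP[z1 z2].
(* The square has half-side 2 * eta, so its points lie within 4 * eta = 2^-(k+2) of z; this keeps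
   them below [rad k.+2]. *)
pose eta : R := 2 ^- (k + 4); have eta0 : 0 < eta by exact: pow2_gt0.
have eta4 : 4 * eta = 2 ^- k.+2.
  by rewrite /eta (@pow2S R k.+2) (@pow2S R k.+3) !addnS addn0; ring.
have e1 := @pow2S R k; have e2 := @pow2S R k.+1; have e3 := @pow2_gt0 R k.+2.
have hz : cabs z + 2 * (2 * eta) < 1 by move: z2 eta4; rewrite /rad; lra.
have sq u : square z (2 * eta) u -> rad k.-1 <= cabs (u.1 +i* u.2 : C) < rad k.+2.
  move=> /square_near hu.
  have hu1 := cabs_subl z (z - (u.1 +i* u.2 : C)).
  have hu2 := cabsD ((u.1 +i* u.2 : C) - z) z.
  rewrite subrK in hu2; rewrite subKr cabs_distC in hu1.
  apply/andP; split; last by move: hu hu2 z2 eta4; rewrite /rad; lra.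
  have [->|->] : k = 0%N \/ rad k.-1 = rad k - 2 ^- k :> R.
    case: (k) => [|k']; [by left|right].
    by rewrite /= /rad (@pow2S R k'); ring.
  - by rewrite rad0 cabs_ge0.
  - by move: z1 hu hu1 e1 e2 eta4; lra.
(* A common lower bound for [nu] on the three annuli: two doubling steps cost K ^+ 2, and the inner
   annulus costs the factor 2. *)
pose m : R := c1 * Wd k / K ^+ 2 * 2 ^+ k / 2.
have KK : 0 < K ^+ 2 by rewrite exprn_gt0 // (lt_le_trans ltr01).
have m0 : 0 < m by rewrite /m !mulr_gt0 ?invr_gt0 // exprn_gt0.
have nu_m j : (k <= j.+1)%N -> (j <= k.+1)%N -> m <= nu j.
  move=> kj jk; rewrite /m /nu -(mulrA (_ / _)); apply: ler_pM.
  - by rewrite !mulr_ge0 ?invr_ge0 // ltW.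
  - by rewrite divr_ge0 ?exprn_ge0.
  - rewrite -mulrA; apply: ler_wpM2l; first exact: ltW.
    rewrite ler_pdivrMr //; apply: (@le_trans _ _ (Wd k.+2 * K ^+ 2)).
      rewrite mulrC expr2 -mulrA; apply: (le_trans (dyadic_le H k)).
      apply: ler_wpM2l; first exact: le_trans ler01 K1.
      exact: dyadic_le H _.
    by apply: ler_wpM2r; [exact: ltW|exact: Wd_mono].
  - rewrite ler_pdivrMr // -exprSr; apply: ler_weXn2l => //; exact: ler1n.
have := HK0 f z eta Hf eta0 hz; set J := integral _ _ _ => HJ.
have mJ : (m%:E * J <= (e k.-1 + e k + e k.+1)%:E)%E.
  have mh : measurable_fun (square z (2 * eta) : set M2) (fun u : M2 => (cabs (f (u.1 +i* u.2)) `^ p)%:E).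
    apply/measurable_EFinP.
    apply: (measurable_funS planar_disc_measurable (square_in_disc _ hz)).
      by rewrite mulr_ge0 // ltW.
    exact: measurableT_comp (measurable_powR p) (holo_cabs_measurable Hf).
  rewrite /J -ge0_integralZl //; last 3 first.
  - exact: square_measurable.
  - by move=> u _; rewrite lee_fin powR_ge0.
  - by rewrite lee_fin ltW.
  rewrite !EFinD -!He.
  rewrite -ge0_integralD //; last 5 first.
  - exact: planar_disc_measurable.
  - by move=> u _; rewrite lee_fin.
  - exact: mass_measurable.
  - by move=> u _; rewrite lee_fin.
  - exact: mass_measurable.
  rewrite -ge0_integralD //; last 5 first.
  - exact: planar_disc_measurable.
  - by move=> u _; rewrite adde_ge0 // lee_fin.
  - by apply: emeasurable_funD; exact: mass_measurable.
  - by move=> u _; rewrite lee_fin.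
  - exact: mass_measurable.
  apply: integral_mono => [||u _|u hu].
  - by apply: square_in_disc => //; rewrite mulr_ge0 // ltW.
  - by move=> u _; rewrite !adde_ge0 // lee_fin.
  - by rewrite -EFinM lee_fin mulr_ge0 ?powR_ge0 // ltW.
  have Du : @planar_disc R u.
    by apply/planar_discE; have /andP[_ h] := sq u hu; exact: lt_trans h (rad_lt1 _).
  have [j hj] := annulus_cover Du.
  have /andP[j1 j2] := hj; have /andP[s1 s2] := sq u hu.
  have jk : (k <= j.+1)%N.
    case: (k) s1 => [//|k'] /= s1; rewrite ltnS leqNgt; apply/negP => h.
    by move: (lt_le_trans j2 (le_trans (@rad_le R _ _ h) s1)); rewrite ltxx.
  have kj : (j <= k.+1)%N.
    rewrite leqNgt; apply/negP => h.
    by move: (lt_le_trans s2 (le_trans (@rad_le R _ _ h) j1)); rewrite ltxx.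
  have mj : m * cabs (f (u.1 +i* u.2)) `^ p <= mass f j u.
    rewrite /mass indicE mem_set // mulr1; apply: ler_wpM2r; first exact: powR_ge0.
    exact: nu_m.
  rewrite -EFinM -!EFinD lee_fin.
  have g1 := mass_ge0 f k.-1 u; have g2 := mass_ge0 f k u; have g3 := mass_ge0 f k.+1 u.
  have [E|[E|E]] : j = k.-1 \/ j = k \/ j = k.+1.
  - exact: near_index jk kj.
  - by rewrite E in mj; apply: (sum3 g1 g2 g3); left.
  - by rewrite E in mj; apply: (sum3 g1 g2 g3); right; left.
  - by rewrite E in mj; apply: (sum3 g1 g2 g3); right; right.
have J0 : (0 <= J)%E by apply: integral_ge0 => u _; rewrite lee_fin powR_ge0.
have kap0 : 0 <= K0 / eta ^+ 2 / m by apply: divr_ge0; [apply: divr_ge0; rewrite ?exprn_ge0 // ltW|exact: ltW].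
rewrite -lee_fin; apply: (le_trans HJ).
rewrite (_ : K0 / eta ^+ 2 = (K0 / eta ^+ 2 / m) * m); last by rewrite mulfVK // gt_eqF.
rewrite EFinM -muleA; apply: (@le_trans _ _ ((K0 / eta ^+ 2 / m)%:E * (e k.-1 + e k + e k.+1)%:E)%E).
  by apply: lee_wpmul2l.
rewrite -EFinM lee_fin le_eqVlt; apply/orP; left; apply/eqP; congr (_ * _).
have P0 : 2 ^+ k != 0 :> R by rewrite expf_neq0.
rewrite /m /eta exprD; field.
by rewrite P0 (gt_eqF c10) (gt_eqF (Wd_gt0 k)) (gt_eqF (lt_le_trans ltr01 K1)).
Qed.

End AnnulusGrowth.

(** * Summable growth of functions and of their primitives *)

Section PrimitiveGrowth.
Context {R : realType}.
Local Notation C := (Cplx R).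

(** With x_k = b_k 2^-k one has (2^k)^p x_k^(p-1) = 2^k / W_k, so the shell bound reads |f|^p <=
    (2^k)^p A0 Q x_k^(p-1) (E_k / Q), and x^(p-1) y <= (x + y)^p splits the product. The x_k sum to
    at most B by hypothesis, and the E_k / Q to at most 4 pi. *)
Lemma annulus_growth p (w : C -> R) (Wd : nat -> R) (K c1 c2 B : R) : 1 < p ->
  dyadic_weight w Wd K c1 c2 -> (forall m, 0 < Wd m) -> (forall n, Sseq p Wd n <= B) ->
  exists2 A : R, 0 < A & forall (f : C -> C) Q, holo f -> 0 < Q ->
    (bergman_integral p w f <= Q%:E)%E -> exists y : nat -> R,
    [/\ forall k, 0 <= y k,
        forall k z, rad k <= cabs z < rad k.+1 -> cabs (f z) <= 2 ^+ k * y k &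
        forall n, \sum_(0 <= k < n) y k <= A * Q `^ p^-1].
Proof.
move=> p1 H Wd0 SB; have p0 : 0 < p by exact: lt_trans p1.
have [A0 A00 HA] := shell_bound p1 H Wd0.
have B0 : 0 <= B by apply: le_trans (SB 0%N); rewrite /Sseq big_geq.
have pi0 := @pi_gt0 R.
exists (A0 `^ p^-1 * (B + 4 * pi)).
  by apply: mulr_gt0; [exact: powR_gt0|rewrite ltr_wpDl // mulr_gt0].
move=> f Q Hf Q0 HQ.
have [e [e0 eS eI]] := annulus_masses H Wd0 Hf HQ.
pose E k := e k.-1 + e k + e k.+1.
have E0 k : 0 <= E k by rewrite !addr_ge0.
pose b := bseq p Wd; have b0 k : 0 < b k by exact: bseq_gt0.
pose x k := b k * 2 ^- k; have x0 k : 0 < x k by rewrite mulr_gt0.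
pose y k := (A0 * Q) `^ p^-1 * (x k + E k / Q).
have s0 k : 0 < x k + E k / Q by rewrite ltr_wpDr // divr_ge0 // ltW.
have y0 k : 0 <= y k by rewrite /y mulr_ge0 ?powR_ge0 // ltW.
exists y; split => // [k z hz|n].
- rewrite leNgt; apply/negP => h.
  have k2 : 0 < 2 ^+ k :> R by rewrite exprn_gt0.
  have : (2 ^+ k * y k) `^ p < cabs (f z) `^ p.
    by apply: gt0_ltr_powR => //; rewrite nnegrE ?cabs_ge0 // mulr_ge0 // ltW.
  apply/negP; rewrite -leNgt; apply: (le_trans (HA f e k z Hf eI hz)); rewrite -/(E k).
  rewrite powRM ?(ltW k2) // /y powRM ?powR_ge0 ?(ltW (s0 k)) //.
  rewrite -powRrM mulVf ?gt_eqF // powRr1; last by rewrite mulr_ge0 // ltW.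
  set s := x k + E k / Q; have sp : 0 < s := s0 k.
  have h1 : x k `^ (p - 1) * (E k / Q) <= s `^ p.
    have -> : s `^ p = s `^ (p - 1) * s.
      rewrite -[X in _ = _ * X](powRr1 (ltW sp)) -powRD; last by rewrite (gt_eqF sp) implybT.
      by congr (_ `^ _); ring.
    apply: ler_pM; rewrite ?powR_ge0 ?divr_ge0 ?(ltW Q0) //.
      apply: ge0_ler_powR; rewrite ?nnegrE ?subr_ge0 ?(ltW p1) ?(ltW (x0 k)) ?(ltW (s0 k)) //.
      by rewrite /s lerDl divr_ge0 // ltW.
    by rewrite /s lerDr ltW.
  have h2 : (2 ^+ k) `^ p * x k `^ (p - 1) = 2 ^+ k / Wd k.
    rewrite /x powRM ?(ltW (b0 k)) //.
    have -> : b k `^ (p - 1) = (Wd k)^-1.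
      rewrite /b /bseq -powRrM mulNr mulVf ?powR_inv1 ?(ltW (Wd0 k)) //.
      by rewrite gt_eqF // subr_gt0.
    rewrite mulrCA mulrC; congr (_ * _).
    rewrite -[2 ^- k]powR_inv1 ?(ltW k2) // -powRrM -powRD; last by rewrite (gt_eqF k2) implybT.
    by rewrite (_ : p + -1 * (p - 1) = 1) ?powRr1 ?(ltW k2) //; ring.
  rewrite -h2 (_ : A0 * _ * _ = (2 ^+ k) `^ p * (A0 * Q * (x k `^ (p - 1) * (E k / Q)))).
    apply: ler_wpM2l; first exact: powR_ge0.
    by apply: ler_wpM2l => //; rewrite mulr_ge0 // ltW.
  by field; rewrite gt_eqF.
rewrite /y -mulr_sumr powRM ?(ltW A00) ?(ltW Q0) // -mulrA [leRHS]mulrAC -mulrA.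
rewrite [leRHS](mulrC (_ `^ _)) -?mulrA.
have : \sum_(0 <= k < n) (x k + E k / Q) <= B + 4 * pi.
  rewrite big_split /=; apply: lerD; first exact: SB.
  rewrite -mulr_suml ler_pdivrMr // /E !big_split /=.
  have s1 : \sum_(0 <= k < n) e k.-1 <= 2 * (pi * Q).
    case: n => [|n]; first by rewrite big_geq // mulr_ge0 // mulr_ge0 // ltW.
    rewrite big_nat_recl //= mulr2n mulrDl mul1r; apply: lerD => //.
    by have := eS 1%N; rewrite big_nat1.
  have s3 : \sum_(0 <= k < n) e k.+1 <= pi * Q.
    by apply: le_trans (eS n.+1); rewrite big_nat_recl // lerDr.
  by have := eS n; move: s1 s3; rewrite -(mulrA 4); lra.
move=> h; rewrite (_ : A0 `^ p^-1 * _ = A0 `^ p^-1 * Q `^ p^-1 * \sum_(0 <= k < n) (x k + E k / Q)); last by ring.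
rewrite (_ : _ * (_ * _) = A0 `^ p^-1 * Q `^ p^-1 * (B + 4 * pi)); last by ring.
by apply: ler_wpM2l => //; rewrite mulr_ge0 // powR_ge0.
Qed.

(** Between r_n z and r_{n+1} z the primitive changes by at most a length 2^-(n+1) times a bound for
    |f|, itself a sum of 2^k y_k. In the double sum each y_k receives a geometric series of total
    4. *)
Lemma primitive_increments (f : C -> C) (y : nat -> R) Y : holo f ->
  (forall k, 0 <= y k) ->
  (forall k z, rad k <= cabs z < rad k.+1 -> cabs (f z) <= 2 ^+ k * y k) ->
  (forall n, \sum_(0 <= k < n) y k <= Y) ->
  exists u : nat -> R, [/\ forall n, 0 <= u n, forall n, \sum_(0 <= k < n) u k <= 4 * Y &
    forall n z, cabs z <= 1 ->
      cabs (primitive f ((rad n.+1)%:C * z) - primitive f ((rad n)%:C * z)) <= u n].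
Proof.
move=> Hf y0 Hy HY; pose M n := \sum_(0 <= k < n.+1) 2 ^+ k * y k.
have t0 k : 0 <= 2 ^+ k * y k by rewrite mulr_ge0 // exprn_ge0.
have M0 n : 0 <= M n by rewrite sumr_ge0.
have HM n z : cabs z < rad n.+1 -> cabs (f z) <= M n.
  move=> hz; have z1 : cabs z < 1 by exact: lt_trans hz (rad_lt1 _).
  have [k /andP[h1 h2]] := rad_cover (cabs_ge0 z) z1.
  have kn : (k < n.+1)%N.
    rewrite ltnNge; apply/negP => nk.
    by move: (lt_le_trans hz (le_trans (@rad_le R _ _ nk) h1)); rewrite ltxx.
  apply: (le_trans (Hy k z _)); first by rewrite h1.
  have kin : k \in index_iota 0 n.+1 by rewrite mem_index_iota.
  by rewrite /M (bigD1_seq k kin (iota_uniq _ _)) /= lerDl sumr_ge0.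
(* The index n.+1 is needed because the endpoint may have modulus r_{n+1}; writing 2^-n in place of
   2^-(n+1) absorbs the factor 2 of [cint_le]. *)
exists (fun n => 2 ^- n * M n.+1); split.
- by move=> n; rewrite mulr_ge0 // ltW // pow2_gt0.
(* The added term is what the y_k with k <= n still contribute to the rest of the series. *)
- move=> n; suff : \sum_(0 <= k < n) 2 ^- k * M k.+1 + 2 * (2 ^- n * M n) <= 4 * \sum_(0 <= k < n.+1) y k.
    move=> h; have := HY n.+1; have : 0 <= 2 ^- n * M n by rewrite mulr_ge0 // ltW // pow2_gt0.
    by move: h; lra.
  elim: n => [|n IH].
    rewrite big_geq // /M !big_nat1 expr0 invr1; have := y0 0%N; lra.
  rewrite big_nat_recr //= [X in _ <= 4 * X]big_nat_recr //=.
  have -> : M n.+1 = M n + 2 ^+ n.+1 * y n.+1 by rewrite /M big_nat_recr.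
  have E : 2 ^- n * (2 ^+ n.+1 * y n.+1) = 2 * y n.+1.
    by rewrite exprS; field; rewrite expf_neq0.
  have := @pow2S R n; have : 2 ^- n.+1 * (2 ^+ n.+1 * y n.+1) = y n.+1.
    by rewrite mulrA mulVf ?mul1r // expf_neq0.
  rewrite !mulrDr E => -> e1.
  have e2 : 2 ^- n * M n = 2 * (2 ^- n.+1 * M n) by rewrite e1; ring.
  by move: IH; rewrite e2; lra.
move=> n z z1; have e0 := @pow2_gt0 R n; have e1 := @pow2S R n.
have e2 := @pow2_gt0 R n.+1; have e3 := @pow2S R n.+1; have e4 := @pow2_gt0 R n.+2.
pose k := (2 ^- n.+1)%:C * z.
have Ek : (rad n.+1)%:C * z = (rad n)%:C * z + k.
  by rewrite /k -mulrDl -rmorphD; congr (_%:C * _); rewrite /rad; lra.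
have ck : cabs k <= 2 ^- n.+1 by rewrite /k cabsM cabsR gtr0_norm // ler_piMr // ltW.
have cr m : cabs ((rad m)%:C * z) < 1.
  rewrite cabsM cabsR ger0_norm ?rad_ge0 //; apply: le_lt_trans (@rad_lt1 R m).
  by rewrite ler_piMr // rad_ge0.
have cz t : 0 <= t <= 1 -> cabs ((rad n)%:C * z + t%:C * k) < rad n.+2.
  move=> /andP[h0 h1]; apply: (le_lt_trans (cabsD _ _)).
  have k1 : cabs ((rad n)%:C * z) <= rad n by rewrite cabsM cabsR ger0_norm ?rad_ge0 // ler_piMr // rad_ge0.
  have k2 : cabs (t%:C * k) <= 2 ^- n.+1.
    by rewrite cabsM cabsR ger0_norm //; apply: le_trans ck; rewrite ler_piMl // cabs_ge0.
  by move: k1 k2; rewrite /rad; lra.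
rewrite Ek primitive_diff // -?Ek // cabsM.
apply: (@le_trans _ _ (2 ^- n.+1 * (2 * M n.+1 * (1 - 0)))).
  apply: ler_pM; rewrite ?cabs_ge0 //; apply: cint_le => //; last first.
    by move=> t ht; apply: HM; exact: cz.
  apply: (@ccont_comp _ _ _ f (fun t => (rad n)%:C * z + t%:C * k)) => [t ht|].
    by apply: Hf; exact: lt_trans (cz t ht) (rad_lt1 _).
  apply: ccontD; first exact: ccont_cst.
  by apply: ccontM; [exact: ccont_id|exact: ccont_cst].
by rewrite subr0 mulr1 mulrCA mulrA -e1.
Qed.

End PrimitiveGrowth.

(** * Continuous extension of primitives to the closed disc *)

Section DiscAlgebra.
Context {R : realType}.
Local Notation C := (Cplx R).

Lemma within_closed_discP (G : C -> C) : {within closed_unit_disc, continuous G} <->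
  (forall z, cabs z <= 1 -> forall e : R, 0 < e -> exists2 d : R, 0 < d &
    forall w, cabs w <= 1 -> cabs (w - z) < d -> cabs (G w - G z) <= e).
Proof.
split.
- move=> /subspace_continuousP H z z1 e e0.
  have zc : closed_unit_disc z by exact/closed_unit_discE.
  have e0' : (0 : C) < e%:C by rewrite ltc0R.
  have /cvgrPdist_le /(_ _ e0') := H z zc.
  move=> [d d0 Hd]; have [r r0 dr] := gt0_complexE d0; exists r => // w w1 wr.
  have := Hd w; rewrite /ball_ /= normE dr ltcR (cabs_distC z w) => /(_ wr).
  by move=> /(_ (proj2 (closed_unit_discE w) w1)); rewrite normE lecR cabs_distC.
move=> H; apply/subspace_continuousP => z /closed_unit_discE z1.
apply/cvgrPdist_le => e /gt0_complexE[r r0 ->].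
have [d d0 Hd] := H z z1 r r0.
exists d%:C; first by rewrite /= ltc0R.
move=> w /=; rewrite normE ltcR cabs_distC => wd /closed_unit_discE w1.
by rewrite normE lecR cabs_distC; exact: Hd.
Qed.

(** With U the partial sums of u, the sequence a + U increases and a - U decreases, which gives the
    limit and the rate at once; the right-hand side is the tail of the series. *)
Lemma limit_of_increments (a u : nat -> R) T :
  (forall n, `|a n.+1 - a n| <= u n) -> (forall n, \sum_(0 <= k < n) u k <= T) ->
  exists l, forall n, `|l - a n| <= sup (range (fun n => \sum_(0 <= k < n) u k)) - \sum_(0 <= k < n) u k.
Proof.
move=> Ha HT; pose U n := \sum_(0 <= k < n) u k; set L := sup _.
have US n : U n.+1 = U n + u n by rewrite /U big_nat_recr.
have UL n : U n <= L.
  by apply: ub_le_sup; [exists T => _ [k _ <-]; exact: HT|exists n].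
pose c n := a n + U n.
have cS n : c n <= c n.+1.
  by rewrite /c US; have := Ha n; rewrite ler_norml => /andP[]; lra.
have cm n m : (n <= m)%N -> c n <= c m.
  elim: m => [|m IH]; first by rewrite leqn0 => /eqP ->.
  rewrite leq_eqVlt => /predU1P[-> //|]; rewrite ltnS => /IH h.
  exact: le_trans h (cS m).
pose d n := a n - U n.
have dS n : d n.+1 <= d n.
  by rewrite /d US; have := Ha n; rewrite ler_norml => /andP[]; lra.
have dm n m : (n <= m)%N -> d m <= d n.
  elim: m => [|m IH]; first by rewrite leqn0 => /eqP ->.
  rewrite leq_eqVlt => /predU1P[-> //|]; rewrite ltnS => /IH h.
  exact: le_trans (dS m) h.
have cu n k : c k <= d n + 2 * L.
  have [nk|kn] := leqP n k.
    by have := dm _ _ nk; have := UL k; rewrite /c /d; lra.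
  by have := cm _ _ (ltnW kn); have := UL n; rewrite /c /d; lra.
exists (sup (range c) - L) => n.
have s1 : c n <= sup (range c).
  by apply: ub_le_sup; [exists (d 0%N + 2 * L) => _ [k _ <-]; exact: cu|exists n].
have s2 : sup (range c) <= d n + 2 * L.
  by apply: ge_sup; [exists (c 0%N); exists 0%N|move=> _ [k _ <-]; exact: cu].
rewrite -/(U n) ler_norml; apply/andP; move: s1 s2; rewrite /c /d; split; lra.
Qed.

Lemma uniform_limit (Fn : nat -> C -> C) (u : nat -> R) T :
  (forall n z, cabs z <= 1 -> cabs (Fn n.+1 z - Fn n z) <= u n) ->
  (forall n, \sum_(0 <= k < n) u k <= T) ->
  exists G : C -> C, forall e, 0 < e -> exists n0, forall n z, (n0 <= n)%N -> cabs z <= 1 ->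
    cabs (G z - Fn n z) <= e.
Proof.
move=> HF HT; pose U n := \sum_(0 <= k < n) u k; pose L := sup (range U).
have [G HG] : exists G : C -> C, forall z, cabs z <= 1 -> forall n, cabs (G z - Fn n z) <= 2 * (L - U n).
  suff /choice[G HG] : forall z, exists l : C, cabs z <= 1 -> forall n, cabs (l - Fn n z) <= 2 * (L - U n).
    by exists G.
  move=> z; have [z1|z1] := leP (cabs z) 1; last by exists 0.
  have [|x Hx] := @limit_of_increments (fun n => Re (Fn n z)) u T _ HT.
    by move=> n; rewrite -cReN -cReD; exact: le_trans (Re_le _) (HF n z z1).
  have [|y Hy] := @limit_of_increments (fun n => Im (Fn n z)) u T _ HT.
    by move=> n; rewrite -cImN -cImD; exact: le_trans (Im_le _) (HF n z z1).
  exists (x +i* y) => _ n; apply: (le_trans (cabs_le_ReIm _)).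
  by rewrite cReD cReN cImD cImN /= mulr2n mulrDl mul1r; apply: lerD; [exact: Hx|exact: Hy].
exists G => e e0.
have u0 n : 0 <= u n by apply: le_trans (HF n 0 _); rewrite ?cabs_ge0 // cabs0.
have Um n m : (n <= m)%N -> U n <= U m.
  by move=> nm; rewrite /U (@big_cat_nat _ _ _ n 0 m) //= lerDl sumr_ge0.
have hs : has_sup (range U) by split; [exists (U 0%N); exists 0%N|exists T => _ [k _ <-]; exact: HT].
have e2 : 0 < e / 2 by rewrite divr_gt0.
have [_ [n0 _ <-] Hn] := sup_adherent e2 hs; exists n0 => n z nn z1.
apply: (le_trans (HG z z1 n)); have := Um _ _ nn; move: Hn; rewrite -/L; lra.
Qed.

Lemma sup_norm_le (f : C -> C) M : (forall z, cabs z < 1 -> cabs (f z) <= M) -> sup_norm f <= M.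
Proof.
move=> h; apply: ge_sup; last by move=> _ [z /unit_discE z1 <-]; exact: h.
by exists (cabs (f 0)), 0 => //; apply/unit_discE; rewrite cabs0.
Qed.

(** The dilates z -> primitive f (r_n z) are continuous on the closed disc and converge uniformly
    there, so the limit is the required extension. Telescoping from primitive f 0 = 0 gives the
    bound. *)
Lemma primitive_disc_algebra (f : C -> C) (y : nat -> R) Y : holo f ->
  (forall k, 0 <= y k) ->
  (forall k z, rad k <= cabs z < rad k.+1 -> cabs (f z) <= 2 ^+ k * y k) ->
  (forall n, \sum_(0 <= k < n) y k <= Y) ->
  disc_algebra (primitive f) /\ (forall z, cabs z < 1 -> cabs (primitive f z) <= 4 * Y).
Proof.
move=> Hf y0 Hy HY; have [u [u0 uS Hu]] := primitive_increments Hf y0 Hy HY.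
have hp : holo (primitive f) by move=> z z1; exists (f z); exact: primitive_cderiv.
have [G HG] := uniform_limit Hu uS.
have r0 n := @rad_ge0 R n; have r1 n := @rad_lt1 R n.
have cr n (z : C) : cabs z <= 1 -> cabs ((rad n)%:C * z) < 1.
  move=> z1; have e1 := r0 n; have e2 := r1 n; rewrite cabsM cabsR ger0_norm //.
  by apply: le_lt_trans e2; rewrite ler_piMr.
have radlim (z : C) (e : R) : cabs z < 1 -> 0 < e -> exists n0, forall n, (n0 <= n)%N ->
    cabs (primitive f ((rad n)%:C * z) - primitive f z) <= e.
  move=> z1 e0; have [d d0 Hd] := holo_cont hp z1 e0.
  exists (Num.bound d^-1) => n nn; apply: Hd.
  rewrite (_ : _ - z = - ((2 ^- n)%:C * z)); last by rewrite /rad rmorphB rmorph1; ring.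
  have e1 := @pow2_gt0 R n.
  rewrite cabsN cabsM cabsR gtr0_norm //; apply: (@le_lt_trans _ _ (2 ^- n)).
    by rewrite ler_piMr // ltW.
  rewrite -[ltRHS]invrK ltf_pV2 ?posrE ?exprn_gt0 ?invr_gt0 //.
  apply: (lt_le_trans (archi_boundP _)); first by rewrite invr_ge0 ltW.
  by rewrite -natrX ler_nat (leq_trans nn) // ltnW // ltn_expl.
have GE (z : C) : cabs z < 1 -> G z = primitive f z.
  move=> z1; apply/eqP; rewrite -subr_eq0 -cabs_eq0 eq_le cabs_ge0 andbT.
  apply/ler_addgt0Pl => e e0; rewrite addr0.
  have e2 : 0 < e / 2 by rewrite divr_gt0.
  have [n1 H1] := HG _ e2; have [n2 H2] := radlim z _ z1 e2.
  have := H1 (maxn n1 n2) z (leq_maxl _ _) (ltW z1).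
  have := H2 (maxn n1 n2) (leq_maxr _ _).
  set v := primitive f _ => k2 k1.
  rewrite (_ : G z - _ = (G z - v) + (v - primitive f z)); last by rewrite addrA subrK.
  by apply: (le_trans (cabsD _ _)); lra.
split.
  split; first exact/analyticP.
  exists G; last by move=> z /unit_discE; exact: GE.
  apply/within_closed_discP => z z1 e e0.
  have e3 : 0 < e / 3 by rewrite divr_gt0.
  have [n /(_ n) Hn] := HG _ e3.
  have [d d0 Hd] := holo_cont hp (cr n z z1) e3.
  exists d => // v v1 vd.
  have k1 := Hn z (leqnn n) z1; have k2 := Hn v (leqnn n) v1.
  have k3 : cabs (primitive f ((rad n)%:C * v) - primitive f ((rad n)%:C * z)) <= e / 3.
    apply: Hd; rewrite -mulrBr cabsM cabsR ger0_norm //; apply: le_lt_trans vd.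
    by rewrite ler_piMl ?cabs_ge0 // ltW.
  rewrite (_ : G v - G z = (G v - primitive f ((rad n)%:C * v)) +
    (primitive f ((rad n)%:C * v) - primitive f ((rad n)%:C * z)) - (G z - primitive f ((rad n)%:C * z))); last by ring.
  apply: (le_trans (cabsB _ _)); have := cabsD (G v - primitive f ((rad n)%:C * v))
    (primitive f ((rad n)%:C * v) - primitive f ((rad n)%:C * z)).
  by lra.
move=> z z1; apply/ler_addgt0Pl => e e0.
have [n /(_ n (leqnn n)) Hn] := radlim z e z1 e0.
have P0 : primitive f 0 = 0.
  transitivity (cint 0 1 (fun=> 0 : C)); last by rewrite cint_cst // mulr0.
  by apply: cint_ext => t _; rewrite mulr0.
have hn m : cabs (primitive f ((rad m)%:C * z)) <= \sum_(0 <= k < m) u k.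
  elim: m => [|m IH].
    by rewrite big_geq // rad0 mul0r P0 cabs0.
  rewrite big_nat_recr //=.
  have := Hu m z (ltW z1); set v := primitive f _; set v' := primitive f _.
  have := cabsD (v - v') v'; rewrite subrK => h1 h2; move: h1 h2 IH; rewrite -/v'; lra.
have := uS n; have := hn n; have := cabsB (primitive f ((rad n)%:C * z)) (primitive f ((rad n)%:C * z) - primitive f z).
rewrite subKr; lra.
Qed.

End DiscAlgebra.

(** * Boundedness for constant symbols and for the identity *)

Section Boundedness.
Context {R : realType}.
Local Notation C := (Cplx R).

(** Compactness through bisection of [-1, 1]^2, with error 1 on a rectangle where G is unbounded on
    the disc and 0 otherwise. *)
Lemma closed_disc_bounded (G : C -> C) : {within closed_unit_disc, continuous G} ->
  exists M : R, forall z, cabs z <= 1 -> cabs (G z) <= M.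
Proof.
move=> /within_closed_discP HG.
pose bnd (x y u v : R) := exists M : R, forall a b, x <= a <= x + u -> y <= b <= y + v ->
  cabs (a +i* b : C) <= 1 -> cabs (G (a +i* b)) <= M.
pose e (x y u v : R) : R := if `[< bnd x y u v >] then 0 else 1.
have e_ge0 x y u v : 0 <= e x y u v by rewrite /e; case: ifP.
have : e (-1) (-1) 2 2 <= 0.
  apply: (@bisection_le0 R e (-1) (-1) 2 2) => //.
    move=> x y u v u0 v0 _.
    have [h1|h1] := pselect (bnd x y u v); last first.
      rewrite {2}/e (asboolF h1); apply: (@le_trans _ _ 1).
        by rewrite /e; case: ifP.
      by rewrite -addrA lerDl !addr_ge0.
    have [h2|h2] := pselect (bnd (x + u) y u v); last first.
      rewrite {3}/e (asboolF h2); apply: (@le_trans _ _ 1).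
        by rewrite /e; case: ifP.
      by rewrite addrAC lerDr !addr_ge0.
    have [h3|h3] := pselect (bnd x (y + v) u v); last first.
      rewrite {4}/e (asboolF h3); apply: (@le_trans _ _ 1).
        by rewrite /e; case: ifP.
      by rewrite addrCA lerDl !addr_ge0.
    have [h4|h4] := pselect (bnd (x + u) (y + v) u v); last first.
      rewrite {5}/e (asboolF h4); apply: (@le_trans _ _ 1).
        by rewrite /e; case: ifP.
      by rewrite !addrA lerDr !addr_ge0.
    rewrite {1}/e asboolT ?addr_ge0 //.
    have [M1 H1] := h1; have [M2 H2] := h2; have [M3 H3] := h3; have [M4 H4] := h4.
    exists (Num.max (Num.max M1 M2) (Num.max M3 M4)) => a b /andP[a1 a2] /andP[b1 b2] ab.
    have aa := ltP (x + u) a; have bb := ltP (y + v) b.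
    rewrite !le_max; case: bb => bb; case: aa => aa.
    - by rewrite H4 ?orbT //; apply/andP; split; lra.
    - by rewrite H3 ?orbT //; apply/andP; split; lra.
    - by rewrite H2 ?orbT //; apply/andP; split; lra.
    - by rewrite H1 ?orbT //; apply/andP; split; lra.
  move=> a0 b0 _ _ eps eps0.
  suff [d d0 Hd] : exists2 d : R, 0 < d & exists M, forall z, cabs z <= 1 ->
      cabs (z - (a0 +i* b0)) < d -> cabs (G z) <= M.
    exists (d / 2); first by rewrite divr_gt0.
    move=> x y u v _ /andP[x1 x2] /andP[y1 y2] ud vd.
    rewrite /e asboolT; first by apply: mulr_ge0; [exact: ltW|exact: sqr_ge0].
    have [M HM] := Hd; exists M => a b /andP[h1 h2] /andP[h3 h4] ab; apply: HM => //.
    have := @box_cabs R (a0, b0) (a, b) (d / 2); rewrite mulrCA divff // mulr1; apply.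
    by split => /=; rewrite ltr_norml; apply/andP; split; lra.
  have [z1|z1] := leP (cabs (a0 +i* b0 : C)) 1.
    have [d d0 Hd] := HG _ z1 1 ltr01; exists d => //.
    exists (cabs (G (a0 +i* b0)) + 1) => z zz zd.
    have := cabsD (G z - G (a0 +i* b0)) (G (a0 +i* b0)); rewrite subrK.
    by have := Hd z zz zd; lra.
  exists (cabs (a0 +i* b0 : C) - 1); first by rewrite subr_gt0.
  exists 0 => z zz zd; exfalso; have := cabs_subl (a0 +i* b0 : C) z.
  by rewrite cabs_distC; lra.
rewrite /e; case: asboolP => [[M HM] _|_]; last by rewrite ler10.
exists M => -[a b] z1; apply: HM => //.
  have := le_trans (Re_le (a +i* b)) z1; rewrite /= ler_norml => /andP[h1 h2].
  by apply/andP; split; lra.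
have := le_trans (Im_le (a +i* b)) z1; rewrite /= ler_norml => /andP[h1 h2].
by apply/andP; split; lra.
Qed.

Lemma disc_algebra_Hinfty (f : C -> C) : disc_algebra f -> Hinfty f.
Proof.
move=> [af [G /closed_disc_bounded[M HM] GE]]; split => //; exists M => z zd.
by rewrite -GE //; apply: HM; apply: ltW; exact/unit_discE.
Qed.

Lemma bounded_disc_algebra_Hinfty p (w : C -> R) g :
  T_bounded_to_disc_algebra p w g -> T_bounded_to_Hinfty p w g.
Proof. by move=> [H1 H2]; split => // f /H1; exact: disc_algebra_Hinfty. Qed.

Lemma constant_bounded p (w : C -> R) g : constant_on_disc g ->
  T_bounded_to_disc_algebra p w g /\ T_bounded_to_Hinfty p w g.
Proof.
move=> [c gc].
suff H : T_bounded_to_disc_algebra p w g by split => //; exact: bounded_disc_algebra_Hinfty.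
have dg z : cabs z < 1 -> derive1 (g : C -> C^o) z = 0.
  move=> z1; have z1' : 0 < 1 - cabs z by rewrite subr_gt0.
  suff : cderiv g z 0 by case/cderiv_derivable.
  apply: cderiv_ext z1' _ (cderiv_cst c z) => v hv; rewrite gc //; apply/unit_discE.
  by have := cabsD (v - z) z; rewrite subrK; lra.
have v0 f z : cabs z < 1 -> volterra g f z = 0.
  move=> z1; transitivity (cint 0 1 (fun=> 0 : C)); last by rewrite cint_cst // mulr0.
  apply: cint_ext => t /andP[t0 t1]; rewrite dg ?mulr0 ?mul0r //.
  rewrite cabsM cabsR ger0_norm //; apply: le_lt_trans z1.
  by rewrite ler_piMl // cabs_ge0.
split; last first.
  exists 0 => f _; rewrite mul0r; apply: sup_norm_le => z z1.
  by rewrite v0 // cabs0.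
move=> f _; split.
  apply/analyticP => z z1; exists 0; have z1' : 0 < 1 - cabs z by rewrite subr_gt0.
  apply: cderiv_ext z1' _ (cderiv_cst 0 z) => v hv; rewrite v0 //.
  by have := cabsD (v - z) z; rewrite subrK; lra.
exists (fun=> 0); last by move=> z /unit_discE z1; rewrite v0.
by apply/within_closed_discP => z _ e e0; exists 1 => // v _ _; rewrite subrr cabs0 ltW.
Qed.

(** With symbol id the operator is [primitive]. The growth estimate holds for every positive Q above
    the Bergman integral, and Q is then taken equal to it when it is not 0. *)
Lemma identity_bounded p (w : C -> R) (Wd : nat -> R) (K c1 c2 B : R) : 1 < p ->
  dyadic_weight w Wd K c1 c2 -> (forall m, 0 < Wd m) -> (forall n, Sseq p Wd n <= B) ->
  T_bounded_to_disc_algebra p w id.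
Proof.
move=> p1 H Wd0 SB; have p0 : 0 < p by exact: lt_trans p1.
have w0 := dyadic_weight_ge0 H.
have [A A0 HA] := annulus_growth p1 H Wd0 SB.
have key f Q : bergman_space p w f -> 0 < Q -> (bergman_integral p w f <= Q%:E)%E ->
    disc_algebra (primitive f) /\ (forall z, cabs z < 1 -> cabs (primitive f z) <= 4 * (A * Q `^ p^-1)).
  move=> [/analyticP hf _] Q0 HQ; have [y [y0 Hy HY]] := HA f Q hf Q0 HQ.
  exact: (primitive_disc_algebra hf y0 Hy HY).
have vE f : volterra id f = primitive f.
  apply/funext => z; apply: cint_ext => t _.
  by have [_ ->] := cderiv_derivable (cderiv_id (t%:C * z)); rewrite mulr1.
have bE f : bergman_space p w f -> exists2 q : R, 0 <= q & bergman_integral p w f = q%:E.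
  move=> [_ fin]; have := bergman_integral_ge0 p f w0.
  move: fin; case: (bergman_integral p w f) => [q||] //= _; rewrite lee_fin => q0.
  by exists q.
split.
  move=> f Xf; rewrite vE; have [q q0 Eq] := bE f Xf.
  have q1 : 0 < q + 1 by rewrite ltr_wpDl.
  by have [] := key f (q + 1) Xf q1; rewrite ?Eq ?lee_fin ?lerDl.
exists (4 * A) => f Xf; have [q q0 Eq] := bE f Xf.
rewrite vE /bergman_norm Eq /=.
have pn : p^-1 != 0 by rewrite invr_eq0 gt_eqF.
move: q0; rewrite le_eqVlt => /predU1P[q0|q0].
  (* For a zero integral every Q > 0 is admissible; the one chosen here bounds the sup norm s by s /
     2. *)
  rewrite -q0 powR0 // mulr0 leNgt; apply/negP; set s := sup_norm _ => s0.
  pose Q := (s / (8 * A)) `^ p.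
  have sA : 0 < s / (8 * A) by rewrite divr_gt0 // mulr_gt0 // ltr0n.
  have Q0 : 0 < Q by exact: powR_gt0.
  have [|_ h] := key f Q Xf Q0; first by rewrite Eq lee_fin -q0 ltW.
  have := sup_norm_le h; rewrite -/s /Q -powRrM divff ?gt_eqF // powRr1 ?(ltW sA) //.
  have -> : 4 * (A * (s / (8 * A))) = s / 2 by field; rewrite gt_eqF.
  by move: s0; lra.
have [|_ h] := key f q Xf q0; first by rewrite Eq.
by have := sup_norm_le h; rewrite mulrA.
Qed.

Lemma identity_not_constant : ~ constant_on_disc (@id C).
Proof.
move=> [c Hc].
have z0 : unit_disc (0 : C) by apply/unit_discE; rewrite cabs0.
have z1 : unit_disc ((2^-1)%:C : C).
  by apply/unit_discE; rewrite cabsR gtr0_norm ?invr_gt0 // invf_lt1 // ltr1n.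
have := Hc _ z1; rewrite -(Hc _ z0) => -[] /eqP; rewrite invr_eq0 pnatr_eq0 //.
Qed.

Lemma identity_analytic : analytic (@id C).
Proof. by apply/analyticP => z _; exists 1; exact: cderiv_id. Qed.

End Boundedness.

(** * The integral condition against boundedness *)

Section Characterization.
Context {R : realType}.
Local Notation C := (Cplx R).
Variables (p : R) (w : C -> R).
Hypotheses (p1 : 1 < p) (rw : regular_weight w).

Let condition := (\int[lebesgue_measure]_(t in `]0%R, 1%R[)
  ((((1 - t) * w t%:C) `^ (p - 1)^-1)%R%:E)^-1 = +oo)%E.

Let pos_or_zero Wd K c1 c2 : dyadic_weight w Wd K c1 c2 ->
  (forall m, 0 < Wd m) \/ exists k, Wd k = 0.
Proof.
move=> H; have [h|/forallNP h] := pselect (exists k, Wd k = 0); [by right|left => m].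
by rewrite lt_neqAle (dyadic_ge0 H) andbT eq_sym; apply/eqP/h.
Qed.

Lemma infinite_integral_constant g : condition -> analytic g ->
  T_bounded_to_Hinfty p w g -> constant_on_disc g.
Proof.
move=> hc ag Tg; have [Wd [K [c1 [c2 H]]]] := regular_dyadic rw.
case: (pos_or_zero H) => [Wd0|[k Wk]]; last first.
  (* A weight that vanishes on the disc lies below the standard profile with alpha = p - 2. *)
  have w0 := dyadic_zero_weight H Wk.
  apply: (@standard_constant _ p (p - 2) p1 (lexx _) 1 w) => // m u hm.
  rewrite w0; last by apply/planar_discE; exact: annulus_disc hm.
  by rewrite lexx /= !mulr_ge0 ?exprn_ge0 // ltW // (standard_dyadic_gt0 p1 (lexx _)).
have c10 := dyadic_c1 H; have c20 := dyadic_c2 H.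
apply: (@bounded_constant R p K (1 + c1 / 2) (2 * c2) Wd w) => //.
- exact: dyadic_K H.
- by rewrite ltrDl divr_gt0.
- by rewrite mulr_gt0.
- exact: dyadic_le H.
- exact: dyadic_ge H.
- move=> m u hm; have /andP[h ->] := dyadic_annulus H hm; rewrite andbT.
  by apply: (dyadic_weight_ge0 H); apply/planar_discE; exact: annulus_disc hm.
exact: (integral_condition_unbounded p1 H Wd0 hc).
Qed.

(** A finite integral excludes a vanishing weight and bounds [Sseq], so [identity_bounded]
    applies. *)
Lemma finite_integral_bounded : ~ condition -> T_bounded_to_disc_algebra p w id.
Proof.
move=> hc; have [Wd [K [c1 [c2 H]]]] := regular_dyadic rw.
case: (pos_or_zero H) => [Wd0|[k Wk]]; last first.
  by case: hc; exact: (integral_condition_zero p1 H Wk).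
have [B HB] : exists B, forall n, Sseq p Wd n <= B.
  apply: contrapT => /forallNP h; apply: hc.
  apply: (integral_condition_infinite p1 H Wd0) => B.
  have /existsNP[n hn] := h B; exists n.
  by rewrite leNgt; apply/negP => /ltW.
exact: (identity_bounded p1 H Wd0 HB).
Qed.

End Characterization.

Theorem theorem1p3 (R : realType) (p : R) (hp : 1 < p) :
  (forall w : Cplx R -> R, regular_weight w ->
     ((forall g : Cplx R -> Cplx R, analytic g ->
         (T_bounded_to_Hinfty p w g <-> constant_on_disc g))
      <->
      (forall g : Cplx R -> Cplx R, analytic g ->
         (T_bounded_to_disc_algebra p w g <-> constant_on_disc g)))
     /\
     ((forall g : Cplx R -> Cplx R, analytic g ->
         (T_bounded_to_disc_algebra p w g <-> constant_on_disc g))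
      <->
      (\int[lebesgue_measure]_(t in `]0%R, 1%R[)
         ((((1 - t) * w t%:C) `^ (p - 1)^-1)%R%:E)^-1 = +oo)%E))
  /\
  (forall alpha : R, p - 2 <= alpha ->
     forall g : Cplx R -> Cplx R, analytic g ->
       T_bounded_to_Hinfty p (standard_weight alpha) g -> constant_on_disc g).
Proof.
split=> [w rw|alpha ha g ag Tg]; last first.
  have c0 : 0 < 2 `^ `|alpha| :> R by exact: powR_gt0.
  exact: (standard_constant hp ha c0 (standard_weight_le hp ha) ag Tg).
set cond := (X in _ /\ (_ <-> X)).
have cH : cond -> forall g, analytic g -> (T_bounded_to_Hinfty p w g <-> constant_on_disc g).
  move=> hc g ag; split; first exact: infinite_integral_constant.
  by case/(constant_bounded p w).
have cA : cond -> forall g, analytic g -> (T_bounded_to_disc_algebra p w g <-> constant_on_disc g).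
  move=> hc g ag; split; last by case/(constant_bounded p w).
  by move/bounded_disc_algebra_Hinfty; exact: infinite_integral_constant.
(* If the integral were finite, the identity would be a bounded symbol that is not constant. *)
have Hc : (forall g, analytic g -> (T_bounded_to_Hinfty p w g <-> constant_on_disc g)) -> cond.
  move=> h; apply: contrapT => /(finite_integral_bounded hp rw)/bounded_disc_algebra_Hinfty.
  by move/(h id (@identity_analytic R)); exact: identity_not_constant.
have Ac : (forall g, analytic g -> (T_bounded_to_disc_algebra p w g <-> constant_on_disc g)) -> cond.
  move=> h; apply: contrapT => /(finite_integral_bounded hp rw).
  by move/(h id (@identity_analytic R)); exact: identity_not_constant.
split; first by split => [/Hc|/Ac].
by split => [/Ac|].
Qed.
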